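(* Let $n\ge2$ be even. (a) Let $N\ge1$, let $B_T$ be the time-$T$ value of a Brownian motion on $SO(N)$ started at the identity (equivalently, an $O(N)$ Brownian motion started at the identity), and let $O_0\in O(N)$ be a random matrix which has equal probability of being in the two connected components of $O(N)$, equivalently $\mathbb E[\det O_0]=0$. Then $$\lim_{T\to\infty}\mathbb E[B_T^{\otimes n}]\,\mathbb E[O_0^{\otimes n}]=\sum_{\pi,\pi'}\mathrm{Wg}^{\mathrm O}_N(\pi,\pi')\,\rho_+([\pi\ \pi']).$$ (b) Let $N\ge2$ be even and let $B_T$ be the time-$T$ value of a Brownian motion on $\mathrm{Sp}(N/2)$ started at the identity. Then $$\lim_{T\to\infty}\mathbb E[B_T^{\otimes n}]=\sum_{\pi,\pi'}\mathrm{Wg}^{\mathrm O}_{-N}(\pi,\pi')\,\rho_-([\pi\ \pi']).$$ In both sums $\pi,\pi'$ range over all matchings of $\{1,\dots,n\}$.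
   Context: $\mathrm{Sp}(N/2)=\{S\in U(N):S^TJS=J\}$ with $J=\begin{pmatrix}0&I_{N/2}\\-I_{N/2}&0\end{pmatrix}$. Brownian motion on $G=SO(N)$ or $\mathrm{Sp}(N/2)$: the process with generator one half of the Laplace–Beltrami operator, for the bi-invariant metric given on the Lie algebra by $\langle X,Y\rangle=\frac N2\mathrm{Tr}(X^*Y)$. Matchings of $[n]=\{1,\dots,n\}$ are partitions into two-element sets. $\#\mathrm{cycles}(\pi,\pi')$ is the number of connected components of the graph with $n$ strands, each having a left and right vertex joined by the strand, with left vertices joined according to $\pi$ and right vertices according to $\pi'$. For $\zeta\in\{N,-N\}$, $\mathrm{Wg}^{\mathrm O}_\zeta$ is the (Moore–Penrose) pseudo-inverse of the Gram matrix $\mathbf G(\pi,\pi')=\zeta^{\#\mathrm{cycles}(\pi,\pi')}$: a symmetric matrix $W$ with $W\mathbf GW=W$, $\mathbf GW\mathbf G=\mathbf G$. Brauer algebra $\mathcal B_n(\zeta)$: the vector space spanned by perfect matchings of $n$ left vertices and $n$ right vertices, with product given by placing diagrams side by side, following lines, and giving a factor $\zeta$ for each closed loop. $[\pi\ \pi']$ is the diagram pairing left vertices according to $\pi$ and right vertices according to $\pi'$. $(i\ j)$ is the diagram joining left $i$ to right $j$, left $j$ to right $i$, and left $r$ to right $r$ for $r\ne i,j$; $\langle i\ j\rangle$ pairs left $i$ with left $j$, right $i$ with right $j$, and left $r$ with right $r$ for $r\ne i,j$. $\rho_+:\mathcal B_n(N)\to\mathrm{End}((\mathbb C^N)^{\otimes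 n})$: the matrix entry of $\rho_+(\alpha)$ at $(\mathbf i,\mathbf j)\in[N]^n\times[N]^n$ is $1$ if, on putting index $i_r$ on left vertex $r$ and $j_r$ on right vertex $r$, paired vertices always carry equal indices, and $0$ otherwise. In particular $\rho_+([\pi\ \pi'])_{\mathbf i\mathbf j}=\prod_{\{a,b\}\in\pi}\delta_{i_ai_b}\prod_{\{a,b\}\in\pi'}\delta_{j_aj_b}$. $\rho_-:\mathcal B_n(-N)\to\mathrm{End}((\mathbb C^N)^{\otimes n})$ is the representation determined by $\rho_-((i\ j))=-\rho_+((i\ j))$ and $\rho_-(\langle i\ j\rangle)_{\mathbf k\mathbf l}=-J_{k_ik_j}J_{l_il_j}\prod_{r\ne i,j}\delta_{k_rl_r}$. Explicitly, $\rho_-([\pi\ \pi'])_{\mathbf i\mathbf j}=(-1)^{n/2}\,\mathrm{sgn}(\sigma_\pi)\,\mathrm{sgn}(\sigma_{\pi'})\,\Delta'_\pi(\mathbf i)\Delta'_{\pi'}(\mathbf j)$, where, writing $\pi=\{\{\pi(1),\pi(2)\},\dots,\{\pi(n-1),\pi(n)\}\}$ with $1=\pi(1)<\pi(3)<\cdots<\pi(n-1)$ and $\pi(2r-1)<\pi(2r)$, $\sigma_\pi\in S_n$ is $r\mapsto\pi(r)$ and $\Delta'_\pi(\mathbf i)=\prod_{r=1}^{n/2}J_{i_{\pi(2r-1)}i_{\pi(2r)}}$. *)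

(* Defs.v *)
From HB Require Import structures.
From mathcomp Require Import all_boot all_order all_algebra all_fingroup.

Set Implicit Arguments.
Unset Strict Implicit.
Unset Printing Implicit Defensive.

Section Matchings.
Local Open Scope nat_scope.

Definition is_matching (T : finType) (p : {set {set T}}) : bool :=
  partition p [set: T] && [forall b in p, #|b| == 2].

Definition matching (T : finType) := {p : {set {set T}} | is_matching p}.

(* A graph on the 2n end points of the n strands, inl being the left ones. *)
Definition cycle_edge (n : nat) (p q : matching 'I_n) : rel ('I_n + 'I_n) :=
  fun x y => match x, y with
  | inl i, inl j => (i != j) && ([set i; j]%SET \in val p)
  | inr i, inr j => (i != j) && ([set i; j]%SET \in val q)
  | inl i, inr j | inr i, inl j => i == j
  end.

Definition ncycles (n : nat) (p q : matching 'I_n) : nat :=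
  n_comp (cycle_edge p q) predT.

(* [:: (p(1), p(2)); (p(3), p(4)); ...], the pairs being listed by increasing
   first component. *)
Definition matching_pairs (n : nat) (p : matching 'I_n) : seq ('I_n * 'I_n) :=
  [seq (a, b) | a : 'I_n <- enum 'I_n,
     b : 'I_n <- [seq b : 'I_n <- enum 'I_n |
                   (a < b) && ([set a; b]%SET \in val p)]].

Definition matching_word (n : nat) (p : matching 'I_n) : seq 'I_n :=
  flatten [seq [:: ab.1; ab.2] | ab <- matching_pairs p].

(* The default value 1 is never taken, see sigma_matchingE. *)
Definition sigma_matching (n : nat) (p : matching 'I_n) : {perm 'I_n} :=
  insubd (1%g : {perm 'I_n}) [ffun r : 'I_n => nth r (matching_word p) r].

Lemma mem_matching_pairs n (p : matching 'I_n) a b :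
  ((a, b) \in matching_pairs p) = (a < b) && ([set a; b]%SET \in val p).
Proof.
apply/allpairsPdep/idP => [[x [y [_]]]|ab].
  by rewrite mem_filter => /andP[xy _] [-> ->].
by exists a, b; split=> //; rewrite ?mem_enum // mem_filter ab mem_enum.
Qed.

Lemma uniq_matching_pairs n (p : matching 'I_n) : uniq (matching_pairs p).
Proof.
apply: allpairs_uniq_dep => [|x _|]; rewrite ?enum_uniq //.
  by rewrite filter_uniq // enum_uniq.
by move=> [x1 y1] [x2 y2] _ _ /= [-> ->].
Qed.

Lemma mem_matching_word n (p : matching 'I_n) i : i \in matching_word p.
Proof.
have /andP[/and3P[/eqP covp _ _] /forall_inP card2] := valP p.
have : i \in cover (val p) by rewrite covp inE.
move=> /bigcupP[b bp ib]; have := card2 _ bp.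
move=> /cards2P[x [y [xy bE]]].
wlog lt_xy : x y xy bE / x < y => [hw|].
  have [lt|lt|/val_inj eq] := ltngtP x y; first exact: (hw x y).
    by apply: (hw y x) => //; rewrite 1?eq_sym // bE setUC.
  by rewrite eq eqxx in xy.
apply/flattenP; exists [:: x; y]; last by move: ib; rewrite bE !inE.
by apply/mapP; exists (x, y) => //; rewrite mem_matching_pairs lt_xy -bE.
Qed.

Lemma size_matching_word n (p : matching 'I_n) : size (matching_word p) <= n.
Proof.
have /andP[partp /forall_inP card2] := valP p.
have nE : n = #|val p| * 2.
  rewrite -(card_uniform_partition _ partp) ?cardsT ?card_ord //.
  by move=> b /card2/eqP.
have -> : size (matching_word p) = size (matching_pairs p) * 2.
  rewrite /matching_word; elim: (matching_pairs p) => //= ab s IHs.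
  by rewrite IHs mulSn.
rewrite [X in _ <= X]nE leq_mul2r /= cardE.
rewrite -(size_map (fun ab : 'I_n * 'I_n => [set ab.1; ab.2]%SET)).
apply: uniq_leq_size => [|b].
  rewrite map_inj_in_uniq ?uniq_matching_pairs // => -[a b] [c d].
  rewrite !mem_matching_pairs /= => /andP[ab _] /andP[cd _] /setP eq.
  have := eq a; rewrite !inE eqxx /= => /esym/orP[]/eqP ac; subst a.
    have := eq b; rewrite !inE eqxx orbT => /esym/orP[]/eqP bd; subst b => //.
    by rewrite ltnn in ab.
  have := eq b; rewrite !inE eqxx orbT => /esym/orP[]/eqP bd; subst b => //.
    by have := ltn_trans ab cd; rewrite ltnn.
  by rewrite ltnn in ab.
by move=> /mapP[[a c] + ->]; rewrite mem_matching_pairs mem_enum => /andP[].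
Qed.

Lemma sigma_matchingE n (p : matching 'I_n) (r : 'I_n) :
  sigma_matching p r = nth r (matching_word p) r.
Proof.
have sub : {subset enum 'I_n <= matching_word p}.
  by move=> i _; exact: mem_matching_word.
have sz : size (matching_word p) <= size (enum 'I_n).
  by rewrite size_enum_ord size_matching_word.
have uw := leq_size_uniq (enum_uniq 'I_n) sub sz.
have [eqsz _] := uniq_min_size (enum_uniq 'I_n) sub sz.
rewrite size_enum_ord in eqsz.
have inj : injectiveb [ffun r : 'I_n => nth r (matching_word p) r].
  apply/injectiveP => i j; rewrite !ffunE.
  rewrite (set_nth_default i j) -?eqsz // => /eqP.
  by rewrite nth_uniq -?eqsz // => /eqP/val_inj.
by rewrite /sigma_matching -pvalE [pval _]val_insubd inj ffunE.
Qed.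

End Matchings.


From mathcomp Require Import complex.
From mathcomp Require Import all_classical all_reals all_analysis.

Import Order.TTheory GRing.Theory Num.Theory.
Import numFieldNormedType.Exports.

Local Open Scope ring_scope.

Section PseudoInverse.
Local Open Scope ring_scope.

(* The Penrose equations, for a real square matrix. *)
Definition is_pseudo_inverse (R : realType) (m : nat) (A W : 'M[R]_m) : Prop :=
  [/\ A *m W *m A = A, W *m A *m W = W,
      (A *m W)^T = A *m W & (W *m A)^T = W *m A].

Definition pseudo_inverse (R : realType) (m : nat) (A : 'M[R]_m) : 'M[R]_m :=
  xget 0 [set W | is_pseudo_inverse A W]%classic.

Lemma is_pseudo_inverse_unique (R : realType) m (A V W : 'M[R]_m) :
  is_pseudo_inverse A V -> is_pseudo_inverse A W -> V = W.
Proof.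
move=> [AVA VAV AVs VAs] [AWA WAW AWs WAs].
have eAV : A *m V = A *m W.
  by rewrite -AVs -{1}AWA -(mulmxA (A *m W)) trmx_mul AVs AWs mulmxA AVA.
have eVA : V *m A = W *m A.
  rewrite -VAs -{1}AWA -mulmxA mulmxA trmx_mul WAs VAs.
  by rewrite -mulmxA (mulmxA A) AVA.
by rewrite -VAV eVA -mulmxA eAV mulmxA WAW.
Qed.

Lemma mulmx_tr_eq0 (R : realType) m k (A : 'M[R]_(m, k)) :
  A *m A^T = 0 -> A = 0.
Proof.
move=> AA0; apply/matrixP => i j; rewrite mxE.
have /matrixP/(_ i i) := AA0; rewrite !mxE.
under eq_bigr do rewrite mxE -expr2.
move=> /eqP; rewrite psumr_eq0 => [/allP/(_ j)|? _]; last exact: sqr_ge0.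
by rewrite mem_index_enum /= sqrf_eq0 => /(_ isT)/eqP.
Qed.

Lemma pseudo_inverseP (R : realType) m (A : 'M[R]_m) :
  A^T = A -> is_pseudo_inverse A (pseudo_inverse A).
Proof.
move=> As.
have cancel2 k (D : 'M[R]_(k, m)) : D *m A *m A = 0 -> D *m A = 0.
  move=> DAA; apply: mulmx_tr_eq0.
  by rewrite trmx_mul As mulmxA DAA mul0mx.
have cancel2l k (D : 'M[R]_(m, k)) : A *m A *m D = 0 -> A *m D = 0.
  move=> AAD; apply: trmx_inj; rewrite trmx0 trmx_mul As; apply: cancel2.
  by apply: trmx_inj; rewrite !trmx_mul trmxK As mulmxA trmx0.
have [B BE] : exists B, B = A *m A *m A by exists (A *m A *m A).
have Bs : B^T = B by rewrite BE !trmx_mul As mulmxA.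
have [Z BZB] : exists Z, B *m Z *m B = B by exists (pinvmx B); rewrite mulmxKpV.
have BZtB : B *m Z^T *m B = B.
  by apply: trmx_inj; rewrite !trmx_mul trmxK Bs mulmxA BZB.
have [Y [Ys BYB YBY]] : exists Y, [/\ Y^T = Y, B *m Y *m B = B & Y *m B *m Y = Y].
  exists (Z *m B *m Z^T); split; first by rewrite !trmx_mul trmxK Bs mulmxA.
    by rewrite !mulmxA BZB BZtB.
  transitivity (Z *m (B *m Z^T *m B) *m Z *m B *m Z^T); first by rewrite !mulmxA.
  by rewrite BZtB -[in X in _ = X]BZB !mulmxA.
have h1 : B *m Y *m A *m A = A *m A.
  apply/eqP; rewrite -subr_eq0; apply/eqP.
  suff : (B *m Y *m A - A) *m A = 0 by rewrite mulmxBl.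
  apply: cancel2; rewrite !mulmxBl; move: BYB; rewrite BE !mulmxA => ->.
  by rewrite subrr.
have h2 : A *m A *m Y *m B = A *m A.
  by apply: trmx_inj; rewrite !trmx_mul Ys Bs As !mulmxA h1.
have sAW : A *m (A *m Y *m A) = A *m Y *m A *m A.
  apply/eqP; rewrite -subr_eq0; apply/eqP.
  have -> : A *m (A *m Y *m A) - A *m Y *m A *m A =
            A *m (A *m Y - Y *m A) *m A.
    by rewrite mulmxBr mulmxBl !mulmxA.
  apply: cancel2; rewrite -!mulmxA; apply: cancel2l.
  rewrite mulmxBl mulmxBr; apply/eqP; rewrite subr_eq0; apply/eqP.
  by rewrite !mulmxA -[RHS]/(_ *m _); move: h1 h2; rewrite BE !mulmxA => -> ->.
have AWA : A *m (A *m Y *m A) *m A = A.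
  apply/eqP; rewrite -subr_eq0; apply/eqP.
  have [E eE] : exists E, A *m (A *m Y *m A) *m A - A = A *m E *m A.
    exists (A *m Y *m A - pinvmx A).
    by rewrite mulmxBr mulmxBl mulmxKpV.
  rewrite eE; apply: cancel2; rewrite -!mulmxA; apply: cancel2l.
  have := congr1 (fun X => A *m X *m A) eE.
  rewrite mulmxBr mulmxBl !mulmxA => <-.
  by move: BYB; rewrite BE !mulmxA => ->; rewrite subrr.
apply: (@xgetPex _ 0 [set W | is_pseudo_inverse A W]%classic).
exists (A *m Y *m A); split=> //.
- by move: YBY; rewrite BE !mulmxA => e; rewrite -[in RHS]e !mulmxA.
- by move: sAW; rewrite !trmx_mul As Ys !mulmxA => ->.
- by move: sAW; rewrite !trmx_mul As Ys !mulmxA => ->.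
Qed.
End PseudoInverse.

Section Weingarten.
Local Open Scope ring_scope.

Definition gram_mx (R : realType) (n : nat) (zeta : R) :
    'M[R]_#|{: matching 'I_n}| :=
  \matrix_(a, b) zeta ^+ ncycles (enum_val a) (enum_val b).

Definition Wg (R : realType) (n : nat) (zeta : R) (p q : matching 'I_n) : R :=
  pseudo_inverse (gram_mx n zeta) (enum_rank p) (enum_rank q).

End Weingarten.

(* R[i] seen as a numClosedFieldType: this is what gives it, and matrices over
   it, the topology of the norm. *)
Definition Cplx (R : realType) : numClosedFieldType := R[i]%C.

Definition real_to_C (R : realType) (x : R) : Cplx R := (x%:C)%C.

Section TensorPower.
Local Open Scope ring_scope.
Variables (R : realType) (N n : nat).
Local Notation C := (Cplx R).

(* End((C^N)^{(x) n}), as matrices in the standard basis, indexed by [N]^n. *)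
Definition tensor_End := 'M[C]_#|{ffun 'I_n -> 'I_N}|.

Definition tensor_mx (F : {ffun 'I_n -> 'I_N} -> {ffun 'I_n -> 'I_N} -> C) :
    tensor_End :=
  \matrix_(a, b) F (enum_val a) (enum_val b).

Definition tensor_power (A : 'M[C]_N) : tensor_End :=
  tensor_mx (fun i j => \prod_(r < n) A (i r) (j r)).

(* [p q]; a Brauer diagram is a perfect matching of 'I_n + 'I_n, whose inl
   (resp. inr) elements are the left (resp. right) vertices. *)
Definition bracket (p q : matching 'I_n) : {set {set 'I_n + 'I_n}} :=
  ([set [set inl x | x in b]%SET | b : {set 'I_n} in val p] :|:
   [set [set inr x | x in b]%SET | b : {set 'I_n} in val q])%SET.

Definition rho_plus (alpha : {set {set 'I_n + 'I_n}}) : tensor_End :=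
  tensor_mx (fun i j =>
    let index_of v := match v with inl r => i r | inr r => j r end in
    ([forall b in alpha, forall u in b, forall v in b,
        index_of u == index_of v] : bool)%:R).

(* [[0, 1], [-1, 0]] in blocks of size N/2, for N even. *)
Definition symplectic_J : 'M[C]_N :=
  \matrix_(i, j) (if (j == i + N./2 :> nat)%N then 1
                  else if (i == j + N./2 :> nat)%N then -1 else 0).

Definition Delta' (p : matching 'I_n) (i : {ffun 'I_n -> 'I_N}) : C :=
  \prod_(ab <- matching_pairs p) symplectic_J (i ab.1) (i ab.2).

(* The value at [p q] of the representation rho_- of the Brauer algebra with
   parameter -N that maps the transposition (i j) to - rho_plus (i j) and <i j>
   to the operator with entries
   - J_(k_i, k_j) J_(l_i, l_j) \prod_(r != i, j) delta_(k_r, l_r). *)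
Definition rho_minus_bracket (p q : matching 'I_n) : tensor_End :=
  tensor_mx (fun i j =>
    (-1) ^+ n./2 * (-1) ^+ sigma_matching p * (-1) ^+ sigma_matching q *
    Delta' p i * Delta' q j).

End TensorPower.

Arguments tensor_power {R N} n A.
Arguments rho_plus R N {n} alpha.
Arguments rho_minus_bracket R N {n} p q.

Section Groups.
Local Open Scope ring_scope.
Local Open Scope classical_set_scope.
Variables (R : realType) (N : nat).
Local Notation C := (Cplx R).

Definition orthogonal_group : set 'M[C]_N :=
  [set g : 'M[C]_N | (forall i j, complex.Im (g i j) = 0) /\ g^T *m g = 1%:M].

Definition special_orthogonal_group : set 'M[C]_N :=
  [set g : 'M[C]_N | orthogonal_group g /\ \det g = 1].

Definition symplectic_group : set 'M[C]_N :=
  [set S : 'M[C]_N | S \is unitarymx /\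
           S^T *m symplectic_J R N *m S = symplectic_J R N].

End Groups.

Section RandomMatrices.
Local Open Scope ring_scope.
Local Open Scope classical_set_scope.
Variables (R : realType) (d : measure_display) (Om : measurableType d).
Variable P : probability Om R.
Local Notation C := (Cplx R).

Definition expectationC (X : Om -> C) : C :=
  real_to_C (\int[P]_w complex.Re (X w)) +
  'i * real_to_C (\int[P]_w complex.Im (X w)).

Definition expectation_mx (m : nat) (X : Om -> 'M[C]_m) : 'M[C]_m :=
  \matrix_(i, j) expectationC (fun w => X w i j).

Definition random_mx (m : nat) (X : Om -> 'M[C]_m) : Prop :=
  forall i j, measurable_fun setT (fun w => complex.Re (X w i j)) /\
              measurable_fun setT (fun w => complex.Im (X w i j)).

End RandomMatrices.

(* Analysis on a closed subgroup G of U(N).  Functions on G are represented by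
   functions on all matrices, only the values on G being relevant. *)
Section LaplaceBeltrami.
Local Open Scope ring_scope.
Local Open Scope classical_set_scope.
Variables (R : realType) (N : nat) (G : set 'M[Cplx R]_N).
Local Notation C := (Cplx R).
Local Notation M := 'M[Cplx R]_N.

Definition expm (X : M) : M :=
  lim ((fun m : nat => \sum_(k < m) (k`!%:R^-1 : C) *: X ^+ k) @ \oo).

Definition lie_algebra : set M :=
  [set X | forall t : R, G (expm (real_to_C t *: X))].

Definition lie_inner (X Y : M) : C :=
  N%:R / 2 * \tr ((X ^t*)%sesqui *m Y).

Definition lie_orthonormal_basis (d : nat) (E : 'I_d -> M) : Prop :=
  [/\ forall a, lie_algebra (E a),
      forall a b, lie_inner (E a) (E b) = (a == b)%:R &
      forall X, lie_algebra X ->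
        exists c : 'I_d -> R, X = \sum_a real_to_C (c a) *: E a].

(* The left-invariant vector field of X acting on f. *)
Definition lie_derive (X : M) (f : M -> R) : M -> R :=
  fun g => (fun t : R => f (g *m expm (real_to_C t *: X)))^`() 0.

Definition continuous_on (f : M -> R) : Prop := {within G, continuous f}.

Fixpoint Ck (k : nat) (f : M -> R) : Prop :=
  continuous_on f /\
  match k with
  | 0 => True
  | k'.+1 => forall X, lie_algebra X ->
      (forall g, G g ->
         derivable (fun t : R => f (g *m expm (real_to_C t *: X))) 0 1) /\
      Ck k' (lie_derive X f)
  end.

Definition smooth (f : M -> R) : Prop := forall k, Ck k f.

(* The metric being bi-invariant, the geodesics through g are the curves
   t |-> g exp(tX), X in the Lie algebra; the trace of the Hessian of f is thus
   the sum of its second derivatives along an orthonormal basis. *)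
Definition laplace_beltrami (d : nat) (E : 'I_d -> M) (f : M -> R) : M -> R :=
  fun g => \sum_a lie_derive (E a) (lie_derive (E a) f) g.

Record feller_semigroup (S : R -> (M -> R) -> (M -> R)) : Prop := {
  feller_continuous : forall (t : R) f, 0 <= t ->
    continuous_on f -> continuous_on (S t f) ;
  feller_linear : forall (t a : R) f h g, 0 <= t ->
    continuous_on f -> continuous_on h -> G g ->
    S t (fun x => a * f x + h x) g = a * S t f g + S t h g ;
  feller_ge0 : forall (t : R) f, 0 <= t -> continuous_on f ->
    (forall g, G g -> 0 <= f g) -> forall g, G g -> 0 <= S t f g ;
  feller_1 : forall (t : R) g, 0 <= t -> G g -> S t (fun=> 1) g = 1 ;
  feller_0 : forall f g, continuous_on f -> G g -> S 0 f g = f g ;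
  feller_add : forall (s t : R) f g, 0 <= s -> 0 <= t -> continuous_on f -> G g ->
    S (s + t) f g = S s (S t f) g ;
  feller_strongly_continuous : forall f, continuous_on f ->
    forall e : R, 0 < e -> \forall t \near 0^'+,
      forall g, G g -> `|S t f g - f g| < e }.

(* L is the infinitesimal generator of S on the smooth functions, for the
   topology of uniform convergence on G. *)
Definition has_generator (S : R -> (M -> R) -> (M -> R))
    (L : (M -> R) -> (M -> R)) : Prop :=
  forall f, smooth f -> forall e : R, 0 < e -> \forall t \near 0^'+,
    forall g, G g -> `|(S t f g - f g) / t - L f g| < e.

End LaplaceBeltrami.

Section BrownianMotion.
Local Open Scope ring_scope.
Local Open Scope classical_set_scope.
Variables (R : realType) (N : nat) (G : set 'M[Cplx R]_N).
Variables (d : measure_display) (Om : measurableType d).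
Variable P : probability Om R.
Local Notation C := (Cplx R).
Local Notation M := 'M[Cplx R]_N.

(* The sigma-algebra generated by the B u, 0 <= u <= s. *)
Definition natural_filtration (B : R -> Om -> M) (s : R) : set (set Om) :=
  <<s [set A | exists (u : R) (i j : 'I_N) (U : set R),
         [/\ 0 <= u <= s, measurable U &
             A = [set w | U (complex.Re (B u w i j))] \/
             A = [set w | U (complex.Im (B u w i j))]] ] >>.

Definition markov_process (S : R -> (M -> R) -> (M -> R))
    (B : R -> Om -> M) : Prop :=
  forall (s t : R) f A, 0 <= s -> 0 <= t -> continuous_on G f ->
    natural_filtration B s A ->
    \int[P]_(w in A) f (B (s + t) w) = \int[P]_(w in A) S t f (B s w).

(* Started at the identity.  The last field says that the generator is one
   half of the Laplace-Beltrami operator. *)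
Record brownian_motion (B : R -> Om -> M) : Prop := {
  brownian_random : forall t : R, 0 <= t -> random_mx (B t) ;
  brownian_in : forall (t : R) w, 0 <= t -> G (B t w) ;
  brownian_0 : forall w, B 0 w = 1%:M ;
  brownian_continuous : forall w,
    {within [set t : R | 0 <= t], continuous (fun t => B t w)} ;
  brownian_generator :
    exists (k : nat) (E : 'I_k -> M) (S : R -> (M -> R) -> (M -> R)),
      [/\ lie_orthonormal_basis G E, feller_semigroup G S,
          has_generator G S (fun f g => 2^-1 * laplace_beltrami E f g) &
          markov_process S B] }.

End BrownianMotion.

(* Main.v *)
Require Import Defs.
From mathcomp Require Import all_boot all_order all_algebra all_fingroup.
From mathcomp Require Import ring lra zify complex.
From mathcomp Require Import all_classical all_reals all_analysis.
From mathcomp Require Import measurable_realfun.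

(** Both parts are one statement about a real matrix K with K^T = eps K and
    K K^T = 1: K = 1 and eps = 1 for the orthogonal groups, K = J and eps = -1 for the
    symplectic group. Let G be the compact group preserving K, or its identity
    component, acting on the n-th tensor power of C^N.

    Convergence. The matrix coefficients of g^((x) n) span a finite-dimensional
    space of functions on G that is stable under the left-invariant vector fields,
    and on which one half of the Laplacian is the multiplication by the Casimir
    operator, a sum of squares of anti-Hermitian operators. The Markov property and
    the generator make the mean of B_T^((x) n) an approximate solution of x' = C x,
    with an error uniform in time. As C is Hermitian and nonpositive, the mean tends
    to the orthogonal projection Pi on ker C ([mean_limit]), and ker C consists of
    the vectors killed by the Lie algebra of G ([brownian_mean_limit]).

    Invariants. Every matching p of the tensor factors gives a vector v_p, obtained
    by placing the form K on each pair, and the Lie algebra kills v_p. Conversely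
    let u be killed by the Lie algebra and orthogonal to all the v_p. If eps = -1,
    then u = 0 ([FFT_antisym]); if eps = 1, every orthogonal matrix O multiplies u
    by det O ([FFT_sym]). The proof contracts pairs of factors of u by the form
    until the result w is traceless on the set A of remaining factors. Then the
    Casimir element of gl_N yields that the squared norms of the E_ab w add up to
    eps #|A| times that of w ([harmonic_norm]). For eps = -1 this forces w = 0; for
    eps = 1 it is an equality case, which forces w into the top exterior power.
    So the mean of O_0^((x) n), whose determinant has mean 0, fixes the v_p and
    kills the invariants orthogonal to them ([orthogonal_mean_fix],
    [orthogonal_mean_kill]): the limit is the orthogonal projection on the span of
    the v_p ([limit_projector]).

    Weingarten sum. If V has the v_p as columns, this projection is V W V^T for any
    W such that (V^T V) W (V^T V) = V^T V. With suitable signs on the v_p, their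
    scalar products are eps^(n/2) (eps N)^(number of cycles) ([gram_value]), because
    a contraction that moves q towards p multiplies the scalar product by eps N and
    adds one cycle. Hence W is eps^(n/2) times the Weingarten matrix, and V W V^T is
    the sum in the statement. *)

Set Implicit Arguments.
Unset Strict Implicit.
Unset Printing Implicit Defensive.

Import Order.TTheory GRing.Theory Num.Theory.
Import numFieldNormedType.Exports.

Local Open Scope ring_scope.

(** * Products of matrices acting on tensors *)
Section TensorOperators.
Variables (C : numClosedFieldType) (N n : nat).
Local Notation idx := {ffun 'I_n -> 'I_N}.
Local Notation End := 'M[C]_#|{ffun 'I_n -> 'I_N}|.
Local Notation ev a := (enum_val a : {ffun 'I_n -> 'I_N}).
Local Open Scope sesquilinear_scope.

Definition tens (f : 'I_n -> 'M[C]_N) : End :=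
  \matrix_(a, b) \prod_(r < n) f r (ev a r) (ev b r).

Definition put (f : 'I_n -> 'M[C]_N) r X : 'I_n -> 'M[C]_N :=
  fun t => if t == r then X else f t.

Definition site r X : End := tens (put (fun=> 1%:M) r X).

Definition upd (i : idx) r x : idx := [ffun t => if t == r then x else i t].

Lemma tensM f g : tens f *m tens g = tens (fun r => f r *m g r).
Proof.
apply/matrixP => a b; rewrite !mxE.
under eq_bigr do rewrite !mxE -big_split /=.
rewrite -(big_enum_val (fun k : idx =>
   \prod_(r < n) (f r (ev a r) (k r) * g r (k r) (ev b r)))) /=.
rewrite -(bigA_distr_bigA (fun r x =>
   f r (ev a r) x * g r x (ev b r))).
by apply: eq_bigr => r _; rewrite !mxE.
Qed.

Lemma eq_tens f g : (forall r, f r = g r) -> tens f = tens g.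
Proof.
by move=> fg; apply/matrixP => a b; rewrite !mxE; apply: eq_bigr => r _; rewrite fg.
Qed.

Lemma tens1 : tens (fun=> 1%:M) = 1%:M.
Proof.
apply/matrixP => a b; rewrite !mxE; have [<-|ab] := eqVneq a b.
  by rewrite big1 // => r _; rewrite mxE eqxx.
have [r abr] : exists r, ev a r != ev b r.
  apply/existsP; rewrite -negb_forall; apply: contra ab => /forallP e.
  by apply/eqP/enum_val_inj/ffunP => r; apply/eqP.
by rewrite (bigD1 r) //= mxE (negPf abr) mul0r.
Qed.

Lemma adj_tens f : (tens f)^t* = tens (fun r => (f r)^t*).
Proof.
apply/matrixP => a b; rewrite !mxE rmorph_prod.
by apply: eq_bigr => r _; rewrite !mxE.
Qed.

Lemma tens_put f r X a b : tens (put f r X) a b =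
  X (ev a r) (ev b r) *
  \prod_(t < n | t != r) f t (ev a t) (ev b t).
Proof.
rewrite mxE (bigD1 r) //= /put eqxx; congr (_ * _).
by apply: eq_bigr => t /negPf ->.
Qed.

Lemma tens_putP f r a X Y :
  tens (put f r (a *: X + Y)) = a *: tens (put f r X) + tens (put f r Y).
Proof.
apply/matrixP => b c; rewrite [RHS]mxE [X in _ = X + _]mxE !tens_put.
by rewrite !mxE mulrDl mulrA.
Qed.

Lemma tens_put0 f r : tens (put f r 0) = 0.
Proof. by apply/matrixP => b c; rewrite tens_put !mxE mul0r. Qed.

Lemma tens_putD f r X Y :
  tens (put f r (X + Y)) = tens (put f r X) + tens (put f r Y).
Proof. by rewrite -[X in put _ _ (X + _)]scale1r tens_putP scale1r. Qed.

Lemma tens_putZ f r a X : tens (put f r (a *: X)) = a *: tens (put f r X).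
Proof. by rewrite -[X in put f r X]addr0 tens_putP tens_put0 addr0. Qed.

Lemma putC f r s X Y t : r != s -> put (put f r X) s Y t = put (put f s Y) r X t.
Proof.
by move=> rs; rewrite /put; case: eqP => // ->; rewrite eq_sym (negPf rs).
Qed.

Lemma siteM r X Y : site r X *m site r Y = site r (X *m Y).
Proof.
rewrite tensM; apply: eq_tens => t; rewrite /put; case: eqP => // _.
by rewrite mulmx1.
Qed.

Lemma site_tens r X f : site r X *m tens f = tens (put f r (X *m f r)).
Proof.
rewrite tensM; apply: eq_tens => t; rewrite /put; case: eqP => [->//|_].
by rewrite mul1mx.
Qed.

Lemma tens_site r X f : tens f *m site r X = tens (put f r (f r *m X)).
Proof.
rewrite tensM; apply: eq_tens => t; rewrite /put; case: eqP => [->//|_].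
by rewrite mulmx1.
Qed.

Lemma site2 r s X Y : r != s ->
  site r X *m site s Y = tens (put (put (fun=> 1%:M) r X) s Y).
Proof.
move=> rs; rewrite site_tens; apply: eq_tens => t; rewrite /put (negPf rs) mulmx1.
by case: eqP => // ->; rewrite (negPf rs).
Qed.

Lemma siteC r s X Y : r != s -> site r X *m site s Y = site s Y *m site r X.
Proof.
move=> rs; have sr : s != r by rewrite eq_sym.
by rewrite (site2 _ _ rs) (site2 _ _ sr); apply: eq_tens => t; exact: putC.
Qed.

Lemma site1 r : site r 1%:M = 1%:M.
Proof. by rewrite -[RHS](tens1); apply: eq_tens => t; rewrite /put; case: eqP. Qed.

Lemma siteD r X Y : site r (X + Y) = site r X + site r Y.
Proof. exact: tens_putD. Qed.

Lemma siteZ r a X : site r (a *: X) = a *: site r X.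
Proof. exact: tens_putZ. Qed.

Lemma site0 r : site r 0 = 0.
Proof. exact: tens_put0. Qed.

Lemma adj_site r X : (site r X)^t* = site r (X^t*).
Proof.
rewrite adj_tens; apply: eq_tens => t; rewrite /put; case: eqP => // _.
by rewrite trmx1 map_mx1.
Qed.

Lemma tr_site r X : (site r X)^T = site r X^T.
Proof.
apply/matrixP => x y; rewrite !mxE; apply: eq_bigr => t _; rewrite /put.
by case: eqP => _; rewrite !mxE // eq_sym.
Qed.

(** Matrices on tensors are indexed by the ranks of multi-indices; reading vectors
    through [vat] lets every sum below run over the multi-indices themselves. *)
Definition vat (w : 'cV[C]_#|{ffun 'I_n -> 'I_N}|) (i : idx) : C :=
  w (enum_rank i) 0.

Lemma vatP w w' : (forall i, vat w i = vat w' i) -> w = w'.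
Proof.
by move=> e; apply/colP => a; have := e (enum_val a); rewrite /vat enum_valK.
Qed.

Lemma vat_tens f w i :
  vat (tens f *m w) i = \sum_(j : idx) (\prod_r f r (i r) (j r)) * vat w j.
Proof.
rewrite /vat mxE (reindex (@enum_rank idx)); last first.
  by exists enum_val => x _; rewrite ?enum_rankK ?enum_valK.
by apply: eq_bigr => j _; rewrite mxE !enum_rankK.
Qed.

Lemma vat_site r X w i :
  vat (site r X *m w) i = \sum_x X (i r) x * vat w (upd i r x).
Proof.
(* Only the multi-indices that agree with i away from r contribute. *)
rewrite vat_tens (bigID (fun j : idx => [forall t, (t != r) ==> (i t == j t)])) /=.
rewrite [X in _ + X]big1 ?addr0 => [|j].
  rewrite (reindex_onto (upd i r) (fun j => j r)) => [|j /forallP ij] /=; last first.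
    apply/ffunP => t; rewrite ffunE; case: eqP => [->//|/eqP tr].
    by have /implyP/(_ tr)/eqP := ij t.
  apply: eq_big => [x|x _].
    rewrite ffunE eqxx eqxx andbT; apply/forallP => t.
    by apply/implyP => /negPf tr; rewrite ffunE tr.
  rewrite (bigD1 r) //= /put eqxx ffunE eqxx big1 ?mulr1 // => t /negPf tr.
  by rewrite tr ffunE tr mxE eqxx.
rewrite negb_forall => /existsP[t]; rewrite negb_imply => /andP[tr ij].
by rewrite (bigD1 t) //= /put (negPf tr) mxE (negPf ij) !mul0r.
Qed.

End TensorOperators.

(** * Squared norms and matrix units *)
Section Norm.
Variable C : numClosedFieldType.
Local Open Scope sesquilinear_scope.

Definition nrm2 m (w : 'cV[C]_m) : C := (w^t* *m w) 0 0.

Lemma nrm2E m (w : 'cV[C]_m) : nrm2 w = \sum_i `|w i 0| ^+ 2.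
Proof.
by rewrite /nrm2 mxE; apply: eq_bigr => i _; rewrite !mxE normCK mulrC.
Qed.

Lemma nrm2_ge0 m (w : 'cV[C]_m) : 0 <= nrm2 w.
Proof. by rewrite nrm2E sumr_ge0 // => i _; rewrite exprn_ge0. Qed.

Lemma nrm2_eq0 m (w : 'cV[C]_m) : nrm2 w = 0 -> w = 0.
Proof.
rewrite nrm2E => /psumr_eq0P w0; apply/colP => i; rewrite mxE.
apply/eqP; rewrite -normr_eq0 -sqrf_eq0; apply/eqP.
by apply: w0 => // j _; rewrite exprn_ge0.
Qed.

Lemma adj_mul m p q (A : 'M[C]_(m, p)) (B : 'M[C]_(p, q)) :
  (A *m B)^t* = B^t* *m A^t*.
Proof. by rewrite trmx_mul map_mxM. Qed.

Lemma adj_scale m p (c : C) (A : 'M[C]_(m, p)) : (c *: A)^t* = c^* *: A^t*.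
Proof. by apply/matrixP => i j; rewrite !mxE rmorphM. Qed.

Lemma adj_sum m p (I : Type) (s : seq I) (P : pred I) (A : I -> 'M[C]_(m, p)) :
  (\sum_(i <- s | P i) A i)^t* = \sum_(i <- s | P i) (A i)^t*.
Proof. by rewrite linear_sum raddf_sum. Qed.

Lemma mul_delta_entry m (A B : 'M[C]_m) a b p q :
  (A *m delta_mx a b *m B) p q = A p a * B b q.
Proof.
rewrite mxE (bigD1 b) //= [X in _ + X]big1 ?addr0 => [|c cb].
  rewrite mxE (bigD1 a) //= [X in _ + X]big1 ?addr0 => [|c ca].
    by rewrite mxE !eqxx mulr1.
  by rewrite mxE (negPf ca) mulr0.
rewrite mxE big1 ?mul0r // => d _.
by rewrite mxE (negPf cb) andbF mulr0.
Qed.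

Lemma delta_mx_mulE m (a b : 'I_m) (X : 'M[C]_m) :
  delta_mx a b *m X = \sum_c X b c *: delta_mx a c.
Proof.
apply/matrixP => p q; rewrite -[delta_mx a b]mul1mx mul_delta_entry mxE.
rewrite summxE (bigD1 q) //= !mxE eqxx andbT big1 ?addr0 => [|c cq].
  by rewrite mulrC.
by rewrite !mxE eq_sym [q == c]eq_sym (negPf cq) andbF mulr0.
Qed.

(** The sum of the E_ba (x) E_ba is the contraction of two factors by the standard
    symmetric form, so that X on one leg may be traded for its transpose on the
    other. F stands for whatever is done to the two legs. *)
Lemma delta_sum_transpose m (V : lmodType C) (F : 'M[C]_m -> 'M[C]_m -> V) X :
  (forall Y, linear (F^~ Y)) -> (forall Y, linear (F Y)) ->
  \sum_b \sum_a F (delta_mx b a *m X) (delta_mx b a) =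
  \sum_b \sum_a F (delta_mx b a) (delta_mx b a *m X^T).
Proof.
move=> Fl Fr; apply: eq_bigr => b _.
have lsum (f : 'M[C]_m -> V) : linear f -> forall (c : 'I_m -> C) (M : 'I_m -> 'M[C]_m),
    f (\sum_k c k *: M k) = \sum_k c k *: f (M k).
  move=> lf c M; have f0 : f 0 = 0.
    have := lf (-1) 0 0; rewrite scaler0 addr0 scaleN1r => ->.
    by rewrite addNr.
  elim/big_rec2: _ => [|k y z _ <-]; first exact: f0.
  by rewrite lf.
under eq_bigr do rewrite delta_mx_mulE (lsum (F^~ _)) //.
rewrite exchange_big; apply: eq_bigr => c _ /=.
rewrite delta_mx_mulE lsum //; apply: eq_bigr => a _.
by rewrite mxE.
Qed.

End Norm.

(** * Contractions and the Lie algebra of a form *)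
Section Form.
Variables (C : numClosedFieldType) (N n : nat) (K : 'M[C]_N) (eps : C).
Hypothesis KT : K^T = eps *: K.
Hypothesis KKT : K *m K^T = 1%:M.
Hypothesis eps2 : eps * eps = 1.
Local Open Scope sesquilinear_scope.
Local Notation idx := {ffun 'I_n -> 'I_N}.
Local Notation vec := 'cV[C]_#|{ffun 'I_n -> 'I_N}|.

(** The complex Lie algebra of the group preserving K; its anti-Hermitian elements
    are the Lie algebra of the compact group. *)
Definition in_form_lie (X : 'M[C]_N) := X^T *m K + K *m X = 0.

(** The contraction of the factors r and s by the form K, followed by the insertion
    of K, as [vat_contr] shows; this presentation by matrix units is the one that
    comes out of a Casimir element, see [casimir]. *)
Definition contr (r s : 'I_n) : 'M[C]_#|{ffun 'I_n -> 'I_N}| :=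
  \sum_b \sum_a site r (delta_mx b a) *m site s (K^T *m delta_mx b a *m K).

Definition lie_act (A : {set 'I_n}) (X : 'M[C]_N) : 'M[C]_#|{ffun 'I_n -> 'I_N}| :=
  \sum_(r in A) site r X.

Definition tens_on_fun (A : {set 'I_n}) (X : 'M[C]_N) : 'I_n -> 'M[C]_N :=
  fun r => if r \in A then X else 1%:M.

Definition tens_on (A : {set 'I_n}) (X : 'M[C]_N) : 'M[C]_#|{ffun 'I_n -> 'I_N}| :=
  tens (tens_on_fun A X).

Lemma KTK : K^T *m K = 1%:M. Proof. by rewrite mulmx1C. Qed.

Lemma KK : K *m K = eps%:M.
Proof.
have -> : K *m K = eps *: (K *m K^T).
  by rewrite KT -scalemxAr scalerA eps2 scale1r.
by rewrite KKT scalemx1.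
Qed.

Lemma lie_actD A X Y : lie_act A (X + Y) = lie_act A X + lie_act A Y.
Proof. by rewrite /lie_act -big_split; apply: eq_bigr => r _; rewrite siteD. Qed.

Lemma lie_actZ A a X : lie_act A (a *: X) = a *: lie_act A X.
Proof. by rewrite /lie_act scaler_sumr; apply: eq_bigr => r _; rewrite siteZ. Qed.

Lemma lie_actN A X : lie_act A (- X) = - lie_act A X.
Proof. by rewrite -scaleN1r lie_actZ scaleN1r. Qed.

Lemma adj_lie_act A X : (lie_act A X)^t* = lie_act A (X^t*).
Proof. by rewrite adj_sum; apply: eq_bigr => r _; rewrite adj_site. Qed.

(** This is twice the projection of a matrix on the Lie algebra of K. On a vector
    killed by that Lie algebra, Y and K^T Y^T K therefore act in the same way. *)
Lemma in_form_lie_sub Y : in_form_lie (Y - K^T *m Y^T *m K).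
Proof.
rewrite /in_form_lie linearB /= !trmx_mul !trmxK mulmxBl mulmxBr.
rewrite -!mulmxA KK mulmxA [in X in _ - X]KT mul_mx_scalar -scalemxAl scalerA.
by rewrite eps2 scale1r !mulmxA KKT mul1mx addrA subrK subrr.
Qed.

Lemma contr_site_comm r s t X : t != r -> t != s ->
  site t X *m contr r s = contr r s *m site t X.
Proof.
move=> tr ts; rewrite mulmx_sumr mulmx_suml; apply: eq_bigr => b _.
rewrite mulmx_sumr mulmx_suml; apply: eq_bigr => a _.
by rewrite mulmxA siteC // -!mulmxA siteC.
Qed.

(** The infinitesimal invariance of the form: the action of X on the two contracted
    factors cancels. *)
Lemma contr_lie r s X : r != s -> in_form_lie X ->
  contr r s *m (site r X + site s X) = 0.
Proof.
move=> rs lX; rewrite mulmxDr !mulmx_suml.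
have -> : \sum_b (\sum_a site r (delta_mx b a) *m
      site s (K^T *m delta_mx b a *m K)) *m site r X =
    \sum_b \sum_a site r (delta_mx b a) *m
      site s (K^T *m (delta_mx b a *m X^T) *m K).
  transitivity (\sum_b \sum_a site r (delta_mx b a *m X) *m
      site s (K^T *m delta_mx b a *m K)).
    apply: eq_bigr => b _; rewrite mulmx_suml; apply: eq_bigr => a _.
    by rewrite -mulmxA -siteC // mulmxA siteM.
  apply: (delta_sum_transpose (F := fun Y Z => site r Y *m site s (K^T *m Z *m K))).
    by move=> Y c Z1 Z2; rewrite /= siteD siteZ mulmxDl -scalemxAl.
  move=> Y c Z1 Z2; rewrite mulmxDr mulmxDl -scalemxAr -scalemxAl siteD siteZ.
  by rewrite mulmxDr -scalemxAr.
rewrite -big_split big1 // => b _ /=; rewrite mulmx_suml -big_split big1 // => a _ /=.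
rewrite -[X in _ + X]mulmxA siteM -mulmxDr -siteD -!mulmxA -!mulmxDr lX.
by rewrite !mulmx0 site0 mulmx0.
Qed.

(** The invariance of the form: it absorbs X on the two contracted factors. *)
Lemma contr_tens_on (A : {set 'I_n}) r s X X' : r \in A -> s \in A -> r != s ->
  X^T *m K *m X = K -> X' *m X = 1%:M ->
  contr r s *m tens_on A X = tens_on (A :\: [set r; s]) X *m contr r s.
Proof.
move=> rA sA rs XKX X'X; have XX' := mulmx1C X'X.
have KX : K *m X = X'^T *m K.
  by rewrite -[in RHS]XKX !mulmxA -trmx_mul XX' trmx1 mul1mx.
(* F Y Z is X on A, except for Y at r and K^T Z K at s. *)
pose F Y Z := tens (put (put (tens_on_fun A X) s (K^T *m Z *m K)) r Y).
have Fl Y : linear (F^~ Y) by move=> c Z1 Z2; exact: tens_putP.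
have Fswap Y Z : F Y Z = tens (put (put (tens_on_fun A X) r Y) s (K^T *m Z *m K)).
  by apply: eq_tens => t; rewrite putC // eq_sym.
have Fr Y : linear (F Y).
  move=> c Z1 Z2; rewrite !Fswap mulmxDr mulmxDl -scalemxAr -scalemxAl.
  exact: tens_putP.
transitivity (\sum_b \sum_a F (delta_mx b a *m X) (delta_mx b a *m X'^T)).
  rewrite mulmx_suml; apply: eq_bigr => b _; rewrite mulmx_suml.
  apply: eq_bigr => a _; rewrite -mulmxA site_tens [tens_on_fun A X s]/tens_on_fun sA.
  rewrite -!mulmxA KX site_tens [put _ _ _ r]/put (negPf rs).
  by rewrite [tens_on_fun A X r]/tens_on_fun rA /F !mulmxA.
transitivity (\sum_b \sum_a F (delta_mx b a) (delta_mx b a)).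
  have := delta_sum_transpose (F := fun Y Z => F (Y *m X) Z) X' _ _.
  move=> <-; first by under eq_bigr do under eq_bigr do rewrite -mulmxA X'X mulmx1.
    by move=> Y c Z1 Z2; rewrite mulmxDl -scalemxAl Fl.
  by move=> Y; exact: Fr.
rewrite mulmx_sumr; apply: eq_bigr => b _; rewrite mulmx_sumr.
apply: eq_bigr => a _; rewrite mulmxA tens_site tens_site.
apply: eq_tens => t; rewrite /put /tens_on_fun !inE !eqxx orbT /= [s == r]eq_sym (negPf rs).
rewrite !mul1mx; have [->|ts] := eqVneq t s.
  by rewrite [s == r]eq_sym (negPf rs).
by case: (eqVneq t r).
Qed.

Lemma lie_act_tens_on A X Y X' : X *m X' = 1%:M ->
  lie_act A Y *m tens_on A X = tens_on A X *m lie_act A (X' *m Y *m X).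
Proof.
move=> XX'; rewrite mulmx_suml mulmx_sumr; apply: eq_bigr => r rA.
rewrite site_tens tens_site; apply: eq_tens => t; rewrite /put /tens_on_fun rA.
by rewrite !mulmxA XX' mul1mx.
Qed.

Lemma lie_act_mul A X Y : lie_act A X *m lie_act A Y =
  lie_act A (X *m Y) + \sum_(r in A) \sum_(s in A | s != r) site r X *m site s Y.
Proof.
rewrite mulmx_suml -big_split; apply: eq_bigr => r rA /=.
by rewrite mulmx_sumr (bigD1 r) //= siteM.
Qed.

Lemma lie_act_sum A (I : Type) (s : seq I) (P : pred I) (X : I -> 'M[C]_N) :
  lie_act A (\sum_(i <- s | P i) X i) = \sum_(i <- s | P i) lie_act A (X i).
Proof.
elim/big_rec2: _ => [|i y1 y2 _ <-]; last by rewrite lie_actD.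
by rewrite /lie_act big1 // => r _; rewrite site0.
Qed.

Lemma lie_act_scalar A c : lie_act A c%:M = (c *+ #|A|)%:M.
Proof.
rewrite -scalemx1 lie_actZ /lie_act; under eq_bigr do rewrite site1.
by rewrite sumr_const -scaler_nat scalerA scalemx1 mulr_natr.
Qed.

(** The terms that act on a single factor add up to a scalar, because the sum of the
    E_ba K^T E_ba K is K^2; those acting on two factors are the contractions. *)
Lemma casimir A : \sum_b \sum_a lie_act A (delta_mx b a) *m lie_act A (K^T *m delta_mx b a *m K)
  = (eps *+ #|A|)%:M + \sum_(r in A) \sum_(s in A | s != r) contr r s.
Proof.
under eq_bigr do under eq_bigr do rewrite lie_act_mul.
under eq_bigr do rewrite big_split /=.
rewrite big_split /= -lie_act_scalar; congr (_ + _).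
  under eq_bigr do rewrite -lie_act_sum.
  rewrite -lie_act_sum -KK; congr (lie_act A _); apply/matrixP => p q.
  rewrite summxE [in RHS]mxE (bigD1 p) //= [X in _ + X]big1 ?addr0 => [|b bp].
    rewrite summxE; apply: eq_bigr => a _; rewrite !mulmxA mul_delta_entry.
    by rewrite -[delta_mx p a]mul1mx mul_delta_entry !mxE eqxx mul1r.
  rewrite summxE big1 // => a _; rewrite !mulmxA mul_delta_entry.
  by rewrite -[delta_mx b a]mul1mx mul_delta_entry !mxE eq_sym (negPf bp) !mul0r.
under eq_bigr do rewrite exchange_big /=.
rewrite exchange_big; apply: eq_bigr => r _ /=.
under eq_bigr do rewrite exchange_big /=.
by rewrite exchange_big.
Qed.

Definition lie_killed A (w : vec) :=
  forall X, in_form_lie X -> lie_act A X *m w = 0.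

Definition traceless (A : {set 'I_n}) (w : vec) :=
  forall r s, r \in A -> s \in A -> r != s -> contr r s *m w = 0.

(** Evaluate the left-hand side of [casimir] against w. As w is killed by the Lie
    algebra, K^T E_ba K acts on it as the adjoint of E_ba does, so that each term is
    a squared norm; as w is traceless, only the scalar remains on the other side.
    The sign eps of the form decides what follows: for eps = -1 the two sides have
    opposite signs, and w = 0 unless A is empty. *)
Lemma harmonic_norm A w : lie_killed A w -> traceless A w ->
  \sum_b \sum_a nrm2 (lie_act A (delta_mx a b) *m w) = (eps *+ #|A|) * nrm2 w.
Proof.
move=> kw tw; pose Z := (w^t* *m ((eps *+ #|A|)%:M +
  \sum_(r in A) \sum_(s in A | s != r) contr r s) *m w) 0 0.
transitivity Z.
  rewrite /Z -casimir mulmx_sumr mulmx_suml summxE; apply: eq_bigr => b _.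
  rewrite mulmx_sumr mulmx_suml summxE; apply: eq_bigr => a _.
  rewrite /nrm2 adj_mul adj_lie_act.
  have -> : (delta_mx a b)^t* = delta_mx b a :> 'M[C]_N.
    by rewrite trmx_delta map_delta_mx.
  have kX := kw _ (in_form_lie_sub (delta_mx a b)).
  rewrite -!mulmxA; congr ((_ *m (_ *m _)) 0 0).
  by apply/eqP; rewrite -subr_eq0 -mulmxBl -lie_actN -lie_actD mulmxA -[delta_mx b a]trmx_delta kX.
rewrite /Z mulmxDr mulmxDl -[in X in _ + X]mulmxA mulmx_suml big1 => [|r rA].
  by rewrite mulmx0 addr0 mul_mx_scalar -scalemxAl mxE.
by rewrite mulmx_suml big1 // => s /andP[sA sr]; apply: tw; rewrite // eq_sym.
Qed.

Lemma vat_lie_act A X w i :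
  vat (lie_act A X *m w) i = \sum_(r in A) \sum_x X (i r) x * vat w (upd i r x).
Proof.
rewrite mulmx_suml /vat summxE; apply: eq_bigr => r _.
exact: vat_site.
Qed.

Lemma vat_lie_act_delta A a b w i : vat (lie_act A (delta_mx a b) *m w) i =
  \sum_(r in A | i r == a) vat w (upd i r b).
Proof.
rewrite vat_lie_act big_mkcondr; apply: eq_bigr => r _.
rewrite (bigD1 b) //= big1 ?addr0 => [|x xb]; rewrite mxE ?eqxx ?andbT.
  by case: eqP; rewrite ?mul1r ?mul0r.
by rewrite (negPf xb) andbF mul0r.
Qed.

Lemma nrm2_vat (w : vec) : nrm2 w = \sum_(i : idx) `|vat w i| ^+ 2.
Proof.
rewrite nrm2E (reindex (@enum_rank idx)) //.
by exists enum_val => x _; rewrite ?enum_rankK ?enum_valK.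
Qed.

Lemma upd_id (i : idx) r : upd i r (i r) = i.
Proof. by apply/ffunP => t; rewrite ffunE; case: eqP => [->|]. Qed.

Lemma upd_upd (i : idx) r x y : upd (upd i r x) r y = upd i r y.
Proof. by apply/ffunP => t; rewrite !ffunE; case: eqP. Qed.

End Form.

(** * Harmonic invariants of a symmetric form *)
Section Harmonic.
Variables (C : numClosedFieldType) (N n : nat) (K : 'M[C]_N).
Hypothesis KT : K^T = 1 *: K.
Hypothesis KKT : K *m K^T = 1%:M.
Local Notation idx := {ffun 'I_n -> 'I_N}.
Local Notation vec := 'cV[C]_#|{ffun 'I_n -> 'I_N}|.
Variables (A : {set 'I_n}) (w : vec).
Hypothesis kw : lie_killed K A w.
Hypothesis tw : traceless K A w.

Definition mult (i : idx) a : nat := #|[set r in A | i r == a]|.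

Lemma sum_mult i : (\sum_a mult i a = #|A|)%N.
Proof.
rewrite -sum1_card (partition_big i predT) //=; apply: eq_bigr => a _.
by rewrite /mult -sum1_card; apply: eq_bigl => r; rewrite inE.
Qed.

Lemma nrm2_diag a : nrm2 (lie_act A (delta_mx a a) *m w) =
  \sum_i (mult i a ^ 2)%:R * `|vat w i| ^+ 2.
Proof.
rewrite nrm2_vat; apply: eq_bigr => i _.
rewrite vat_lie_act_delta (eq_bigr (fun=> vat w i)) => [|r /andP[_ /eqP <-]]; last first.
  by rewrite upd_id.
rewrite sumr_const -[vat w i *+ _]mulr_natl normrM normr_nat exprMn natrX; congr (_%:R ^+ 2 * _).
by apply: eq_card => r; rewrite !inE.
Qed.

(** The equality case of [harmonic_norm] for eps = 1. Its diagonal terms a = b give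
    w_i the weight of the sum of the squares of the multiplicities of the values
    of i, which is at least the sum #|A| of the multiplicities; so all
    multiplicities are at most 1 on the support of w, and the other terms vanish. *)
Lemma harmonic_terms :
  (forall i a, (1 < mult i a)%N -> vat w i = 0) /\
  (forall a b, a != b -> lie_act A (delta_mx a b) *m w = 0).
Proof.
have := harmonic_norm KT KKT (mulr1 1) kw tw.
under eq_bigr => b _ do rewrite (bigD1 b isT) /=.
rewrite big_split /= => hE.
have dE : \sum_a nrm2 (lie_act A (delta_mx a a) *m w) - #|A|%:R * nrm2 w =
    \sum_i \sum_a (mult i a * (mult i a).-1)%:R * `|vat w i| ^+ 2.
  under eq_bigr do rewrite nrm2_diag.
  rewrite exchange_big nrm2_vat mulr_sumr -sumrB; apply: eq_bigr => i _ /=.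
  rewrite -mulr_suml -mulr_suml -mulrBl -!natr_sum -(sum_mult i) -natrB; last first.
    by apply: leq_sum => a _; case: (mult i a) => // k; rewrite leq_pmulr.
  rewrite -sumnB => [|a _]; last by case: (mult i a) => // k; rewrite leq_pmulr.
  congr (_%:R * _); apply: eq_bigr => a _.
  by rewrite -subn1 mulnBr muln1 mulnn.
have S2_ge0 b : 0 <= \sum_(a | a != b) nrm2 (lie_act A (delta_mx a b) *m w).
  by rewrite sumr_ge0 // => a _; exact: nrm2_ge0.
have S1_ge0 i a : 0 <= (mult i a * (mult i a).-1)%:R * `|vat w i| ^+ 2 :> C.
  by rewrite mulr_ge0 // exprn_ge0.
have S1i_ge0 i : 0 <= \sum_a (mult i a * (mult i a).-1)%:R * `|vat w i| ^+ 2 :> C.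
  by rewrite sumr_ge0.
have : \sum_i \sum_a (mult i a * (mult i a).-1)%:R * `|vat w i| ^+ 2 +
    \sum_b \sum_(a | a != b) nrm2 (lie_act A (delta_mx a b) *m w) = 0.
  by rewrite -dE addrAC hE subrr.
move/eqP; rewrite paddr_eq0 ?sumr_ge0 // => /andP[/eqP e1 /eqP e2]; split.
  move=> i a m1; move/psumr_eq0P: e1 => /(_ (fun i _ => S1i_ge0 i) i isT).
  move/psumr_eq0P => /(_ (fun a _ => S1_ge0 i a) a isT)/eqP.
  rewrite mulf_eq0 pnatr_eq0 muln_eq0 sqrf_eq0 normr_eq0.
  by case: (mult i a) m1 => [|[|k]] //= _ /eqP.
move=> a b ab; apply: nrm2_eq0.
move/psumr_eq0P: e2 => /(_ (fun b _ => S2_ge0 b) b isT)/psumr_eq0P.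
by apply=> // c _; exact: nrm2_ge0.
Qed.

Let wmult i a : (1 < mult i a)%N -> vat w i = 0 := harmonic_terms.1 i a.

Lemma harmonic_inj (i : idx) r s : r \in A -> s \in A -> r != s -> i r = i s -> vat w i = 0.
Proof.
move=> rA sA rs irs; apply: (wmult (a := i r)).
rewrite /mult (cardsD1 r) (cardsD1 s) !inE rA sA eqxx eq_sym rs irs eqxx.
by [].
Qed.

(** If i missed the value a, the vanishing of E_(a, i r0) w, read where i has been
    recoloured by a at r0, would be the vanishing of w_i. *)
Lemma harmonic_surj (i : idx) : A != finset.set0 -> vat w i != 0 ->
  forall a, exists2 r, r \in A & i r = a.
Proof.
move=> /set0Pn[r0 r0A] wi a.
have [/existsP[r /andP[rA /eqP]]|/existsPn na] := boolP [exists r, (r \in A) && (i r == a)].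
  by exists r.
have ia r : r \in A -> i r != a by move=> rA; have := na r; rewrite rA.
have ar0 : a != i r0 by rewrite eq_sym ia.
have := congr1 (fun v => vat v (upd i r0 a)) (harmonic_terms.2 _ _ ar0).
rewrite vat_lie_act_delta (bigD1 r0) ?ffunE ?eqxx ?r0A //= big1 => [|r /andP[/andP[rA]]]; last first.
  by rewrite ffunE => + /negPf rr; rewrite rr (negPf (ia r rA)).
rewrite upd_upd upd_id addr0 => w0; move: wi; rewrite w0 /vat mxE.
by rewrite eqxx.
Qed.

Definition permv (p : {perm 'I_N}) (i : idx) : idx :=
  [ffun r => if r \in A then p (i r) else i r].

(** At a multi-index with two values a and no value b, E_ab w is the sum of two
    coordinates of w, which differ by the transposition of a and b. *)
Lemma harmonic_swap (i : idx) a b : A != finset.set0 -> a != b ->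
  vat w (permv (tperm a b) i) = - vat w i.
Proof.
move=> A0 ab; have [/andP[]|nex] :=
  boolP ([exists r in A, i r == a] && [exists s in A, i s == b]); last first.
  have -> : vat w i = 0.
    apply/eqP; apply: contraNT nex => wi.
    have [r rA ir] := harmonic_surj A0 wi a; have [s sA is_] := harmonic_surj A0 wi b.
    by apply/andP; split; apply/exists_inP; [exists r|exists s]; rewrite ?ir ?is_.
  rewrite oppr0; apply/eqP; apply: contraNT nex => wi.
  have [r rA] := harmonic_surj A0 wi a; have [s sA] := harmonic_surj A0 wi b.
  rewrite !ffunE rA sA => /(canRL (tpermK _ _)) is_ /(canRL (tpermK _ _)) ir.
  rewrite tpermL in ir; rewrite tpermR in is_.
  by apply/andP; split; apply/exists_inP; [exists s|exists r]; rewrite ?ir ?is_.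
move=> /exists_inP[r rA /eqP ir] /exists_inP[s sA /eqP is_].
have rs : r != s by apply: contra ab => /eqP rs; rewrite -ir -is_ rs.
have [inj|] := boolP [forall t in A, ((i t == a) ==> (t == r)) && ((i t == b) ==> (t == s))];
  last first.
  move=> /forall_inPn[t tA]; rewrite negb_and !negb_imply => tE.
  have [u [uA ut iu]] : exists u, [/\ u \in A, t != u & i t = i u].
    by case/orP: tE => /andP[/eqP it tu]; [exists r|exists s]; rewrite it ?ir ?is_.
  rewrite (harmonic_inj tA uA ut iu) oppr0.
  by apply: (harmonic_inj tA uA ut); rewrite !ffunE tA uA iu.
have := congr1 (fun v => vat v (upd i s a)) (harmonic_terms.2 _ _ ab).
rewrite vat_lie_act_delta (bigD1 s) ?ffunE ?eqxx ?sA //= upd_upd -is_ upd_id is_.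
(* The first term is w_i, the second one the coordinate after the swap. *)
rewrite (bigD1 r) /= ?ffunE ?(negPf rs) ?rA ?ir ?eqxx //= big1 ?addr0 => [|t]; last first.
  move=> /andP[/andP[/andP[tA +] ts] tr]; rewrite ffunE (negPf ts) => it.
  by have /forall_inP/(_ _ tA) := inj; rewrite it (negPf tr).
have -> : upd (upd i s a) r b = permv (tperm a b) i.
  apply/ffunP => t; rewrite !ffunE; have [->|tr] := eqVneq t r.
    by rewrite rA ir tpermL.
  have [->|ts] := eqVneq t s; first by rewrite sA is_ tpermR.
  case: ifP => // tA; have /forall_inP/(_ _ tA) := inj.
  rewrite (negPf tr) (negPf ts) !implybF => /andP[ta tb].
  by rewrite tpermD // eq_sym.
by rewrite {3}/vat mxE => /eqP; rewrite addrC addr_eq0 => /eqP.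
Qed.

Lemma harmonic_sign p (i : idx) : A != finset.set0 ->
  vat w (permv p i) = (-1) ^+ p * vat w i.
Proof.
move=> A0; have [ts -> ] := prod_tpermP p; elim: ts i => [|[a b] ts IH] i /=.
  rewrite big_nil odd_perm1 mul1r => _; congr (vat w _).
  by apply/ffunP => r; rewrite ffunE perm1 if_same.
move=> /andP[ab dts]; rewrite big_cons odd_mul_tperm.
have -> : permv (tperm a b * \prod_(t <- ts) tperm t.1 t.2)%g i =
    permv (\prod_(t <- ts) tperm t.1 t.2)%g (permv (tperm a b) i).
  by apply/ffunP => r; rewrite !ffunE permM; case: (r \in A).
by rewrite IH // harmonic_swap // signr_addb ab expr1 mulN1r mulrN mulNr.
Qed.

End Harmonic.

Section HarmonicDet.
Variables (C : numClosedFieldType) (N n : nat) (K : 'M[C]_N).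
Hypothesis KT : K^T = 1 *: K.
Hypothesis KKT : K *m K^T = 1%:M.
Local Notation idx := {ffun 'I_n -> 'I_N}.
Local Notation vec := 'cV[C]_#|{ffun 'I_n -> 'I_N}|.
Variables (A : {set 'I_n}) (w : vec).
Hypothesis kw : lie_killed K A w.
Hypothesis tw : traceless K A w.

Lemma in_form_lie_conj X Y : X^T *m K *m X = K -> in_form_lie K Y ->
  forall X', X' *m X = 1%:M -> in_form_lie K (X' *m Y *m X).
Proof.
move=> XKX lY X' X'X; have XX' := mulmx1C X'X.
have KX : K *m X' = X^T *m K by rewrite -{1}XKX -!mulmxA XX' mulmx1.
have KX2 : X'^T *m K = K *m X.
  by rewrite -{1}XKX !mulmxA -trmx_mul XX' trmx1 mul1mx.
rewrite /in_form_lie !trmx_mul -!mulmxA KX2 [K *m (X' *m _)]mulmxA KX.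
by rewrite -mulmxA -mulmxDr !mulmxA -mulmxDl lY mul0mx mulmx0.
Qed.

Lemma traceless_tens_on X X' : X^T *m K *m X = K -> X' *m X = 1%:M ->
  traceless K A (tens_on A X *m w).
Proof.
move=> XKX X'X r s rA sA rs.
by rewrite mulmxA (contr_tens_on _ _ _ XKX X'X) // -mulmxA tw // mulmx0.
Qed.

Lemma lie_killed_tens_on X X' : X^T *m K *m X = K -> X' *m X = 1%:M ->
  lie_killed K A (tens_on A X *m w).
Proof.
move=> XKX X'X Y lY; rewrite mulmxA (lie_act_tens_on _ _ (mulmx1C X'X)) -mulmxA.
by rewrite kw ?mulmx0 //; apply: in_form_lie_conj.
Qed.

(** By the previous lemmas w is supported by the multi-indices that restrict to
    bijections from A onto the colours, and it alternates under the permutations of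
    colours: it lies in the top exterior power. *)
Lemma harmonic_det X X' : A != finset.set0 -> X^T *m K *m X = K -> X' *m X = 1%:M ->
  tens_on A X *m w = \det X *: w.
Proof.
move=> A0 XKX X'X; apply: vatP => i; rewrite [RHS]mxE -/(vat w i).
have kf := lie_killed_tens_on XKX X'X; have tf := traceless_tens_on XKX X'X.
have [/forallP surj|/forallPn[a na]] := boolP [forall a, [exists r in A, i r == a]]; last first.
  have vi0 v : lie_killed K A v -> traceless K A v -> vat v i = 0.
    move=> kv tv; apply: contraNeq na => vi.
    have [r rA ir] := harmonic_surj KT KKT kv tv A0 vi a.
    by apply/exists_inP; exists r => //; apply/eqP.
  by rewrite !vi0 ?mulr0.
have [/forall_inP inj|] := boolP [forall r in A, forall s in A, (i r == i s) ==> (r == s)];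
  last first.
  move=> /forall_inPn[r rA /forall_inPn[s sA]]; rewrite negb_imply => /andP[/eqP irs rs].
  by rewrite !(harmonic_inj KT KKT _ _ rA sA rs irs) ?mulr0.
have iinj r s : r \in A -> s \in A -> i r = i s -> r = s.
  by move=> rA sA irs; have /forall_inP/(_ _ sA) := inj _ rA; rewrite irs eqxx => /eqP.
have /fin_all_exists2[pos posA ipos] a : exists2 r, r \in A & i r = a.
  by have /exists_inP[r rA /eqP] := surj a; exists r.
have posi r : r \in A -> pos (i r) = r by move=> rA; apply: iinj.
(* Only the recolourings of i contribute: the other bijections j differ from i
   outside A, where X is not applied. *)
rewrite vat_tens (bigID [in [set permv A p i | p in [set: 'S_N]]]) /=.
rewrite [X in _ + X]big1 ?addr0; last first.
  move=> j; apply: contraNeq; rewrite mulf_eq0 negb_or => /andP[pj wj].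
  have jinj : injective (fun x => j (pos x)).
    move=> x y jxy; apply: contraNeq wj => xy.
    rewrite (harmonic_inj KT KKT kw tw (posA x) (posA y) _ jxy) //.
    by apply: contra xy => /eqP; rewrite -{2}(ipos x) -{2}(ipos y) => ->.
  apply/imsetP; exists (perm jinj); rewrite ?inE //; apply/ffunP => r.
  rewrite ffunE permE; case: ifP => [rA|rA]; first by rewrite posi.
  apply/eqP; apply: contraNeq pj => ijr; apply/prodf_eq0; exists r => //.
  rewrite /tens_on_fun rA mxE; move: ijr; rewrite [i r == _]eq_sym.
  by case: (j r == i r).
rewrite big_imset /= => [|p q _ _ /ffunP pq]; last first.
  by apply/permP => x; have := pq (pos x); rewrite !ffunE posA ipos.
rewrite /determinant mulr_suml; apply: eq_big => p; rewrite ?inE // => _.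
rewrite (harmonic_sign KT KKT kw tw) //; rewrite mulrCA mulrA; congr (_ * _ * _).
rewrite (bigID [in A]) /= [X in _ * X]big1 ?mulr1 => [|r rA]; last first.
  by rewrite /tens_on_fun ffunE (negPf rA) mxE eqxx.
rewrite (reindex_onto i pos) /= => [|x _]; last exact: ipos.
apply: eq_big => [r|r rA]; last by rewrite /tens_on_fun ffunE rA.
by apply/idP/eqP => [/posi|<-].
Qed.

End HarmonicDet.

(** * Invariants orthogonal to all pairings *)
Section Contractions.
Variables (C : numClosedFieldType) (N n : nat) (K : 'M[C]_N) (eps : C).
Hypothesis KT : K^T = eps *: K.
Hypothesis KKT : K *m K^T = 1%:M.
Hypothesis eps2 : eps * eps = 1.
Local Notation idx := {ffun 'I_n -> 'I_N}.
Local Notation vec := 'cV[C]_#|{ffun 'I_n -> 'I_N}|.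

Definition word (s : seq ('I_n * 'I_n)) : seq 'I_n :=
  flatten [seq [:: ab.1; ab.2] | ab <- s].

Definition unpaired (s : seq ('I_n * 'I_n)) : {set 'I_n} := [set r | r \notin word s].

Definition form_prod (s : seq ('I_n * 'I_n)) (i : idx) : C :=
  \prod_(ab <- s) K (i ab.1) (i ab.2).

Definition contr_seq (s : seq ('I_n * 'I_n)) : 'M[C]_#|{ffun 'I_n -> 'I_N}| :=
  foldr (fun ab M => contr K ab.1 ab.2 *m M) 1%:M s.

Lemma vat_contr r s (w : vec) (i : idx) : r != s ->
  vat (contr K r s *m w) i =
  K (i r) (i s) * \sum_x \sum_y K x y * vat w (upd (upd i r x) s y).
Proof.
move=> rs; rewrite mulmx_suml /vat summxE.
transitivity (\sum_b \sum_a \sum_x \sum_y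
   (delta_mx b a : 'M[C]_N) (i r) x * (K^T *m delta_mx b a *m K) (i s) y *
     vat w (upd (upd i r x) s y)).
  apply: eq_bigr => b _; rewrite mulmx_suml summxE; apply: eq_bigr => a _.
  rewrite -mulmxA -/(vat _ i) vat_site; apply: eq_bigr => x _.
  rewrite vat_site mulr_sumr; apply: eq_bigr => y _.
  by rewrite ffunE eq_sym (negPf rs) mulrA.
rewrite (bigD1 (i r)) //= [X in _ + X]big1 ?addr0 => [|b bi]; last first.
  rewrite big1 // => a _; rewrite big1 // => x _; rewrite big1 // => y _.
  by rewrite mxE eq_sym (negPf bi) !mul0r.
rewrite mulr_sumr; apply: eq_bigr => a _.
rewrite (bigD1 a) //= [X in _ + X]big1 ?addr0 => [|x xa]; last first.
  by rewrite big1 // => y _; rewrite mxE (negPf xa) andbF !mul0r.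
rewrite mulr_sumr; apply: eq_bigr => y _.
by rewrite mul_delta_entry !mxE !eqxx mul1r mulrA.
Qed.

Lemma form_prod_upd s (i : idx) r x : r \notin word s ->
  form_prod s (upd i r x) = form_prod s i.
Proof.
rewrite /form_prod; elim: s => [|[a b] s IH] /=; first by rewrite !big_nil.
rewrite !inE !negb_or => /and3P[ra rb rs]; rewrite !big_cons IH // !ffunE.
by rewrite ![_ == r]eq_sym (negPf ra) (negPf rb).
Qed.

Lemma contr_seqE s (w : vec) (i : idx) : uniq (word s) ->
  vat (contr_seq s *m w) i = form_prod s i *
    \sum_(j : idx | [forall r in unpaired s, j r == i r]) form_prod s j * vat w j.
Proof.
elim: s i => [|[a b] s IH] i /=.
  move=> _; rewrite mul1mx /form_prod big_nil mul1r (big_pred1 i) ?big_nil ?mul1r // => j.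
  apply/forall_inP/eqP => [ji|-> //]; apply/ffunP => r; apply/eqP/ji.
  by rewrite inE.
rewrite inE negb_or => /and3P[/andP[ab aw] bw uw].
rewrite -mulmxA vat_contr // {1}/form_prod big_cons /= -/(form_prod s i) -mulrA.
congr (_ * _); rewrite mulr_sumr.
transitivity (\sum_x \sum_y K x y * (form_prod s i * \sum_(j : idx |
   [forall r in unpaired s, j r == upd (upd i a x) b y r]) form_prod s j * vat w j)).
  apply: eq_bigr => x _; apply: eq_bigr => y _.
  by rewrite IH // !form_prod_upd.
rewrite (partition_big (fun j : idx => j a) predT) //=; apply: eq_bigr => x _.
rewrite (partition_big (fun j : idx => j b) predT) //=; apply: eq_bigr => y _.
rewrite mulrCA; under [RHS]eq_bigr => j jP.
  rewrite /form_prod big_cons /= -mulrA -/(form_prod s j).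
  move: jP => /andP[/andP[_ /eqP ->] /eqP ->]; over.
rewrite /= -mulr_sumr -/(form_prod s i) -mulr_sumr; congr (_ * (_ * _)).
apply: eq_bigl => j; apply/forall_inP/andP => [h|[/andP[/forall_inP h /eqP ja] /eqP jb]].
  split; last by have := h b; rewrite inE bw ffunE eqxx; apply.
  apply/andP; split; last first.
    by have := h a; rewrite inE aw !ffunE eqxx (negPf ab); apply.
  apply/forall_inP => r; rewrite !inE !negb_or => /and3P[ra rb rs].
  by have := h r; rewrite inE rs !ffunE (negPf ra) (negPf rb); apply.
move=> r rs; rewrite !ffunE; have [->|rb] := eqVneq r b; first exact/eqP.
have [->|ra] := eqVneq r a; first exact/eqP.
by apply: h; rewrite !inE !negb_or ra rb; rewrite inE in rs.
Qed.

Lemma lie_killed_contr_seq s w : uniq (word s) ->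
  lie_killed K [set: 'I_n] w -> lie_killed K (unpaired s) (contr_seq s *m w).
Proof.
move=> + kw; elim: s => [|[a b] s IH] /=.
  move=> _ X lX; have -> : unpaired [::] = finset.setT by apply/setP => r; rewrite /unpaired /= !inE.
  by rewrite mul1mx; exact: kw.
rewrite inE negb_or => /and3P[/andP[ab aw] bw uw] X lX.
have := IH uw X lX; set v := contr_seq s *m w => actv.
have actE : lie_act (unpaired s) X = lie_act (unpaired ((a, b) :: s)) X + (site a X + site b X).
  rewrite {1}/lie_act (bigD1 a) ?inE //= (bigD1 b) ?inE ?bw 1?eq_sym //=.
  rewrite addrA addrC; congr (_ + _); apply: eq_bigl => r.
  rewrite !inE !negb_or -/(word s).
  by case: (r == a); case: (r == b); rewrite /= ?andbF ?andbT.
have comm : lie_act (unpaired ((a, b) :: s)) X *m contr K a b =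
    contr K a b *m lie_act (unpaired ((a, b) :: s)) X.
  rewrite /lie_act [LHS]mulmx_suml [RHS]mulmx_sumr; apply: eq_bigr => r.
  rewrite !inE !negb_or => /and3P[ra rb _]; exact: contr_site_comm.
rewrite -mulmxA -/v mulmxA comm -mulmxA.
have -> : lie_act (unpaired ((a, b) :: s)) X *m v = - ((site a X + site b X) *m v).
  by apply/eqP; rewrite -addr_eq0 -mulmxDl -actE actv.
by rewrite mulmxN mulmxA contr_lie // mul0mx oppr0.
Qed.

End Contractions.

(** In this section u is an invariant orthogonal to the vectors attached to all
    perfect matchings of the tensor factors: what is proved is that such a u comes
    from the determinant alone, a form of the first fundamental theorem of
    invariant theory. *)
Section FFT.
Variables (C : numClosedFieldType) (N n : nat) (K : 'M[C]_N) (eps : C).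
Hypothesis KT : K^T = eps *: K.
Hypothesis KKT : K *m K^T = 1%:M.
Hypothesis eps2 : eps * eps = 1.
Local Notation idx := {ffun 'I_n -> 'I_N}.
Local Notation vec := 'cV[C]_#|{ffun 'I_n -> 'I_N}|.
Local Open Scope sesquilinear_scope.

Variable u : vec.
Hypothesis ku : lie_killed K [set: 'I_n] u.
Hypothesis pu : forall s, perm_eq (word s) (enum 'I_n) ->
  \sum_(j : idx) form_prod K s j * vat u j = 0.

Lemma contr_seq_perfect s : uniq (word s) -> unpaired s = finset.set0 -> contr_seq K s *m u = 0.
Proof.
move=> us fs; apply: vatP => i; rewrite contr_seqE // (eq_bigl predT) => [|j].
  rewrite pu ?mulr0 /vat ?mxE //; apply: uniq_perm; rewrite ?enum_uniq // => r.
  by rewrite mem_enum inE; have /setP/(_ r) := fs; rewrite !inE => /negbFE.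
by apply/forall_inP => r; rewrite fs inE.
Qed.

(** Descending induction on the number of contracted factors: a property of
    contracted tensors is proved for s once it holds for s with one more pair, and
    there is nothing to contract when no factor is left. *)
Lemma FFT_ind (P : seq ('I_n * 'I_n) -> Prop) :
  (forall s, uniq (word s) -> unpaired s = finset.set0 -> P s) ->
  (forall s, uniq (word s) -> unpaired s != finset.set0 ->
     (forall r t, r \in unpaired s -> t \in unpaired s -> r != t -> P ((r, t) :: s)) -> P s) ->
  P [::].
Proof.
move=> P0 PS; suff : forall k s, (#|unpaired s| <= k)%N -> uniq (word s) -> P s.
  by move/(_ _ [::] (leqnn _)); apply.
elim=> [|k IH] s sk us.
  by apply: P0 => //; apply/eqP; rewrite -cards_eq0 -leqn0.
have [|f0] := eqVneq (unpaired s) finset.set0; first exact: P0.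
apply: PS => // r t rs ts rt; apply: IH; last first.
  by move: rs ts; rewrite !inE /= inE negb_or rt us => -> ->.
rewrite -ltnS; apply: leq_trans sk; apply: proper_card; apply/properP; split.
  by apply/fintype.subsetP => q; rewrite !inE !negb_or => /and3P[].
by exists r; rewrite // !inE eqxx.
Qed.

(** By induction all contractions of w = contr_seq s u vanish, and [harmonic_norm]
    gives a nonnegative value to a nonpositive multiple of the norm of w. *)
Theorem FFT_antisym : eps = -1 -> u = 0.
Proof.
move=> epsE; rewrite -[u]mul1mx -[1%:M]/(contr_seq K [::]).
apply: (FFT_ind (P := fun s => contr_seq K s *m u = 0)); first exact: contr_seq_perfect.
move=> s us fs IH; apply: nrm2_eq0.
have ks := lie_killed_contr_seq us ku.
have ts : traceless K (unpaired s) (contr_seq K s *m u).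
  by move=> r t rs ts rt; rewrite mulmxA; exact: IH.
have := harmonic_norm KT KKT eps2 ks ts; rewrite epsE => hE.
have : 0 <= - 1 *+ #|unpaired s| * nrm2 (contr_seq K s *m u).
  rewrite -hE sumr_ge0 // => b _; rewrite sumr_ge0 // => a _; exact: nrm2_ge0.
rewrite mulNrn mulNr oppr_ge0 pmulr_rle0 ?ltr0n ?card_gt0 // => le0.
by apply/eqP; rewrite eq_le le0 nrm2_ge0.
Qed.

(** By induction all contractions of v = X w - det(X) w vanish, so that X acts on v
    as a determinant by [harmonic_det]; then v is orthogonal to itself, since
    <v, v> = <w, (X^* - conj (det X)) v> = 0. *)
Theorem FFT_sym X : eps = 1 -> X^T *m K *m X = K -> X \is unitarymx ->
  tens (fun=> X) *m u = \det X *: u.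
Proof.
move=> epsE XKX uX.
pose P s := tens_on (unpaired s) X *m (contr_seq K s *m u) = \det X *: (contr_seq K s *m u).
have : P [::].
  apply: FFT_ind => s us fs; first by rewrite /P contr_seq_perfect // mulmx0 scaler0.
  move=> IH; rewrite /P.
  have ks := lie_killed_contr_seq us ku.
  set w := contr_seq K s *m u in ks *; set d := \det X.
  have /unitarymxP XXt := uX; have XtX := mulmx1C XXt.
  pose v := tens_on (unpaired s) X *m w - d *: w.
  suff v0 : v = 0 by apply/eqP; rewrite -subr_eq0 -/v v0.
  have KT1 : K^T = 1 *: K by rewrite KT epsE.
  have kv : lie_killed K (unpaired s) v.
    move=> Y lY; rewrite mulmxBr -scalemxAr ks // scaler0 subr0.
    exact: (lie_killed_tens_on ks XKX XtX).
  have tv : traceless K (unpaired s) v.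
    move=> r t rs ts rt; rewrite mulmxBr -scalemxAr !mulmxA.
    rewrite (contr_tens_on _ _ _ XKX XtX) // -mulmxA.
    have <- : unpaired ((r, t) :: s) = unpaired s :\: [set r; t].
      by apply/setP => q; rewrite !inE !negb_or; case: (q == r); case: (q == t).
    have := IH r t rs ts rt; rewrite /P /= !mulmxA => ->.
    by rewrite subrr.
  have XtKXt : (X^t*)^T *m K *m X^t* = K.
    rewrite -[in LHS]XKX !mulmxA -trmx_mul XXt trmx1 mul1mx.
    by rewrite -mulmxA XXt mulmx1.
  have Tv : (tens_on (unpaired s) X)^t* *m v = d^* *: v.
    have -> : (tens_on (unpaired s) X)^t* =
        tens_on (unpaired s) (X^t*) :> 'M[C]_#|{ffun 'I_n -> 'I_N}|.
      rewrite adj_tens; apply: eq_tens => r; rewrite /tens_on_fun.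
      by case: ifP => // _; rewrite trmx1 map_mx1.
    by rewrite (harmonic_det KT1 KKT kv tv fs XtKXt XXt) det_map_mx det_tr.
  have vE : v^t* = w^t* *m (tens_on (unpaired s) X)^t* - d^* *: w^t*.
    by rewrite /v linearB linearZ /= map_mxB map_mxZ -adj_mul.
  apply: nrm2_eq0; rewrite /nrm2 vE mulmxBl -mulmxA Tv -scalemxAr -scalemxAl.
  by rewrite subrr mxE.
rewrite /P mul1mx => <-; congr (_ *m _); apply: eq_tens => r.
by rewrite /tens_on_fun inE.
Qed.

End FFT.

(** * Signed pairing vectors *)
Section Signs.
Variables (C : numClosedFieldType) (n : nat) (eps : C) (delta : 'I_n -> 'I_n -> C).
Hypothesis eps2 : eps * eps = 1.
Hypothesis deltaC : forall a b, delta a b = eps * delta b a.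

Lemma perm_cons_mid (T : eqType) (x : T) w w1 w2 :
  perm_eq (x :: w) (w1 ++ x :: w2) = perm_eq w (w1 ++ w2).
Proof. by rewrite perm_sym -[x :: w2]cat1s perm_catCA /= perm_cons perm_sym. Qed.

(** The Vandermonde product of delta along w. For a skew form it provides signs: an
    antisymmetric delta makes it alternate under the permutations of w. For a
    symmetric form one takes delta = 1. *)
Fixpoint alt (w : seq 'I_n) : C :=
  if w is x :: w' then (\prod_(y <- w') delta x y) * alt w' else 1.

Lemma alt_front w1 x w2 :
  alt (w1 ++ x :: w2) = eps ^+ size w1 * alt (x :: w1 ++ w2).
Proof.
elim: w1 => [|y w1 IH] /=; first by rewrite mul1r.
rewrite IH /= big_cat big_cons deltaC exprS.
rewrite [\prod_(z <- w1 ++ w2) delta y z]big_cat /= big_cons.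
ring.
Qed.

Lemma epsX k : (eps ^+ k) ^+ 2 = 1.
Proof. by rewrite -exprM mulnC exprM expr2 eps2 expr1n. Qed.

Lemma sqr_alt_perm w w' : perm_eq w w' -> alt w ^+ 2 = alt w' ^+ 2.
Proof.
elim: w w' => [|x w IH] w'; first by rewrite perm_sym => /perm_nilP ->.
move=> xw; have xw' : x \in w' by rewrite -(perm_mem xw) mem_head.
case/splitPr: xw' xw => w1 w2; rewrite perm_cons_mid => ww.
rewrite (alt_front w1) /= !exprMn epsX mul1r (IH _ ww).
by rewrite (perm_big _ ww).
Qed.

Hypothesis delta_neq0 : forall a b, a != b -> delta a b != 0.

Lemma alt_neq0 w : uniq w -> alt w != 0.
Proof.
elim: w => [|x w IH] /=; first by rewrite oner_eq0.
move=> /andP[xw uw]; rewrite mulf_neq0 ?IH //.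
rewrite prodf_seq_neq0; apply/allP => y yw; apply: delta_neq0.
by apply: contraNneq xw => ->.
Qed.

Variables (N : nat) (K : 'M[C]_N).
Hypothesis KT : K^T = eps *: K.
Hypothesis KKT : K *m K^T = 1%:M.
Local Notation idx := {ffun 'I_n -> 'I_N}.
Local Notation vec := 'cV[C]_#|{ffun 'I_n -> 'I_N}|.

Lemma KC x y : K x y = eps * K y x.
Proof. by have /matrixP/(_ y x) := KT; rewrite !mxE. Qed.

(** The signs make it depend only on the matching, not on the order of the pairs, nor
    on the order inside a pair: see [pairing_perm] and [pairing_ordp]. *)
Definition pairing (s : seq ('I_n * 'I_n)) : vec :=
  \col_a (alt (word s) * form_prod K s (enum_val a)).

Lemma vat_pairing s i : vat (pairing s) i = alt (word s) * form_prod K s i.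
Proof. by rewrite /vat mxE enum_rankK. Qed.

Lemma vat_pairing_cons a b s i : vat (pairing ((a, b) :: s)) i =
  delta a b * K (i a) (i b) *
  (\prod_(y <- word s) (delta a y * delta b y)) * vat (pairing s) i.
Proof.
rewrite !vat_pairing /form_prod /= !big_cons /= big_split -/(word s) /=.
by ring.
Qed.

Lemma word_cat (s t : seq ('I_n * 'I_n)) : word (s ++ t) = word s ++ word t.
Proof. by rewrite /word map_cat flatten_cat. Qed.

Lemma pairing_front s1 ab s2 : pairing (s1 ++ ab :: s2) = pairing (ab :: s1 ++ s2).
Proof.
apply: vatP => i; rewrite !vat_pairing; congr (_ * _); last first.
  by rewrite /form_prod big_cat !big_cons big_cat /= mulrCA.
case: ab => a b.
have -> : word (s1 ++ (a, b) :: s2) = word s1 ++ a :: b :: word s2 by rewrite word_cat.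
have -> : word ((a, b) :: s1 ++ s2) = a :: b :: word s1 ++ word s2 by rewrite -word_cat.
rewrite (alt_front (word s1)) [alt (a :: _ ++ b :: _)]/= (alt_front (word s1)) /=.
rewrite !big_cat !big_cons !big_cat /=.
have e2 := epsX (size (word s1)); set e := eps ^+ _ in e2 *.
by ring: e2.
Qed.

Lemma perm_word (s t : seq ('I_n * 'I_n)) : perm_eq s t -> perm_eq (word s) (word t).
Proof. by move=> st; apply: perm_flatten; apply: perm_map. Qed.

Lemma pairing_perm s t : perm_eq s t -> pairing s = pairing t.
Proof.
elim: s t => [|[a b] s IH] t; first by rewrite perm_sym => /perm_nilP ->.
move=> st; have abt : (a, b) \in t by rewrite -(perm_mem st) mem_head.
case/splitPr: abt st => t1 t2; rewrite perm_cons_mid => st.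
rewrite pairing_front; apply: vatP => i; rewrite !vat_pairing_cons (IH _ st).
by rewrite (perm_big _ (perm_word st)).
Qed.

Definition ordp (ab : 'I_n * 'I_n) : 'I_n * 'I_n :=
  if (ab.1 < ab.2)%N then ab else (ab.2, ab.1).

Lemma perm_word_ordp s : perm_eq (word [seq ordp ab | ab <- s]) (word s).
Proof.
elim: s => [|[a b] s IH] //=; rewrite /ordp /=; case: ifP => _ /=.
  by rewrite !perm_cons.
by rewrite -(perm_cat2l [:: a; b]) in IH; apply: perm_trans IH; rewrite (perm_catCA [:: b] [:: a]).
Qed.

Lemma pairing_ordp s : pairing [seq ordp ab | ab <- s] = pairing s.
Proof.
elim: s => [|[a b] s IH] //=; apply: vatP => i; rewrite vat_pairing_cons -IH.
rewrite [ordp (a, b)]/ordp /=; case: ifP => _; rewrite vat_pairing_cons.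
  by rewrite (perm_big _ (perm_word_ordp s)).
rewrite (perm_big _ (perm_word_ordp s)) /= [in RHS]deltaC [in RHS]KC.
rewrite mulrACA eps2 mul1r; congr (_ * _ * _); apply: eq_bigr => y _.
by rewrite mulrC.
Qed.

Lemma pairing_upd s (i : idx) r x : r \notin word s ->
  vat (pairing s) (upd i r x) = vat (pairing s) i.
Proof. by move=> rs; rewrite !vat_pairing form_prod_upd. Qed.

Lemma sum_sqr_form : \sum_x \sum_y K x y * K x y = N%:R.
Proof.
rewrite -[RHS]mxtrace1 -KKT /mxtrace; apply: eq_bigr => x _.
by rewrite mxE; apply: eq_bigr => y _; rewrite mxE.
Qed.

Lemma contr_pairing_same a b s : uniq (word ((a, b) :: s)) ->
  contr K a b *m pairing ((a, b) :: s) = N%:R *: pairing ((a, b) :: s).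
Proof.
rewrite /= inE negb_or => /and3P[/andP[ab aw] bw uw].
apply: vatP => i; rewrite vat_contr // [RHS]mxE -/(vat _ i) vat_pairing_cons.
rewrite -sum_sqr_form !mulr_suml mulr_sumr; apply: eq_bigr => x _.
rewrite !mulr_suml mulr_sumr; apply: eq_bigr => y _.
rewrite vat_pairing_cons !pairing_upd // !ffunE !eqxx (negPf ab).
by ring.
Qed.

Lemma KTK_sum y c : \sum_x K x y * K x c = (y == c)%:R.
Proof.
have /matrixP/(_ y c) := mulmx1C KKT; rewrite !mxE => <-.
by apply: eq_bigr => x _; rewrite mxE.
Qed.

(** Contracting two factors that belong to different pairs {a, c} and {b, d} joins
    their partners. *)
Lemma contr_pairing_swap a b c d s : uniq (word ((a, c) :: (b, d) :: s)) ->
  contr K a b *m pairing ((a, c) :: (b, d) :: s) =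
  eps *: pairing ((a, b) :: (c, d) :: s).
Proof.
rewrite /= !inE !negb_or.
move=> /andP[/and4P[ac ab ad aw]] /andP[/and3P[cb cd cw]] /andP[/andP[bd bw]] /andP[dw uw].
apply: vatP => i; rewrite vat_contr // [RHS]mxE -/(vat _ i) !vat_pairing_cons /= !big_cons.
rewrite -/(word s).
pose Z := (\prod_(y <- word s) (delta a y * delta c y)) *
  (\prod_(y <- word s) (delta b y * delta d y)) * vat (pairing s) i.
have ZE : Z = (\prod_(y <- word s) (delta a y * delta b y)) *
  (\prod_(y <- word s) (delta c y * delta d y)) * vat (pairing s) i.
  rewrite /Z !big_split /=; ring.
pose D := delta a c * delta b d * (delta a b * delta c b) * (delta a d * delta c d).
transitivity (K (i a) (i b) * (D * Z * \sum_y (\sum_x K x y * K x (i c)) * K y (i d))).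
  congr (_ * _); rewrite exchange_big mulr_sumr; apply: eq_bigr => y _.
  rewrite mulr_suml mulr_sumr; apply: eq_bigr => x _.
  rewrite !vat_pairing_cons !pairing_upd //= !big_cons !ffunE !eqxx.
  rewrite ![c == _]eq_sym ![d == _]eq_sym (negPf ab) (negPf ac) (negPf ad) (negPf bd).
  rewrite [b == c]eq_sym (negPf cb) -/(word s) /Z /D.
  by ring.
have -> : \sum_y (\sum_x K x y * K x (i c)) * K y (i d) = K (i c) (i d).
  rewrite (bigD1 (i c)) //= KTK_sum eqxx mul1r big1 ?addr0 // => y /negPf yc.
  by rewrite KTK_sum yc mul0r.
rewrite ZE /D [delta c b]deltaC.
by ring.
Qed.

Lemma contr_sym (a b : 'I_n) : a != b -> (contr K a b)^T = contr K a b.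
Proof.
move=> ab; rewrite [LHS]linear_sum /= [RHS]exchange_big /=; apply: eq_bigr => x _.
rewrite [LHS]linear_sum; apply: eq_bigr => y _ /=.
apply: etrans (trmx_mul _ _) _; rewrite !tr_site -(siteC _ _ ab).
by rewrite !trmx_mul !trmxK !trmx_delta mulmxA.
Qed.

Lemma sum_upd (F : idx -> C) r : \sum_i \sum_x F (upd i r x) = N%:R * \sum_i F i.
Proof.
rewrite pair_big /= (reindex (fun ix : idx * 'I_N => (upd ix.1 r ix.2, ix.1 r))) /=.
  rewrite (eq_bigr (fun ix : idx * 'I_N => F ix.1)) => [|[i x] _] /=; last first.
    by rewrite upd_upd upd_id.
  rewrite -(pair_big predT predT (fun i _ => F i)) /= mulr_sumr; apply: eq_bigr => i _.
  by rewrite sumr_const card_ord mulr_natl.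
apply: onW_bij; apply: inv_bij => -[i x] /=.
by rewrite upd_upd upd_id ffunE eqxx.
Qed.

Lemma sum_form_prod_sqr s : uniq (word s) ->
  N%:R ^+ size s * \sum_(i : idx) form_prod K s i ^+ 2 = N%:R ^+ n.
Proof.
elim: s => [_|[a b] s IH].
  rewrite mul1r (eq_bigr (fun=> 1)) => [|i _]; last by rewrite /form_prod big_nil expr1n.
  by rewrite sumr_const card_ffun !card_ord natrX.
rewrite /= inE negb_or => /and3P[/andP[ab aw] bw uw]; rewrite -(IH uw).
suff NE : N%:R * \sum_(i : idx) form_prod K ((a, b) :: s) i ^+ 2 =
    \sum_(i : idx) form_prod K s i ^+ 2.
  by rewrite exprSr -mulrA NE.
have [N0|N0] := eqVneq (N%:R : C) 0.
  move/eqP: N0; rewrite pnatr_eq0 => /eqP N0.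
  have I0 (F : idx -> C) : \sum_i F i = 0.
    by rewrite big1 // => i _; have := leq_trans (ltn_ord (i a)) (eq_leq N0).
  by rewrite !I0 !mulr0.
apply: (mulfI N0); rewrite -(sum_upd _ b) -(sum_upd _ a) mulr_sumr.
apply: eq_bigr => i _; rewrite -sum_sqr_form mulr_suml; apply: eq_bigr => x _.
rewrite mulr_suml; apply: eq_bigr => y _.
rewrite {1}/form_prod big_cons /= -/(form_prod K s _) !form_prod_upd //.
by rewrite !ffunE !eqxx (negPf ab) exprMn expr2.
Qed.

End Signs.

(** * Matchings and lists of pairs *)
Section MatchingLists.
Variable n : nat.
Implicit Types (p q : matching 'I_n) (s : seq ('I_n * 'I_n)).

Definition pair_set (ab : 'I_n * 'I_n) : {set 'I_n} := [set ab.1; ab.2].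

Lemma pair_set_ordp ab : pair_set (ordp ab) = pair_set ab.
Proof. by rewrite /pair_set /ordp; case: ifP => //= _; rewrite finset.setUC. Qed.

Lemma matching_block p B : B \in val p ->
  exists ab : 'I_n * 'I_n, [/\ (ab.1 < ab.2)%N, B = pair_set ab & ab \in matching_pairs p].
Proof.
have /andP[_ /forall_inP card2] := valP p; move=> Bp; have := card2 _ Bp.
move=> /cards2P[x [y [xy BE]]]; wlog lt_xy : x y xy BE / (x < y)%N => [hw|].
  have [lt|lt|/val_inj eq] := ltngtP x y; first exact: (hw x y).
    by apply: (hw y x) => //; rewrite 1?eq_sym // BE finset.setUC.
  by rewrite eq eqxx in xy.
by exists (x, y); split; rewrite // mem_matching_pairs lt_xy -BE.
Qed.

Lemma perm_matching_word p : perm_eq (word (matching_pairs p)) (enum 'I_n).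
Proof.
have sub : {subset enum 'I_n <= matching_word p}.
  by move=> i _; exact: mem_matching_word.
have sz : (size (matching_word p) <= size (enum 'I_n))%N.
  by rewrite size_enum_ord size_matching_word.
apply: uniq_perm; rewrite ?enum_uniq //; first exact: (leq_size_uniq (enum_uniq _) sub sz).
by move=> i; rewrite mem_enum inE; exact: mem_matching_word.
Qed.

Lemma size_word s : size (word s) = (2 * size s)%N.
Proof. by elim: s => //= ab s ->; rewrite mulnS. Qed.

Lemma size_matching_pairs p : (2 * size (matching_pairs p))%N = n.
Proof. by rewrite -size_word (perm_size (perm_matching_word p)) size_enum_ord. Qed.

Lemma matching_of_list s : perm_eq (word s) (enum 'I_n) ->
  exists p, perm_eq [seq ordp ab | ab <- s] (matching_pairs p) /\
    forall B, (B \in val p) = (B \in [seq pair_set ab | ab <- s]).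
Proof.
move=> ws; have us : uniq (word s) by rewrite (perm_uniq ws) enum_uniq.
have all_mem i : i \in word s by rewrite (perm_mem ws) mem_enum.
have memw ab i : ab \in s -> i \in pair_set ab -> i \in word s by [].
have ne ab : ab \in s -> ab.1 != ab.2.
  move=> /splitPr sP; case: sP us => s1 s2; rewrite word_cat cat_uniq => /and3P[_ _].
  by rewrite /= inE negb_or => /andP[/andP[]].
have disj ab cd i : ab \in s -> cd \in s -> i \in pair_set ab -> i \in pair_set cd -> ab = cd.
  elim: s us {ws all_mem memw ne} => //= xy s IH; rewrite inE negb_or.
  have inw zt : zt \in s -> i \in pair_set zt -> i \in word s.
    move=> zts izt; apply/flattenP; exists [:: zt.1; zt.2]; first by apply: map_f.
    by move: izt; rewrite !inE.
  move=> /and3P[/andP[_ xw] yw us]; rewrite ![_ \in xy :: s]in_cons.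
  move=> /orP[/eqP->|abs] /orP[/eqP->|cds] //.
  - by move=> ixy icd; have iw := inw _ cds icd; case/set2P: ixy => e; rewrite -e iw in xw yw.
  - by move=> iab ixy; have iw := inw _ abs iab; case/set2P: ixy => e; rewrite -e iw in xw yw.
  - exact: IH.
pose P := [set B in [seq pair_set ab | ab <- s]].
have mP : is_matching P.
  apply/andP; split; last first.
    by apply/forall_inP => B; rewrite inE => /mapP[ab abs ->]; rewrite cards2 ne.
  apply/and3P; split.
  - apply/eqP/setP => i; rewrite inE; apply/bigcupP.
    have /flattenP[_ /mapP[ab abs ->] iab] := all_mem i.
    by exists (pair_set ab); [rewrite inE map_f|rewrite !inE in iab *].
  - apply/finset.trivIsetP => B1 B2; rewrite !inE => /mapP[ab abs ->] /mapP[cd cds ->] ne12.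
    rewrite -setI_eq0; apply/eqP/setP => i; rewrite !inE; apply/negP => /andP[i1 i2].
    by case/negP: ne12; rewrite (disj ab cd i) // !inE.
  - rewrite inE; apply/mapP => -[ab _ /setP/(_ ab.1)]; by rewrite !inE eqxx.
pose p : matching 'I_n := Sub P mP; exists p; split; last by move=> B; rewrite SubK inE.
have uo : uniq [seq ordp ab | ab <- s].
  rewrite map_inj_in_uniq => [|ab cd abs cds e].
    elim: s us {ws all_mem memw ne disj P mP p} => //= ab s IH.
    rewrite inE negb_or => /and3P[/andP[_ aw] bw us]; rewrite IH // andbT.
    apply: contra aw => abs; apply/flattenP; exists [:: ab.1; ab.2]; first exact: map_f.
    by rewrite inE eqxx.
  apply: (disj ab cd ab.1) => //; first by rewrite !inE eqxx.
  by rewrite -pair_set_ordp -e pair_set_ordp !inE eqxx.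
apply: uniq_perm => //; first exact: uniq_matching_pairs.
case=> a b; rewrite mem_matching_pairs SubK inE; apply/mapP/andP => [[cd cds e]|[ab /mapP[cd cds e]]].
  split; last by apply/mapP; exists cd => //; rewrite -pair_set_ordp -e.
  move: e (ne _ cds); case: cd {cds} => c d; rewrite /ordp /=.
  case: ifP => [lt [-> ->] //|ge [-> ->] cd].
  by rewrite ltn_neqAle leqNgt ge andbT eq_sym.
exists cd => //; move: e (ne _ cds); case: cd cds => c d cds /= e cd; rewrite /ordp /=.
have /setP eq := e; have := eq a; have := eq b; rewrite !inE !eqxx orbT /=.
move=> /esym/orP[]/eqP bE /esym/orP[]/eqP aE; move: ab; rewrite bE aE ?ltnn // => lt;
  by rewrite ?lt // ltnNge (ltnW lt).
Qed.

Lemma matching_eq p q : val p \subset val q -> p = q.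
Proof.
move=> /fintype.subsetP pq; apply/val_inj/setP => B; apply/idP/idP; first exact: pq.
have /andP[/and3P[/eqP covp _ _] _] := valP p.
have /andP[/and3P[_ /finset.trivIsetP triv q0] _] := valP q.
move=> Bq; have [x xB] : exists x, x \in B by apply/set0Pn; apply: contraNneq q0 => <-.
have : x \in finset.cover (val p) by rewrite covp inE.
move=> /bigcupP[D Dp xD]; have [<- //|BD] := eqVneq D B.
have := triv _ _ (pq _ Dp) Bq BD; rewrite -setI_eq0 => /eqP/setP/(_ x).
by rewrite !inE xD xB.
Qed.

Lemma matching_pairs_split p a b : a != b -> [set a; b] \in val p ->
  exists s, perm_eq [seq ordp ab | ab <- (a, b) :: s] (matching_pairs p).
Proof.
move=> ab abp; have : ordp (a, b) \in matching_pairs p.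
  rewrite /ordp /=; case: ifP => [lt|ge]; rewrite mem_matching_pairs ?lt //.
  by rewrite ltn_neqAle leqNgt ge eq_sym ab finset.setUC.
move=> /perm_to_rem; set s := rem _ _ => ps; exists s; rewrite perm_sym /=.
apply: perm_trans ps _; rewrite perm_cons.
have -> : [seq ordp ab | ab <- s] = s; last by [].
have : {subset s <= matching_pairs p} by move=> cd /mem_rem.
elim: (s) => //= -[c d] t IH st; rewrite IH => [|x xt]; last first.
  by apply: st; rewrite inE xt orbT.
have := st (c, d) (mem_head _ _); rewrite mem_matching_pairs => /andP[cd _].
by rewrite /ordp /= cd.
Qed.

Lemma matching_partner q a : exists2 c, a != c & [set a; c] \in val q.
Proof.
have /andP[/and3P[/eqP covq _ _] /forall_inP card2] := valP q.
have : a \in finset.cover (val q) by rewrite covq inE.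
move=> /bigcupP[B Bq aB]; have /cards2P[x [y [xy BE]]] := card2 _ Bq.
move: aB Bq; rewrite BE !inE => /orP[/eqP ->|/eqP ->] Bq; first by exists y.
by exists x; rewrite 1?eq_sym // finset.setUC.
Qed.

Lemma matching_blocks_disjoint q B D x : B \in val q -> D \in val q ->
  x \in B -> x \in D -> B = D.
Proof.
have /andP[/and3P[_ /finset.trivIsetP triv _] _] := valP q.
move=> Bq Dq xB xD; apply/eqP; apply: contraTT isT => BD.
by have := triv _ _ Bq Dq BD; rewrite -setI_eq0 => /eqP/setP/(_ x); rewrite !inE xB xD.
Qed.

(** An elementary move of q towards p: a pair {a, b} of p is created from two pairs of
    q, the partners being joined; no pair of p is lost. *)
Lemma matching_move p q : p != q -> exists a b c d s q',
  [/\ uniq (word ((a, c) :: (b, d) :: s)),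
      a != b /\ [set a; b] \in val p,
      perm_eq [seq ordp ab | ab <- (a, c) :: (b, d) :: s] (matching_pairs q),
      perm_eq [seq ordp ab | ab <- (a, b) :: (c, d) :: s] (matching_pairs q') &
      (#|val p :\: val q'| < #|val p :\: val q|)%N].
Proof.
move=> pq; have /subsetPn[B Bp Bq] : ~~ (val p \subset val q).
  by apply: contra pq => /matching_eq ->.
have [[a b] [/= ab BE _]] := matching_block Bp; rewrite /pair_set /= in BE.
have {ab} ab : a != b by apply: contraTneq ab => ->; rewrite ltnn.
have [c ac acq] := matching_partner q a; have [d bd bdq] := matching_partner q b.
have bc : b != c by apply: contraNneq Bq => bc; rewrite BE bc.
have [s' ps'] := matching_pairs_split ac acq.
have us' : uniq (word ((a, c) :: s')).
  rewrite -(perm_uniq (perm_word_ordp _)) (perm_uniq (perm_word ps')).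
  by rewrite (perm_uniq (perm_matching_word q)) enum_uniq.
have : ordp (b, d) \in matching_pairs q.
  rewrite /ordp /=; case: ifP => [lt|ge]; rewrite mem_matching_pairs ?lt //.
  by rewrite ltn_neqAle leqNgt ge eq_sym bd finset.setUC.
rewrite -(perm_mem ps') inE => /orP[/eqP e|].
  have : b \in pair_set (ordp (a, c)) by rewrite -e pair_set_ordp !inE eqxx.
  by rewrite pair_set_ordp !inE eq_sym (negPf ab) (negPf bc).
move=> /mapP[x xs' ex].
case/splitPr: xs' ps' us' => s1 s2 ps' us'.
pose s := s1 ++ s2.
have qs : perm_eq [seq ordp ab | ab <- (a, c) :: (b, d) :: s] (matching_pairs q).
  apply: perm_trans ps'; rewrite /= perm_cons !map_cat /= ex.
  by rewrite perm_cons_mid.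
have ws : perm_eq (word ((a, c) :: (b, d) :: s)) (enum 'I_n).
  apply: perm_trans (perm_matching_word q); apply: perm_trans (perm_word qs).
  by rewrite perm_sym perm_word_ordp.
have ws2 : perm_eq (word ((a, b) :: (c, d) :: s)) (enum 'I_n).
  apply: perm_trans ws; rewrite /= perm_cons.
  exact/permPl/(perm_catCA [:: b] [:: c]).
have uws : uniq (word ((a, c) :: (b, d) :: s)) by rewrite (perm_uniq ws) enum_uniq.
have [q' [qs' memq']] := matching_of_list ws2.
exists a, b, c, d, s, q'; split.
- exact: uws.
- by rewrite -BE.
- exact: qs.
- exact: qs'.
apply: proper_card; apply/properP; split; last first.
  by exists B; rewrite !inE ?Bp ?Bq // memq' BE mem_head.
apply/fintype.subsetP => D; rewrite !inE => /andP[Dq' Dp]; rewrite Dp andbT.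
apply: contra Dq' => Dq; have [x' [_ DE x'q]] := matching_block Dq.
have abp : [set a; b] \in val p by rewrite -BE.
move: x'q; rewrite -(perm_mem qs) /= !inE => /or3P[/eqP x'E|/eqP x'E|/mapP[y ys x'E]].
- rewrite x'E pair_set_ordp in DE.
  have : D = [set a; b] by apply: (matching_blocks_disjoint (x := a) Dp abp); rewrite ?DE !inE eqxx.
  by rewrite DE => /setP/(_ c); rewrite !inE eqxx orbT eq_sym (negPf ac) eq_sym (negPf bc).
- rewrite x'E pair_set_ordp in DE.
  have eD : D = [set a; b].
    by apply: (matching_blocks_disjoint (x := b) Dp abp); rewrite ?DE !inE eqxx ?orbT.
  by case/negP: Bq; rewrite BE -eD.
by rewrite memq' /= !inE DE x'E pair_set_ordp map_f ?orbT.
Qed.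

End MatchingLists.

(** * The Gram matrix of the pairing vectors *)

(** A function that is constant along the edges is a choice of value on each
    component. *)
Lemma card_locally_constant (T : finType) (e : rel T) N : connect_sym e ->
  #|[set f : {ffun T -> 'I_N} | [forall x, forall y, e x y ==> (f x == f y)]]|
  = (N ^ n_comp e predT)%N.
Proof.
move=> se; pose S := {x : T | x \in fingraph.roots e}.
pose rt x : S := Sub (fingraph.root e x) (fingraph.roots_root se x).
pose ext (g : {ffun S -> 'I_N}) := [ffun x => g (rt x)].
have cardS : #|{: S}| = n_comp e predT.
  by rewrite card_sig; apply: eq_card => x; rewrite !inE andbT.
have -> : (N ^ n_comp e predT = #|{: {ffun S -> 'I_N}}|)%N.
  by rewrite card_ffun card_ord cardS.
rewrite -(card_imset (f := ext)); last first.
  move=> g h /ffunP gh; apply/ffunP => x; have := gh (val x); rewrite !ffunE.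
  suff -> : rt (val x) = x by [].
  by apply: val_inj => /=; apply/eqP; exact: (valP x).
apply: eq_card => f; rewrite inE; apply/idP/imsetP => [/forallP fP|[g _ ->]]; last first.
  apply/forallP => x; apply/forallP => y; apply/implyP => exy; rewrite !ffunE.
  apply/eqP; congr (g _); apply: val_inj => /=; apply/eqP.
  by rewrite fingraph.root_connect // connect1.
exists [ffun x : S => f (val x)]; rewrite // ; apply/ffunP => x; rewrite !ffunE /=.
have : connect e x (fingraph.root e x) by exact: connect_root.
move: (fingraph.root e x) => y /connectP[s].
elim: s x => [|z s IH] x /= => [_ ->//|/andP[xz zs] yE].
rewrite -(IH z zs yE); apply/eqP; have /forallP/(_ z)/implyP := fP x; exact.
Qed.

Section Colours.
Variables (C : numClosedFieldType) (n N : nat).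
Implicit Types (p q : matching 'I_n).
Local Notation idx := {ffun 'I_n -> 'I_N}.

Lemma form_prod1 s (i : idx) :
  form_prod (1%:M : 'M[C]_N) s i = (all (fun ab => i ab.1 == i ab.2) s)%:R.
Proof.
rewrite /form_prod; elim: s => [|ab s IH]; first by rewrite big_nil.
by rewrite big_cons IH mxE /=; case: eqP; rewrite ?mul1r ?mul0r.
Qed.

Lemma all_matching_pairs p (i : idx) :
  all (fun ab => i ab.1 == i ab.2) (matching_pairs p) =
  [forall a, forall b, (a != b) && ([set a; b] \in val p) ==> (i a == i b)].
Proof.
apply/allP/forallP => [h a|h [a b]]; last first.
  rewrite mem_matching_pairs => /andP[ab abp] /=; have /forallP/(_ b)/implyP := h a.
  by apply; rewrite abp andbT; apply: contraTneq ab => ->; rewrite ltnn.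
apply/forallP => b; apply/implyP => /andP[ab abp].
have [lt|lt|/val_inj eq] := ltngtP a b; last by rewrite eq.
  by apply: (h (a, b)); rewrite mem_matching_pairs lt abp.
by rewrite eq_sym; apply: (h (b, a)); rewrite mem_matching_pairs lt finset.setUC abp.
Qed.

Lemma cycle_edge_sym p q : symmetric (cycle_edge p q).
Proof. by case=> i [] j //=; rewrite eq_sym // finset.setUC. Qed.

Lemma sum_colourings p q :
  \sum_(i : idx) form_prod (1%:M : 'M[C]_N) (matching_pairs p) i *
    form_prod (1%:M : 'M[C]_N) (matching_pairs q) i = N%:R ^+ ncycles p q.
Proof.
pose ext (i : idx) : {ffun 'I_n + 'I_n -> 'I_N} :=
  [ffun x => match x with inl r | inr r => i r end].
rewrite /ncycles -natrX -card_locally_constant; last first.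
  exact/sym_connect_sym/cycle_edge_sym.
pose A := [set i : idx | all (fun ab => i ab.1 == i ab.2) (matching_pairs p) &&
                         all (fun ab => i ab.1 == i ab.2) (matching_pairs q)].
transitivity (#|A|%:R : C).
  rewrite -sum1_card natr_sum [RHS]big_mkcond; apply: eq_bigr => i _.
  by rewrite !form_prod1 inE; case: all; case: all; rewrite /= ?mulr1 ?mulr0.
congr (_%:R); rewrite -(card_imset (f := ext)) => [|i j /ffunP ij]; last first.
  by apply/ffunP => r; have := ij (inl r); rewrite !ffunE.
apply: eq_card => f; rewrite inE; apply/imsetP/forallP => [[i + ->] x|fP].
  rewrite inE !all_matching_pairs => /andP[/forallP ip /forallP iq].
  apply/forallP => y; rewrite !ffunE; case: x y => [a|a] [b|b] /=; apply/implyP.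
  - by have /forallP/(_ b)/implyP := ip a.
  - by move/eqP->.
  - by move/eqP->.
  - by have /forallP/(_ b)/implyP := iq a.
have flr r : f (inr r) = f (inl r).
  by apply/eqP; have /forallP/(_ (inl r))/implyP := fP (inr r); apply; rewrite /= eqxx.
exists [ffun r => f (inl r)]; last first.
  by apply/ffunP => -[r|r]; rewrite !ffunE // flr.
rewrite inE !all_matching_pairs; apply/andP; split; apply/forallP => a; apply/forallP => b.
  by rewrite !ffunE; have /forallP/(_ (inl b)) := fP (inl a).
by rewrite !ffunE -!flr; have /forallP/(_ (inr b)) := fP (inr a).
Qed.

End Colours.

Section Gram.
Variables (C : numClosedFieldType) (n : nat) (eps : C) (delta : 'I_n -> 'I_n -> C).
Hypothesis eps2 : eps * eps = 1.
Hypothesis deltaC : forall a b, delta a b = eps * delta b a.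
Hypothesis delta_neq0 : forall a b, a != b -> delta a b != 0.
Variables (N : nat) (K : 'M[C]_N).
Hypothesis KT : K^T = eps *: K.
Hypothesis KKT : K *m K^T = 1%:M.
Hypothesis N_gt0 : (0 < N)%N.
Implicit Types (p q : matching 'I_n).

Definition gram p q : C :=
  ((pairing delta K (matching_pairs p))^T *m pairing delta K (matching_pairs q)) 0 0.

Lemma gramE p q : gram p q = \sum_(i : {ffun 'I_n -> 'I_N})
  vat (pairing delta K (matching_pairs p)) i * vat (pairing delta K (matching_pairs q)) i.
Proof.
rewrite /gram mxE (reindex (@enum_rank {ffun 'I_n -> 'I_N})); last first.
  by exists enum_val => x _; rewrite ?enum_rankK ?enum_valK.
by apply: eq_bigr => i _; rewrite mxE.
Qed.

(** Move the contraction of a and b from one side of the scalar product to the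
    other: it multiplies the vector of p by N, and turns the one of q into eps times the one
    of q'. *)
Lemma gram_move p q a b c d s q' :
  uniq (word ((a, c) :: (b, d) :: s)) -> a != b -> [set a; b] \in val p ->
  perm_eq [seq ordp ab | ab <- (a, c) :: (b, d) :: s] (matching_pairs q) ->
  perm_eq [seq ordp ab | ab <- (a, b) :: (c, d) :: s] (matching_pairs q') ->
  N%:R * gram p q = eps * gram p q'.
Proof.
move=> us ab abp qs qs'; have [t ts] := matching_pairs_split ab abp.
have pairE r u : perm_eq [seq ordp ab | ab <- r] (matching_pairs u) ->
    pairing delta K (matching_pairs u) = pairing delta K r.
  move=> ru; rewrite -(pairing_ordp eps2 deltaC KT r).
  by apply/esym/(pairing_perm eps2 deltaC).
have ut : uniq (word ((a, b) :: t)).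
  rewrite -(perm_uniq (perm_word_ordp _)) (perm_uniq (perm_word ts)).
  by rewrite (perm_uniq (perm_matching_word p)) enum_uniq.
have := contr_pairing_same delta KKT ut; rewrite -(pairE _ _ ts) => h1.
have := contr_pairing_swap deltaC KKT us; rewrite -(pairE _ _ qs) -(pairE _ _ qs') => h2.
have := congr1 (fun v => ((pairing delta K (matching_pairs p))^T *m v) 0 0) h2.
rewrite mulmxA -[contr K a b](contr_sym K ab) -trmx_mul h1 linearZ /= -scalemxAl -scalemxAr.
have scE (x : C) (M : 'M[C]_1) : (x *: M) 0 0 = x * M 0 0 by rewrite mxE.
by rewrite !scE.
Qed.

Lemma sqr_alt_matching p : alt delta (word (matching_pairs p)) ^+ 2 = alt delta (enum 'I_n) ^+ 2.
Proof. exact/(sqr_alt_perm eps2 deltaC)/perm_matching_word. Qed.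

Lemma gram_diag p : gram p p = alt delta (enum 'I_n) ^+ 2 * N%:R ^+ n./2.
Proof.
rewrite gramE; under eq_bigr do rewrite vat_pairing -expr2 exprMn.
rewrite -mulr_sumr sqr_alt_matching; congr (_ * _).
have us : uniq (word (matching_pairs p)).
  by rewrite (perm_uniq (perm_matching_word p)) enum_uniq.
have N0 : (N%:R : C) != 0 by rewrite pnatr_eq0 -lt0n.
have szp := size_matching_pairs p; rewrite mul2n in szp.
have nE : N%:R ^+ n = N%:R ^+ size (matching_pairs p) * N%:R ^+ size (matching_pairs p) :> C.
  by rewrite -exprD addnn szp.
have -> : n./2 = size (matching_pairs p) by rewrite -[RHS]doubleK szp.
have := sum_form_prod_sqr KKT us; rewrite nE.
by move/(mulfI (expf_neq0 _ N0)).
Qed.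

End Gram.

Section GramValue.
Variables (C : numClosedFieldType) (n : nat).
Implicit Types (p q : matching 'I_n).

Lemma alt_1 (w : seq 'I_n) : alt (fun _ _ => 1 : C) w = 1.
Proof. by elim: w => //= x w ->; rewrite mulr1 big1. Qed.

(** The symmetric case has no signs and counts colourings. Taken at N = 2, it is used
    below to follow the number of cycles along the moves. *)
Lemma gram_unit N p q : gram (fun=> fun=> 1) (1%:M : 'M[C]_N) p q = N%:R ^+ ncycles p q.
Proof.
rewrite -sum_colourings gramE; apply: eq_bigr => i _; rewrite !vat_pairing.
by rewrite !alt_1 !mul1r.
Qed.

Lemma ncycles_diag p : ncycles p p = n./2.
Proof.
have d1 (a b : 'I_n) : (1 : C) = 1 * 1 by rewrite mulr1.
have := gram_diag (delta := fun=> fun=> 1) (mulr1 1) d1 (_ : 1 *m 1^T = 1%:M :> 'M[C]_2) isT p.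
rewrite trmx1 mulmx1 => /(_ erefl); rewrite gram_unit.
rewrite alt_1 expr1n mul1r -!natrX => /eqP; rewrite eqr_nat => /eqP.
by apply: expnI.
Qed.

Lemma ncycles_move p q a b c d s q' :
  uniq (word ((a, c) :: (b, d) :: s)) -> a != b -> [set a; b] \in val p ->
  perm_eq [seq ordp ab | ab <- (a, c) :: (b, d) :: s] (matching_pairs q) ->
  perm_eq [seq ordp ab | ab <- (a, b) :: (c, d) :: s] (matching_pairs q') ->
  ncycles p q' = (ncycles p q).+1.
Proof.
move=> us ab abp qs qs'; have d1 (x y : 'I_n) : (1 : C) = 1 * 1 by rewrite mulr1.
have KT : (1%:M : 'M[C]_2)^T = 1 *: 1%:M by rewrite trmx1 scale1r.
have KKT : (1%:M : 'M[C]_2) *m 1%:M^T = 1%:M by rewrite trmx1 mulmx1.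
have := gram_move (mulr1 1) d1 KT KKT us ab abp qs qs'.
rewrite !gram_unit mul1r -exprS -!natrX => /eqP; rewrite eqr_nat => /eqP.
by move/expnI => /(_ isT) ->.
Qed.

Variables (eps : C) (delta : 'I_n -> 'I_n -> C).
Hypothesis eps2 : eps * eps = 1.
Hypothesis deltaC : forall a b, delta a b = eps * delta b a.
Variables (N : nat) (K : 'M[C]_N).
Hypothesis KT : K^T = eps *: K.
Hypothesis KKT : K *m K^T = 1%:M.
Hypothesis N_gt0 : (0 < N)%N.

(** Each move of q towards p multiplies the scalar product by eps N, by [gram_move],
    and adds a cycle, by [ncycles_move]. The induction is on the number of pairs of p
    missing from q. *)
Lemma gram_value p q : gram delta K p q =
  alt delta (enum 'I_n) ^+ 2 * (eps ^+ n./2 * (eps * N%:R) ^+ ncycles p q).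
Proof.
have diag : gram delta K p p =
    alt delta (enum 'I_n) ^+ 2 * (eps ^+ n./2 * (eps * N%:R) ^+ ncycles p p).
  rewrite ncycles_diag (gram_diag eps2 deltaC) //; congr (_ * _).
  by rewrite -exprMn mulrA eps2 mul1r.
move: {2}#|val p :\: val q| (leqnn #|val p :\: val q|) => k; elim: k q => [|k IH] q pqk.
  have /matching_eq <- // : val p \subset val q by rewrite -finset.setD_eq0 -cards_eq0 -leqn0.
have [<- //|pq] := eqVneq p q.
have [a [b [c [d [s [q' [us [ab abp] qs qs' lt]]]]]]] := matching_move pq.
have N0 : (N%:R : C) != 0 by rewrite pnatr_eq0 -lt0n.
apply: (mulfI N0); rewrite (gram_move eps2 deltaC KT KKT us ab abp qs qs').
rewrite IH; last by rewrite -ltnS; exact: leq_trans lt pqk.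
rewrite (ncycles_move us ab abp qs qs') [(eps * _) ^+ _.+1]exprS.
set X := (eps * N%:R) ^+ _; set Y := _ ^+ n./2; set Z := alt delta (enum _).
transitivity ((eps * eps) * (N%:R * (Z ^+ 2 * (Y * X)))); first by ring.
by rewrite eps2 mul1r.
Qed.

End GramValue.

(** * The projection on the pairing vectors *)
Section RealProjector.
Variables (C : numClosedFieldType) (m k : nat) (V : 'M[C]_(m, k)) (W : 'M[C]_k).
Hypothesis Vreal : map_mx Num.conj V = V.
Hypothesis GWG : V^T *m V *m W *m (V^T *m V) = V^T *m V.
Local Open Scope sesquilinear_scope.

Lemma mulmx_adj_eq0 p q (D : 'M[C]_(p, q)) : D^t* *m D = 0 -> D = 0.
Proof.
move=> DD; apply/matrixP => i j; rewrite mxE.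
have /colP/(_ i) : col j D = 0.
  apply: nrm2_eq0; rewrite /nrm2.
  have -> : ((col j D)^t* *m col j D) 0 0 = (D^t* *m D) j j.
    by rewrite !mxE; apply: eq_bigr => x _; rewrite !mxE.
  by rewrite DD mxE.
by rewrite !mxE.
Qed.

(** When W is a generalised inverse of V^T V, for a real V, this is the orthogonal
    projection on the range of V: the form in which a Weingarten sum appears. *)
Definition projector := V *m W *m V^T.

Let Vt : V^t* = V^T. Proof. by rewrite -map_trmx Vreal. Qed.
Let VTt : (V^T)^t* = V. Proof. by rewrite trmxK Vreal. Qed.

Lemma mul_projector : V^T *m projector = V^T.
Proof.
pose D := V^T *m projector - V^T; suff D0 : D = 0 by apply/eqP; rewrite -subr_eq0 -/D D0.
have DE : D = (V^T *m V *m W - 1%:M) *m V^T.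
  by rewrite mulmxBl mul1mx /D /projector !mulmxA.
have DV : D *m V = 0.
  by rewrite DE -mulmxA mulmxBl mul1mx GWG subrr.
have DtE : D^t* = V *m (V^T *m V *m W - 1%:M)^t* by rewrite DE adj_mul VTt.
have : (D^t*)^t* *m D^t* = 0 by rewrite trmxCK DtE mulmxA DV mul0mx.
by move/mulmx_adj_eq0 => Dt0; rewrite -[D]trmxCK Dt0 trmx0 map_mx0.
Qed.

Lemma projector_herm : projector^t* = projector.
Proof.
have PtP : projector^t* *m projector = projector^t*.
  by rewrite {1 3}/projector !adj_mul VTt Vt -!mulmxA mul_projector.
have := congr1 (fun M : 'M[C]_m => M^t*) PtP.
by rewrite adj_mul trmxCK PtP.
Qed.

End RealProjector.

Section LimitProjector.
Variables (C : numClosedFieldType) (N n : nat) (K : 'M[C]_N).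
Local Open Scope sesquilinear_scope.
Local Notation vec := 'cV[C]_#|{ffun 'I_n -> 'I_N}|.

Definition invariant_projection (Pi : 'M[C]_#|{ffun 'I_n -> 'I_N}|) :=
  [/\ Pi^t* = Pi, forall x : vec, lie_killed K [set: 'I_n] (Pi *m x) &
      forall x : vec, lie_killed K [set: 'I_n] x -> Pi *m x = x].

Variables (k : nat) (V : 'M[C]_(#|{ffun 'I_n -> 'I_N}|, k)) (W : 'M[C]_k).
Hypothesis Vreal : map_mx Num.conj V = V.
Hypothesis GWG : V^T *m V *m W *m (V^T *m V) = V^T *m V.
Hypothesis Vinv : forall a, lie_killed K [set: 'I_n] (col a V).
Variables Pi Rm : 'M[C]_#|{ffun 'I_n -> 'I_N}|.
Hypothesis PiK : invariant_projection Pi.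
Hypothesis Rm_fix : Rm^t* *m V = V.
Hypothesis Rm_kill : forall u : vec,
  lie_killed K [set: 'I_n] u -> V^T *m u = 0 -> Rm^t* *m u = 0.

Lemma mx_eq_vec p q (A B : 'M[C]_(p, q)) : (forall x : 'cV_q, A *m x = B *m x) -> A = B.
Proof.
move=> AB; apply/matrixP => i j; have /colP/(_ i) := AB (delta_mx j 0).
by rewrite -!colE !mxE.
Qed.

(** The adjoint of Pi Rm first projects on the invariants; there the adjoint of Rm is
    the identity on the range of V, and zero on its orthogonal complement. *)
Lemma limit_projector : Pi *m Rm = projector V W.
Proof.
have [Pi_herm Pi_inv Pi_fix] := PiK; set P := projector V W.
have PiV : Pi *m V = V.
  apply/matrixP => i j; have := Pi_fix _ (Vinv j); rewrite !colE mulmxA -!colE.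
  by move=> /colP/(_ i); rewrite !mxE.
have actV X : in_form_lie K X -> lie_act [set: 'I_n] X *m V = 0.
  move=> lX; apply/matrixP => i j; have := Vinv j lX; rewrite colE mulmxA -colE.
  by move=> /colP/(_ i); rewrite !mxE.
have PPi : P *m Pi = P.
  have Ph : P^t* = P := projector_herm Vreal GWG.
  by rewrite -Pi_herm -Ph -adj_mul /P /projector !mulmxA PiV.
have RPi : Rm^t* *m Pi = P.
  rewrite -[RHS]PPi; apply: mx_eq_vec => x; rewrite -[LHS]mulmxA -[RHS]mulmxA.
  set u := Pi *m x; have ku : lie_killed K [set: 'I_n] u := Pi_inv x.
  have RP : Rm^t* *m P = P by rewrite /P /projector !mulmxA Rm_fix.
  apply/eqP; rewrite -subr_eq0 -RP -mulmxA -mulmxBr; apply/eqP/Rm_kill.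
    move=> X lX; rewrite mulmxBr ku // sub0r /P /projector !mulmxA actV //.
    by rewrite !mul0mx oppr0.
  by rewrite mulmxBr [V^T *m (P *m _)]mulmxA /P mul_projector // subrr.
by rewrite -[LHS]trmxCK adj_mul Pi_herm RPi projector_herm.
Qed.

End LimitProjector.

(** * Invariance of the pairing vectors *)
Section PairingInvariance.
Variables (C : numClosedFieldType) (N n : nat) (eps : C) (delta : 'I_n -> 'I_n -> C) (K : 'M[C]_N).
Hypothesis eps2 : eps * eps = 1.
Hypothesis deltaC : forall a b, delta a b = eps * delta b a.
Hypothesis delta_neq0 : forall a b, a != b -> delta a b != 0.
Hypothesis KT : K^T = eps *: K.
Hypothesis KKT : K *m K^T = 1%:M.
Hypothesis N_gt0 : (0 < N)%N.
Implicit Types (p q : matching 'I_n).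

Lemma in_form_lie_tr X : in_form_lie K X -> in_form_lie K X^T.
Proof.
rewrite /in_form_lie trmxK => lX; have := congr1 (fun M => K *m M *m K) lX.
rewrite mulmxDr mulmxDl mulmx0 mul0mx !mulmxA (KK KT KKT eps2) -mulmxA (KK KT KKT eps2).
rewrite mul_scalar_mx mul_mx_scalar -scalemxAl -scalerDr => /(congr1 (fun M => eps *: M)).
by rewrite scalerA eps2 scale1r scaler0 addrC.
Qed.

Lemma lie_contr (a b : 'I_n) X : a != b -> in_form_lie K X ->
  (site a X + site b X) *m contr K a b = 0.
Proof.
move=> ab /in_form_lie_tr /(contr_lie ab) /(congr1 trmx); rewrite trmx_mul trmx0 contr_sym //.
by rewrite linearD /= !tr_site trmxK.
Qed.

(** The action of X splits into its actions on the pairs of p. On the pair {a, b} it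
    kills the vector, which is the image of a contraction of a and b. *)
Lemma lie_killed_pairing p : lie_killed K [set: 'I_n] (pairing delta K (matching_pairs p)).
Proof.
move=> X lX; set v := pairing _ _ _.
have -> : lie_act [set: 'I_n] X =
    \sum_(ab <- matching_pairs p) (site ab.1 X + site ab.2 X) :> 'M[C]_#|{ffun 'I_n -> 'I_N}|.
  transitivity (\sum_(r <- word (matching_pairs p)) site r X : 'M[C]_#|{ffun 'I_n -> 'I_N}|).
    rewrite (perm_big _ (perm_matching_word p)) /= big_enum /=.
    by apply: eq_bigl => r; rewrite !inE.
  rewrite /word big_flatten big_map /=; apply: eq_bigr => ab _.
  by rewrite !big_cons big_nil addr0.
rewrite mulmx_suml big1_seq // => -[a b] /= abp.
move: (abp); rewrite mem_matching_pairs => /andP[lt abs].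
have ab : a != b by apply: contraTneq lt => ->; rewrite ltnn.
have [s ss] := matching_pairs_split ab abs.
have us : uniq (word ((a, b) :: s)).
  rewrite -(perm_uniq (perm_word_ordp _)) (perm_uniq (perm_word ss)).
  by rewrite (perm_uniq (perm_matching_word p)) enum_uniq.
have N0 : (N%:R : C) != 0 by rewrite pnatr_eq0 -lt0n.
have vE : v = pairing delta K ((a, b) :: s).
  rewrite -(pairing_ordp eps2 deltaC KT ((a, b) :: s)).
  by apply/esym/(pairing_perm eps2 deltaC).
have -> : v = N%:R^-1 *: (contr K a b *m v).
  by rewrite vE (contr_pairing_same delta KKT us) scalerA mulVf // scale1r.
by rewrite -scalemxAr mulmxA lie_contr // mul0mx scaler0.
Qed.

Lemma contr_seq_tens s X X' : uniq (word s) -> X^T *m K *m X = K -> X' *m X = 1%:M ->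
  contr_seq K s *m tens_on [set: 'I_n] X = tens_on (unpaired s) X *m contr_seq K s.
Proof.
move=> + XKX X'X; elim: s => [_|[a b] s IH] /=.
  have -> : unpaired [::] = [set: 'I_n] by apply/setP => r; rewrite /unpaired /= !inE.
  by rewrite mul1mx mulmx1.
rewrite inE negb_or => /and3P[/andP[ab aw] bw us].
rewrite -mulmxA IH // mulmxA (contr_tens_on _ _ _ XKX X'X) ?inE // -mulmxA.
congr (tens_on _ _ *m _); apply/setP => r; rewrite !inE !negb_or.
by case: (r == a); case: (r == b).
Qed.

(** The contraction along all the pairs of p has the pairing vector as its row and
    column factor, and absorbs the action of X by [contr_seq_tens]. *)
Lemma tens_pairing p X X' : X^T *m K *m X = K -> X' *m X = 1%:M ->
  (tens (fun=> X))^T *m pairing delta K (matching_pairs p) = pairing delta K (matching_pairs p).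
Proof.
move=> XKX X'X; set s := matching_pairs p; set T := tens _.
have us : uniq (word s) by rewrite (perm_uniq (perm_matching_word p)) enum_uniq.
have fs : unpaired s = finset.set0.
  by apply/setP => r; rewrite !inE (perm_mem (perm_matching_word p)) mem_enum.
have cT : contr_seq K s *m T = contr_seq K s.
  have -> : T = tens_on [set: 'I_n] X by apply: eq_tens => r; rewrite /tens_on_fun inE.
  rewrite (contr_seq_tens us XKX X'X) fs -[RHS]mul1mx; congr (_ *m _).
  by rewrite -[RHS]tens1; apply: eq_tens => r; rewrite /tens_on_fun inE.
pose f : 'cV[C]_#|{ffun 'I_n -> 'I_N}| := \col_x form_prod K s (enum_val x).
have vf i : vat f i = form_prod K s i by rewrite /vat mxE enum_rankK.
have -> : pairing delta K s = alt delta (word s) *: f by apply/colP => x; rewrite !mxE.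
rewrite -scalemxAr; congr (_ *: _); have [->|] := eqVneq f 0; first by rewrite mulmx0.
move=> f0; have [i fi] : exists i, form_prod K s i != 0.
  apply/existsP; apply: contraNT f0 => /existsPn fi; apply/eqP/vatP => i; rewrite vf.
  by have := fi i; rewrite negbK => /eqP ->; rewrite /vat mxE.
have dotE w : vat (contr_seq K s *m w) i = form_prod K s i * (f^T *m w) 0 0.
  rewrite contr_seqE // (eq_bigl predT) => [|j]; last by apply/forall_inP => r; rewrite fs inE.
  congr (_ * _); rewrite mxE (reindex (@enum_rank {ffun 'I_n -> 'I_N})); last first.
    by exists enum_val => x _; rewrite ?enum_rankK ?enum_valK.
  by apply: eq_bigr => j _; rewrite !mxE enum_rankK.
apply: trmx_inj; rewrite trmx_mul trmxK; apply: mx_eq_vec => w.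
apply/matrixP => x y; rewrite !ord1 -mulmxA.
by apply: (mulfI fi); rewrite -!dotE mulmxA cT.
Qed.

End PairingInvariance.

Local Open Scope classical_set_scope.
Local Open Scope ring_scope.

(** * Norms and limits of complex numbers *)
Section ComplexNorm.
Variable R : realType.
Local Notation C := (Cplx R).
Local Notation rC := (@real_to_C R).
Implicit Types (z w : C) (x y : R).

(** The norm of a complex number as a real number, for estimates in the real field. *)
Definition nC z : R := ComplexField.Normc.normc z.

Lemma norm_nC z : `|z| = rC (nC z). Proof. by []. Qed.

Lemma rCD x y : rC (x + y) = rC x + rC y. Proof. exact: rmorphD. Qed.
Lemma rCN x : rC (- x) = - rC x. Proof. exact: rmorphN. Qed.
Lemma rCM x y : rC (x * y) = rC x * rC y. Proof. exact: rmorphM. Qed.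
Lemma rC0 : rC 0 = 0. Proof. exact: rmorph0. Qed.
Lemma rC1 : rC 1 = 1. Proof. exact: rmorph1. Qed.
Lemma rC_nat n : rC n%:R = n%:R. Proof. exact: rmorph_nat. Qed.
Lemma rCV x : rC x^-1 = (rC x)^-1. Proof. exact: fmorphV. Qed.
Lemma rCX x n : rC (x ^+ n) = rC x ^+ n. Proof. exact: rmorphXn. Qed.
Lemma rC_le x y : (rC x <= rC y) = (x <= y). Proof. exact: lecR. Qed.
Lemma rC_lt x y : (rC x < rC y) = (x < y). Proof. exact: ltcR. Qed.
Lemma rC_sum (I : Type) (s : seq I) (P : pred I) (F : I -> R) :
  rC (\sum_(i <- s | P i) F i) = \sum_(i <- s | P i) rC (F i).
Proof. exact: rmorph_sum. Qed.
Lemma rC_conj x : (rC x)^* = rC x.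
Proof. exact: conjc_real. Qed.
Lemma rC_inj : injective rC. Proof. exact: complexI. Qed.

Lemma cReD z w : complex.Re (z + w) = complex.Re z + complex.Re w.
Proof. by case: z w => a b [c d]. Qed.
Lemma cImD z w : complex.Im (z + w) = complex.Im z + complex.Im w.
Proof. by case: z w => a b [c d]. Qed.
Lemma cReB z w : complex.Re (z - w) = complex.Re z - complex.Re w.
Proof. by case: z w => a b [c d]. Qed.
Lemma cImB z w : complex.Im (z - w) = complex.Im z - complex.Im w.
Proof. by case: z w => a b [c d]. Qed.
Lemma cReM z w : complex.Re (z * w) =
  complex.Re z * complex.Re w - complex.Im z * complex.Im w.
Proof. by case: z w => a b [c d]. Qed.
Lemma cImM z w : complex.Im (z * w) =
  complex.Re z * complex.Im w + complex.Im z * complex.Re w.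
Proof. by case: z w => a b [c d]. Qed.
Lemma cRe_rC x : complex.Re (rC x) = x. Proof. by []. Qed.
Lemma cIm_rC x : complex.Im (rC x) = 0. Proof. by []. Qed.
Lemma cRe_sum (I : Type) (s : seq I) (P : pred I) (F : I -> C) :
  complex.Re (\sum_(i <- s | P i) F i) = \sum_(i <- s | P i) complex.Re (F i).
Proof. by elim/big_rec2: _ => // i x y _ <-; rewrite cReD. Qed.
Lemma cIm_sum (I : Type) (s : seq I) (P : pred I) (F : I -> C) :
  complex.Im (\sum_(i <- s | P i) F i) = \sum_(i <- s | P i) complex.Im (F i).
Proof. by elim/big_rec2: _ => // i x y _ <-; rewrite cImD. Qed.

Lemma C_eq z w : complex.Re z = complex.Re w -> complex.Im z = complex.Im w -> z = w.
Proof. by case: z w => a b [c d] /= -> ->. Qed.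

Lemma C_ReIm z : z = rC (complex.Re z) + 'i * rC (complex.Im z).
Proof. exact: complexE. Qed.

Lemma nC_ge0 z : 0 <= nC z.
Proof. by rewrite -rC_le -norm_nC rC0. Qed.

Lemma nC_rC x : nC (rC x) = `|x|.
Proof. by rewrite /nC /= expr0n addr0 sqrtr_sqr. Qed.

Lemma nCD z w : nC (z + w) <= nC z + nC w.
Proof. by rewrite -rC_le rCD -!norm_nC ler_normD. Qed.

Lemma nCM z w : nC (z * w) = nC z * nC w.
Proof. by apply: rC_inj; rewrite rCM -!norm_nC normrM. Qed.

Lemma nCN z : nC (- z) = nC z.
Proof. by apply: rC_inj; rewrite -!norm_nC normrN. Qed.

Lemma nC_sum (I : Type) (s : seq I) (P : pred I) (F : I -> C) :
  nC (\sum_(i <- s | P i) F i) <= \sum_(i <- s | P i) nC (F i).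
Proof. by rewrite -rC_le rC_sum -norm_nC; apply: ler_norm_sum. Qed.

Lemma nC0 : nC 0 = 0. Proof. by rewrite -rC0 nC_rC normr0. Qed.
Lemma nC1 : nC 1 = 1. Proof. by rewrite -rC1 nC_rC normr1. Qed.
Lemma nC_i : nC 'i = 1. Proof. by apply: rC_inj; rewrite -norm_nC normCi rC1. Qed.

Lemma cRe_nC z : `|complex.Re z| <= nC z.
Proof.
case: z => a b /=; rewrite -sqrtr_sqr; apply: ler_wsqrtr.
by rewrite lerDl sqr_ge0.
Qed.

Lemma cIm_nC z : `|complex.Im z| <= nC z.
Proof.
case: z => a b /=; rewrite -sqrtr_sqr; apply: ler_wsqrtr.
by rewrite lerDr sqr_ge0.
Qed.

Lemma nC_ReIm z : nC z <= `|complex.Re z| + `|complex.Im z|.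
Proof.
rewrite {1}[z]C_ReIm; apply: le_trans (nCD _ _) _.
by rewrite nCM nC_i mul1r !nC_rC.
Qed.

Lemma nC_eq0 z : nC z = 0 -> z = 0.
Proof. exact: ComplexField.Normc.eq0_normc. Qed.

Lemma cvgC_P (T : Type) (F : set_system T) (FF : Filter F) (f : T -> C) (l : C) :
  (forall e : R, 0 < e -> \forall t \near F, nC (l - f t) < e) -> f @ F --> l.
Proof.
move=> h; apply/cvgrPdist_lt => e e0.
have eE : e = rC (complex.Re e).
  by apply: C_eq => //; rewrite (ger0_Im (ltW e0)).
rewrite eE -rC0 rC_lt in e0; have := h _ e0; apply: filterS => t.
by rewrite eE norm_nC rC_lt.
Qed.

Lemma cvgC_nC (T : Type) (F : set_system T) (FF : Filter F) (f : T -> C) (l : C) (e : R) :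
  f @ F --> l -> 0 < e -> \forall t \near F, nC (l - f t) < e.
Proof.
move=> /cvgrPdist_lt h e0; have := h (rC e); rewrite -rC0 rC_lt => /(_ e0).
by apply: filterS => t; rewrite norm_nC rC_lt.
Qed.

Lemma cvg_Re (T : Type) (F : set_system T) (FF : Filter F) (f : T -> C) (l : C) :
  f @ F --> l -> (fun t => complex.Re (f t)) @ F --> complex.Re l.
Proof.
move=> h; apply/cvgrPdist_lt => e e0; have := cvgC_nC FF h e0.
by apply: filterS => t; apply: le_lt_trans; rewrite -cReB cRe_nC.
Qed.

Lemma cvg_ReIm (T : Type) (F : set_system T) (FF : Filter F) (f : T -> C) (l : C) :
  (fun t => complex.Re (f t)) @ F --> complex.Re l ->
  (fun t => complex.Im (f t)) @ F --> complex.Im l -> f @ F --> l.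
Proof.
move=> /cvgrPdist_lt hr /cvgrPdist_lt hi; apply: cvgC_P => e e0.
have e20 : 0 < e / 2 by rewrite divr_gt0.
have := hi _ e20; have := hr _ e20; apply: filterS2 => t h1 h2.
apply: le_lt_trans (nC_ReIm _) _; rewrite cReB cImB.
by rewrite [ltRHS](splitr e) ltrD.
Qed.

Lemma cvg_mx_entries (T : Type) (F : set_system T) (FF : Filter F) m k
    (f : T -> 'M[C]_(m, k)) (l : 'M[C]_(m, k)) :
  (forall i j, (fun t => f t i j) @ F --> l i j) -> f @ F --> l.
Proof.
move=> h; apply/cvg_ballP => e e0.
have : \forall t \near F, forall ij : 'I_m * 'I_k, ball (l ij.1 ij.2) e (f t ij.1 ij.2).
  by apply: filter_forall => ij; move/cvg_ballP: (h ij.1 ij.2); exact.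
by apply: filterS => t ht; split => // i j; exact: (ht (i, j)).
Qed.

End ComplexNorm.

(** * The exponential of matrices *)

(** iv k stands for 1 / k!, as a scalar or as a scalar matrix. *)
Section TruncatedExponential.
Variables (A : pzRingType) (iv : nat -> A) (x y : A) (m : nat).
Hypothesis iv_comm : forall k z, iv k * z = z * iv k.
Hypothesis iv_binom : forall k j, (j <= k)%N -> iv k *+ 'C(k, j) = iv (k - j)%N * iv j.
Hypothesis xy : x * y = y * x.

(** The double sum is the part of total degree at least m of the product of the two
    truncated series. *)
Lemma truncated_exp_mul :
  (\sum_(0 <= k < m) iv k * x ^+ k) * (\sum_(0 <= k < m) iv k * y ^+ k) =
  \sum_(0 <= k < m) iv k * (x + y) ^+ k +
  \sum_(0 <= j < m) \sum_(m - j <= i < m) (iv i * x ^+ i) * (iv j * y ^+ j).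
Proof.
rewrite big_distrlr exchange_big /=.
have -> : \sum_(0 <= k < m) iv k * (x + y) ^+ k =
    \sum_(0 <= j < m) \sum_(0 <= i < m - j) (iv i * x ^+ i) * (iv j * y ^+ j).
  transitivity (\sum_(0 <= k < m) \sum_(0 <= j < m | (j < k.+1)%N)
      (iv (k - j)%N * x ^+ (k - j)) * (iv j * y ^+ j)).
    rewrite [LHS]big_nat [RHS]big_nat; apply: eq_bigr => k /andP[_ km].
    rewrite (exprDn_comm _ xy) mulr_sumr.
    rewrite -(big_mkord predT (fun i => iv k * (x ^+ (k - i)%N * y ^+ i *+ 'C(k, i)))).
    rewrite (big_nat_widen _ _ _ _ _ km) /=.
    apply: eq_bigr => j; rewrite ltnS => jk.
    rewrite mulrnAr -mulrnAl iv_binom // -!mulrA; congr (_ * _).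
    by rewrite !mulrA -iv_comm.
  rewrite (exchange_big_dep_nat predT) //=; apply: eq_bigr => j _.
  rewrite (eq_bigl (fun k => true && (j <= k)%N)) //.
  rewrite -(big_nat_widenl j 0 m predT (fun k =>
    (iv (k - j)%N * x ^+ (k - j)) * (iv j * y ^+ j))) //.
  by rewrite -{1}[j]add0n big_addn; apply: eq_bigr => i _; rewrite addnK.
rewrite -big_split /= ; apply: eq_bigr => j _.
by rewrite -big_cat_nat // leq_subr.
Qed.

End TruncatedExponential.

Section MatrixExponential.
Variables (R : realType) (N : nat).
Local Notation C := (Cplx R).
Local Notation rC := (@real_to_C R).
Local Notation M := 'M[Cplx R]_N.
Implicit Types (X Y : M) (a b : R).

Definition exp_sum X (m : nat) : M := \sum_(k < m) (k`!%:R^-1 : C) *: X ^+ k.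

Definition pow_bound X a := 0 <= a /\ forall k i j, nC ((X ^+ k) i j) <= a ^+ k.

Lemma pow_bound_ex X : exists a, pow_bound X a.
Proof.
pose b := \sum_i \sum_j nC (X i j).
have b0 : 0 <= b by do 2!(apply: sumr_ge0 => ? _); exact: nC_ge0.
have Xb i j : nC (X i j) <= b.
  rewrite /b (bigD1 i) //= (bigD1 j) //= -addrA lerDl addr_ge0 //.
    by apply: sumr_ge0 => ? _; exact: nC_ge0.
  by do 2!(apply: sumr_ge0 => ? _); exact: nC_ge0.
exists (N%:R * b); split; first by rewrite mulr_ge0.
elim=> [|k IH] i j.
  by rewrite !expr0 mxE; case: (i == j); rewrite ?nC1 ?nC0.
rewrite exprSr mxE; apply: le_trans (nC_sum _ _ _) _.
apply: (@le_trans _ _ (\sum_(l < N) (N%:R * b) ^+ k * b)).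
  by apply: ler_sum => l _; rewrite nCM ler_pM ?nC_ge0.
by rewrite sumr_const card_ord exprSr -[leLHS]mulr_natl mulrCA.
Qed.

Lemma mxmulE X Y : X * Y = X *m Y. Proof. by []. Qed.

Lemma pow_boundZ X a (t : R) : pow_bound X a -> pow_bound (rC t *: X) (`|t| * a).
Proof.
move=> [a0 Xa]; split; first by rewrite mulr_ge0.
move=> k i j; have -> : (rC t *: X) ^+ k = rC (t ^+ k) *: X ^+ k.
  elim: k => [|k IH]; first by rewrite !expr0 rC1 scale1r.
  by rewrite !exprS IH ![in LHS]mxmulE -scalemxAl -scalemxAr scalerA -rCM.
rewrite mxE nCM nC_rC normrX exprMn ler_wpM2l ?exprn_ge0 //.
Qed.

Lemma exp_sumE X m i j : exp_sum X m i j = \sum_(k < m) (k`!%:R^-1 : C) * (X ^+ k) i j.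
Proof. by rewrite summxE; apply: eq_bigr => k _; rewrite mxE. Qed.

Lemma nC_fact k : nC (k`!%:R^-1 : C) = k`!%:R^-1.
Proof. by rewrite -rC_nat -rCV nC_rC ger0_norm // invr_ge0. Qed.

Lemma exp_coeff_bound X a k i j : pow_bound X a ->
  nC ((k`!%:R^-1 : C) * (X ^+ k) i j) <= exp_coeff a k.
Proof.
move=> [_ Xa]; rewrite nCM nC_fact /exp_coeff /= mulrC.
by rewrite ler_wpM2r ?invr_ge0.
Qed.

Lemma cvg_exp_series (u : nat -> C) a : 0 <= a ->
  (forall k, nC (u k) <= exp_coeff a k) ->
  exists l : C, (fun m => \sum_(k < m) u k) @ \oo --> l.
Proof.
move=> a0 ua.
have cvg_real (v : nat -> R) : (forall k, `|v k| <= nC (u k)) -> cvgn (series v).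
  move=> vu; apply: normed_cvg; apply: (@series_le_cvg _ (fun k => `|v k|) (exp_coeff a)) => [k|k|k|].
  - exact: normr_ge0.
  - exact: exp_coeff_ge0.
  - exact: le_trans (vu k) (ua k).
  - exact: is_cvg_series_exp_coeff.
have cr := cvg_real (fun k => complex.Re (u k)) (fun k => cRe_nC _).
have ci := cvg_real (fun k => complex.Im (u k)) (fun k => cIm_nC _).
exists (Complex (limn (series (fun k => complex.Re (u k))))
                (limn (series (fun k => complex.Im (u k))))).
apply: cvg_ReIm => /=.
  rewrite (_ : (fun _ => _) = series (fun k => complex.Re (u k))) //.
  by apply/funext => m; rewrite cRe_sum /series /= big_mkord.
rewrite (_ : (fun _ => _) = series (fun k => complex.Im (u k))) //.
by apply/funext => m; rewrite cIm_sum /series /= big_mkord.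
Qed.

Lemma expm_cvg X i j : (fun m => exp_sum X m i j) @ \oo --> expm X i j.
Proof.
have [a Xa] := pow_bound_ex X.
have /choice[L Lcvg] : forall ij : 'I_N * 'I_N,
    exists l : C, (fun m => exp_sum X m ij.1 ij.2) @ \oo --> l.
  move=> ij; have [l ul] := cvg_exp_series Xa.1 (fun k => exp_coeff_bound k ij.1 ij.2 Xa).
  by exists l; rewrite (_ : (fun _ => _) = fun m => \sum_(k < m) (k`!%:R^-1 : C) * (X ^+ k) ij.1 ij.2) //;
     apply/funext => m; rewrite exp_sumE.
suff -> : expm X = \matrix_(i, j) L (i, j) by rewrite mxE; exact: Lcvg (i, j).
apply: cvg_lim; first exact: norm_hausdorff.
by apply: cvg_mx_entries => p q; rewrite mxE; exact: Lcvg (p, q).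
Qed.

Lemma cvgC_unique (u : nat -> C) (l l' : C) :
  u @ \oo --> l -> u @ \oo --> l' -> l = l'.
Proof. by apply: cvg_unique; exact: norm_hausdorff. Qed.

Lemma exp_sum_mul X Y m : X *m Y = Y *m X ->
  exp_sum X m *m exp_sum Y m = exp_sum (X + Y) m +
  \sum_(0 <= j < m) \sum_(m - j <= i < m)
    ((i`!%:R^-1 : C) * (j`!%:R^-1 : C)) *: (X ^+ i *m Y ^+ j).
Proof.
move=> XY; pose iv k : M := (k`!%:R^-1 : C)%:M.
have iv_comm k (Z : M) : iv k * Z = Z * iv k by rewrite !mxmulE scalar_mxC.
have iv_binom k j : (j <= k)%N -> iv k *+ 'C(k, j) = iv (k - j)%N * iv j.
  move=> jk; rewrite mxmulE -scalar_mxM -[LHS]raddfMn /=; congr (_%:M).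
  have f0 q : (q`!%:R : C) != 0 by rewrite pnatr_eq0 -lt0n fact_gt0.
  rewrite -mulr_natr -(bin_fact jk) !natrM.
  have b0 : ('C(k, j)%:R : C) != 0 by rewrite pnatr_eq0 -lt0n bin_gt0.
  by field; rewrite !f0 b0.
have E Z : exp_sum Z m = \sum_(0 <= k < m) iv k * Z ^+ k.
  by rewrite big_mkord; apply: eq_bigr => k _; rewrite mxmulE mul_scalar_mx.
rewrite !E -mxmulE (truncated_exp_mul m iv_comm iv_binom XY); congr (_ + _).
apply: eq_bigr => j _; apply: eq_bigr => i _.
by rewrite !mxmulE !mul_scalar_mx -scalemxAl -scalemxAr scalerA.
Qed.

(** The real exponential is multiplicative: the remainder of [truncated_exp_mul] for
    reals, which dominates the one for matrices, tends to 0. *)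
Lemma exp_remainder_cvg a b :
  (fun m => \sum_(0 <= j < m) \sum_(m - j <= i < m) (exp_coeff a i * exp_coeff b j))
    @ \oo --> 0.
Proof.
pose iv k : R := k`!%:R^-1.
have iv_binom k j : (j <= k)%N -> iv k *+ 'C(k, j) = iv (k - j)%N * iv j.
  move=> jk; have f0 q : (q`!%:R : R) != 0 by rewrite pnatr_eq0 -lt0n fact_gt0.
  rewrite /iv -mulr_natr -(bin_fact jk) !natrM.
  have b0 : ('C(k, j)%:R : R) != 0 by rewrite pnatr_eq0 -lt0n bin_gt0.
  by field; rewrite !f0 b0.
have E x m : series (exp_coeff x) m = \sum_(0 <= k < m) iv k * x ^+ k.
  by apply: eq_bigr => k _; rewrite /exp_coeff /= mulrC.
rewrite (_ : (fun m => _) = fun m => series (exp_coeff a) m * series (exp_coeff b) m -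
    series (exp_coeff (a + b)) m); last first.
  apply/funext => m; rewrite !E (truncated_exp_mul m (fun k z => mulrC _ _) iv_binom (mulrC a b)).
  rewrite addrAC subrr add0r; apply: eq_bigr => j _; apply: eq_bigr => i _.
  by rewrite /exp_coeff /= /iv [a ^+ i * _]mulrC [b ^+ j * _]mulrC.
have <- : expR a * expR b - expR (a + b) = 0 by rewrite expRD subrr.
by apply: cvgB; [apply: cvgM|]; exact: is_cvg_series_exp_coeff.
Qed.

Lemma cvg_mulmx_entry (U V : nat -> M) (A B : M) i j :
  (forall p q, (fun m => U m p q) @ \oo --> A p q) ->
  (forall p q, (fun m => V m p q) @ \oo --> B p q) ->
  (fun m => (U m *m V m) i j) @ \oo --> (A *m B) i j.
Proof.
move=> UA VB; rewrite mxE; under eq_fun do rewrite mxE.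
apply: (cvg_big (op := +%R)) => //; last by move=> k _; apply: cvgM.
by move=> [x y]; exact: add_continuous.
Qed.

Lemma expmD X Y : X *m Y = Y *m X -> expm X *m expm Y = expm (X + Y).
Proof.
move=> XY; apply/matrixP => i j.
apply: (@cvgC_unique (fun m => (exp_sum X m *m exp_sum Y m) i j)).
  by apply: cvg_mulmx_entry => p q; exact: expm_cvg.
have [a [a0 Xa]] := pow_bound_ex X; have [b [b0 Yb]] := pow_bound_ex Y.
(* a and b bound the powers of X and Y entrywise; N comes from the matrix product. *)
pose rem m := \sum_(0 <= j < m) \sum_(m - j <= i < m) (exp_coeff a i * exp_coeff b j).
have remE m : nC ((exp_sum X m *m exp_sum Y m - exp_sum (X + Y) m) i j) <= N%:R * rem m.
  rewrite exp_sum_mul // addrAC subrr add0r summxE.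
  apply: le_trans (nC_sum _ _ _) _; rewrite mulr_sumr; apply: ler_sum => q _.
  rewrite summxE; apply: le_trans (nC_sum _ _ _) _; rewrite mulr_sumr; apply: ler_sum => p _.
  rewrite mxE nCM nCM !nC_fact /exp_coeff /=.
  have -> : N%:R * (a ^+ p / p`!%:R * (b ^+ q / q`!%:R)) =
      (p`!%:R^-1 / q`!%:R) * (N%:R * (a ^+ p * b ^+ q)) :> R by ring.
  rewrite ler_wpM2l ?mulr_ge0 ?invr_ge0 // mxE; apply: le_trans (nC_sum _ _ _) _.
  apply: (@le_trans _ _ (\sum_(l < N) a ^+ p * b ^+ q)).
    by apply: ler_sum => l _; rewrite nCM ler_pM ?nC_ge0.
  by rewrite sumr_const card_ord mulr_natl.
apply: cvgC_P => e e0.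
have e20 : 0 < e / 2 by rewrite divr_gt0.
have h1 := cvgC_nC eventually_filter (@expm_cvg (X + Y) i j) e20.
have /cvgrPdist_lt/(_ _ e20) h2 : (fun m => N%:R * rem m) @ \oo --> (N%:R * 0 : R).
  by apply: cvgM; [exact: cvg_cst|exact: exp_remainder_cvg].
near=> m.
rewrite (_ : _ - _ = (expm (X + Y) i j - exp_sum (X + Y) m i j) -
  (exp_sum X m *m exp_sum Y m - exp_sum (X + Y) m) i j); last first.
  have -> (U V : M) : (U - V) i j = U i j - V i j by rewrite !mxE.
  by ring.
apply: le_lt_trans (nCD _ _) _; rewrite nCN [ltRHS](splitr e) ltrD //.
  by near: m.
apply: le_lt_trans (remE m) _; apply: le_lt_trans (ler_norm _) _.
near: m; apply: filterS h2 => m; rewrite mulr0 sub0r normrN.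
by [].
Unshelve. all: by end_near.
Qed.

Lemma expm_quad X : exists c, 0 <= c /\ forall t : R, `|t| <= 1 -> forall i j,
  nC (expm (rC t *: X) i j - (i == j)%:R - rC t * X i j) <= c * t ^+ 2.
Proof.
have [a [a0 Xa]] := pow_bound_ex X; exists (expR a); split; first exact: expR_ge0.
move=> t t1 i j; have [_ tXb] := pow_boundZ t (conj a0 Xa).
have sum_le m : \sum_(k < m) exp_coeff a k <= expR a.
  have : series (exp_coeff a) m <= expR a.
    apply: nondecreasing_cvgn_le; last exact: is_cvg_series_exp_coeff.
    by apply: nondecreasing_series => k _ _; exact: exp_coeff_ge0.
  by rewrite /series /= big_mkord.
have tailE m : exp_sum (rC t *: X) m.+2 i j - (i == j)%:R - rC t * X i j =
    \sum_(k < m) (k.+2`!%:R^-1 : C) * ((rC t *: X) ^+ k.+2) i j.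
  rewrite exp_sumE 2!big_ord_recl /=; set S := \sum_(k < m) _.
  rewrite expr0 expr1 fact0 (_ : (bump 0 0)`! = 1)%N // invr1 !mul1r mxE mxE.
  by ring.
have bound m : nC (exp_sum (rC t *: X) m.+2 i j - (i == j)%:R - rC t * X i j) <= expR a * t ^+ 2.
  rewrite tailE; apply: le_trans (nC_sum _ _ _) _.
  apply: (@le_trans _ _ ((\sum_(k < m.+2) exp_coeff a k) * t ^+ 2)); last first.
    by rewrite ler_wpM2r ?sqr_ge0.
  rewrite 2!big_ord_recl /= mulrDl mulrDl mulr_suml.
  have p0 k : 0 <= exp_coeff a k * t ^+ 2 by rewrite mulr_ge0 ?sqr_ge0 ?exp_coeff_ge0.
  apply: le_trans (_ : \sum_(k < m) exp_coeff a k.+2 * t ^+ 2 <= _); last first.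
    by rewrite addrA lerDr addr_ge0.
  apply: ler_sum => k _; rewrite nCM nC_fact.
  rewrite /exp_coeff /= mulrC -mulrA [_ * t ^+ 2]mulrC mulrA ler_wpM2r ?invr_ge0 //.
  apply: le_trans (tXb _ _ _) _; rewrite exprMn mulrC ler_wpM2l ?exprn_ge0 //.
  have <- : `|t| ^+ 2 = t ^+ 2 by rewrite real_normK ?num_real.
  by rewrite 2!exprS mulrA -expr2 ler_piMr ?exprn_ile1 // exprn_ge0.
apply/ler_addgt0Pl => e e0.
have h1 := cvgC_nC eventually_filter (@expm_cvg (rC t *: X) i j) e0.
have [m [m2 hm]] := filter_ex (filterI (nbhs_infty_ge 2) h1).
rewrite -(subnK m2) addn2 in hm.
rewrite (_ : _ - _ = (expm (rC t *: X) i j - exp_sum (rC t *: X) (m - 2).+2 i j) +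
  (exp_sum (rC t *: X) (m - 2).+2 i j - (i == j)%:R - rC t * X i j)); last by ring.
by apply: le_trans (nCD _ _) _; apply: lerD; [exact: ltW|].
Qed.

Lemma expm0 : expm (0 : M) = 1%:M.
Proof.
have [c [_ h]] := expm_quad 0; apply/matrixP => i j; rewrite mxE.
have := h 0 _ i j; rewrite normr0 ler01 rC0 scale0r mul0r subr0 expr0n mulr0 => /(_ isT) h0.
apply/eqP; rewrite -subr_eq0; apply/eqP/nC_eq0/eqP.
by rewrite eq_le h0 nC_ge0.
Qed.

Lemma expmN X : expm X *m expm (- X) = 1%:M.
Proof. by rewrite expmD ?subrr ?expm0 // mulmxN mulNmx. Qed.

Lemma expm_tr X : (expm X)^T = expm X^T.
Proof.
apply/matrixP => i j; rewrite mxE.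
apply: (@cvgC_unique (fun m => exp_sum X m j i)); first exact: expm_cvg.
rewrite (_ : (fun _ => _) = fun m => exp_sum X^T m i j); first exact: expm_cvg.
have powT k : X^T ^+ k = (X ^+ k)^T.
  elim: k => [|q IH]; first by rewrite !expr0 trmx1.
  by rewrite exprSr exprS IH !mxmulE trmx_mul.
apply/funext => m; apply: etrans (exp_sumE X m j i) _.
apply: etrans (esym (exp_sumE X^T m i j)).
by apply: eq_bigr => k _; rewrite powT mxE.
Qed.

Lemma expm_conj X : map_mx Num.conj (expm X) = expm (map_mx Num.conj X).
Proof.
apply/matrixP => i j; rewrite mxE.
apply: (@cvgC_unique (fun m => (exp_sum X m i j)^*)).
  have h := @expm_cvg X i j; apply: cvgC_P => e e0.
  have := cvgC_nC eventually_filter h e0; apply: filterS => m.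
  rewrite -rC_lt -norm_nC => he; rewrite -rC_lt -norm_nC; apply: le_lt_trans he.
  by rewrite -rmorphB norm_conjC.
rewrite (_ : (fun _ => _) = fun m => exp_sum (map_mx Num.conj X) m i j); first exact: expm_cvg.
have powC k : (map_mx Num.conj X) ^+ k = map_mx Num.conj (X ^+ k).
  elim: k => [|q IH]; first by rewrite !expr0 map_mx1.
  by rewrite !exprS IH !mxmulE map_mxM.
apply/funext => m; apply: etrans (congr1 Num.conj (exp_sumE X m i j)) _.
apply: etrans (esym (exp_sumE (map_mx Num.conj X) m i j)); rewrite rmorph_sum.
by apply: eq_bigr => k _; rewrite rmorphM fmorphV rmorph_nat powC mxE.
Qed.

Lemma expm_similar (P Q : M) X : Q *m P = 1%:M -> P *m Q = 1%:M ->
  P *m expm X *m Q = expm (P *m X *m Q).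
Proof.
move=> QP PQ; apply/matrixP => i j.
apply: (@cvgC_unique (fun m => (P *m exp_sum X m *m Q) i j)).
  apply: (cvg_mulmx_entry (U := fun m => P *m exp_sum X m) (V := fun=> Q)) => p q; last exact: cvg_cst.
  apply: (cvg_mulmx_entry (U := fun=> P)) => p' q'; first exact: cvg_cst.
  exact: expm_cvg.
rewrite (_ : (fun _ => _) = fun m => exp_sum (P *m X *m Q) m i j); first exact: expm_cvg.
apply/funext => m; congr (fun_of_matrix _ i j); rewrite mulmx_sumr mulmx_suml.
apply: eq_bigr => k _; rewrite -scalemxAr -scalemxAl; congr (_ *: _).
elim: (k : nat) => [|q IH]; first by rewrite !expr0 mulmx1.
by rewrite !exprS !mxmulE -IH !mulmxA -[P *m X *m Q *m P]mulmxA QP mulmx1.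
Qed.

End MatrixExponential.

(** * First order expansions *)
Section QuadraticExpansion.
Variable R : realType.
Local Notation C := (Cplx R).
Local Notation rC := (@real_to_C R).
Implicit Types (phi psi : R -> C) (a b : C).

(** phi t = a + t b + O(t^2), with a constant valid on [-1, 1]. This is all that is
    needed of the curves exp(tX), and it passes to products more easily than
    derivatives do. *)
Definition expands phi a b := exists c : R, 0 <= c /\
  forall t : R, `|t| <= 1 -> nC (phi t - a - rC t * b) <= c * t ^+ 2.

Lemma expands_cst a : expands (fun=> a) a 0.
Proof.
by exists 0; split => // t _; rewrite subrr mulr0 subr0 nC0 mul0r.
Qed.

Lemma expandsD phi psi a b a' b' : expands phi a b -> expands psi a' b' ->
  expands (fun t => phi t + psi t) (a + a') (b + b').
Proof.
move=> [c [c0 h]] [c' [c0' h']]; exists (c + c'); split; first exact: addr_ge0.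
move=> t t1; rewrite (_ : _ - _ = (phi t - a - rC t * b) + (psi t - a' - rC t * b')); last by ring.
by rewrite mulrDl; apply: le_trans (nCD _ _) _; rewrite lerD ?h ?h'.
Qed.

Lemma expandsM phi psi a b a' b' : expands phi a b -> expands psi a' b' ->
  expands (fun t => phi t * psi t) (a * a') (a * b' + b * a').
Proof.
move=> [c [c0 h]] [c' [c0' h']].
pose D := nC b * nC b' + (nC a + nC b) * c' + c * (nC a' + nC b' + c').
exists D; split; first by rewrite !addr_ge0 ?mulr_ge0 ?addr_ge0 ?nC_ge0.
move=> t t1; have {h} := h t t1; have {h'} := h' t t1.
set s := psi t - a' - rC t * b'; set r := phi t - a - rC t * b => hs hr.
rewrite (_ : _ - _ = rC t ^+ 2 * (b * b') + (a + rC t * b) * s +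
   r * (a' + rC t * b' + s)); last by rewrite /s /r; ring.
have t21 : t ^+ 2 <= 1 by rewrite -real_normK ?num_real // expr_le1.
have tb z w : nC (z + rC t * w) <= nC z + nC w.
  apply: le_trans (nCD _ _) _; rewrite lerD // nCM nC_rC ler_piMl ?nC_ge0 //.
rewrite /D !mulrDl; apply: le_trans (nCD _ _) _; apply: lerD.
  apply: le_trans (nCD _ _) _; apply: lerD.
    by rewrite -rCX nCM nC_rC ger0_norm ?sqr_ge0 // nCM mulrC.
  rewrite -!mulrDl -mulrA nCM; apply: ler_pM; rewrite ?nC_ge0 //; exact: tb.
rewrite -!mulrDl nCM mulrAC; apply: ler_pM; rewrite ?nC_ge0 //.
apply: le_trans (nCD _ _) _; apply: lerD; first exact: tb.
by apply: le_trans hs _; rewrite ler_piMr.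
Qed.

Lemma expands_sum (I : Type) (s : seq I) (P : pred I) (phi : I -> R -> C) (a b : I -> C) :
  (forall i, P i -> expands (phi i) (a i) (b i)) ->
  expands (fun t => \sum_(i <- s | P i) phi i t) (\sum_(i <- s | P i) a i)
    (\sum_(i <- s | P i) b i).
Proof.
move=> h; elim: s => [|i s IH].
  by rewrite !big_nil (_ : (fun _ => _) = fun=> 0) ?(funext (fun t => big_nil _ _ _ _)) //; exact: expands_cst.
rewrite !big_cons; case: ifP => Pi.
  by under eq_fun do rewrite big_cons Pi; apply: expandsD => //; exact: h.
by under eq_fun do rewrite big_cons Pi.
Qed.

Lemma expands_conj phi a b : expands phi a b -> expands (fun t => (phi t)^*) a^* b^*.
Proof.
move=> [c [c0 h]]; exists c; split => // t /h; apply: le_trans.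
rewrite -[in leLHS](rC_conj t) -rmorphM -!rmorphB /=.
by rewrite -rC_le -!norm_nC norm_conjC.
Qed.

Lemma expands_unique phi a b a' b' : expands phi a b -> expands phi a' b' ->
  a = a' /\ b = b'.
Proof.
move=> [c [c0 h]] [c' [c0' h']].
have aa : a = a'.
  have := h 0; have := h' 0; rewrite normr0 rC0 !mul0r !subr0 expr0n !mulr0 => /(_ ler01) h1 /(_ ler01) h2.
  have /nC_eq0/eqP : nC (phi 0 - a) = 0 by apply/eqP; rewrite eq_le h2 nC_ge0.
  have /nC_eq0/eqP : nC (phi 0 - a') = 0 by apply/eqP; rewrite eq_le h1 nC_ge0.
  by rewrite !subr_eq0 => /eqP <- /eqP <-.
split=> //; subst a'; apply/eqP; rewrite -subr_eq0; apply/eqP/nC_eq0.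
apply/eqP; rewrite eq_le nC_ge0 andbT; apply/ler_addgt0Pl => e e0; rewrite addr0.
pose t := Num.min 1 (e / (c + c' + 1)).
have d0 : 0 < c + c' + 1 by rewrite ltr_wpDl // addr_ge0.
have t0 : 0 < t by rewrite lt_min ltr01 divr_gt0.
have t1 : `|t| <= 1 by rewrite gtr0_norm // ge_min lexx.
have te : (c + c') * t <= e.
  apply: (@le_trans _ _ ((c + c' + 1) * (e / (c + c' + 1)))); last by rewrite mulrCA mulfV ?mulr1 ?gt_eqF.
  by apply: ler_pM; rewrite ?addr_ge0 ?(ltW t0) // ?lerDl ?ge_min ?lexx ?orbT.
apply: le_trans te; rewrite -(ler_pM2l t0) -{1}(gtr0_norm t0) -nC_rC -nCM.
rewrite (_ : _ * _ = (phi t - a - rC t * b') - (phi t - a - rC t * b)); last by ring.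
apply: le_trans (nCD _ _) _; rewrite nCN.
apply: le_trans (lerD (h' t t1) (h t t1)) _.
by rewrite (_ : t * ((c + c') * t) = c' * t ^+ 2 + c * t ^+ 2) //; ring.
Qed.

Lemma expands_prod (I : finType) (phi : I -> R -> C) (a b : I -> C) :
  (forall i, expands (phi i) (a i) (b i)) ->
  expands (fun t => \prod_i phi i t) (\prod_i a i)
    (\sum_i b i * \prod_(j | j != i) a j).
Proof.
move=> h; suff : forall s : seq I, uniq s -> expands (fun t => \prod_(i <- s) phi i t)
    (\prod_(i <- s) a i) (\sum_(i <- s) b i * \prod_(j <- s | j != i) a j).
  by apply; exact: index_enum_uniq.
elim=> [_|x s IH /= /andP[xs us]].
  rewrite !big_nil (_ : (fun _ => _) = fun=> 1) ?(funext (fun t => big_nil _ _ _ _)) //.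
  exact: expands_cst.
rewrite [in X in expands _ X _]big_cons.
rewrite (_ : (fun _ => _) = fun t => phi x t * \prod_(i <- s) phi i t); last first.
  by apply/funext => t; rewrite big_cons.
rewrite (_ : \sum_(i <- x :: s) _ =
  a x * (\sum_(i <- s) b i * \prod_(j <- s | j != i) a j) + b x * \prod_(i <- s) a i).
  by apply: expandsM; [exact: h|exact: IH].
rewrite big_cons addrC; congr (_ + _).
  rewrite mulr_sumr big_seq [RHS]big_seq; apply: eq_bigr => i si.
  by rewrite big_cons ifT 1?mulrCA //; apply: contraNneq xs => ->.
rewrite big_cons eqxx /=; congr (_ * _); rewrite big_seq_cond [RHS]big_seq.
apply: eq_bigl => j; case sj : (j \in s) => //=.
by apply: contraNneq xs => <-.
Qed.

Lemma expands_derive phi a b : expands phi a b ->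
  derivable (fun t => complex.Re (phi t)) 0 1 /\
  derive1 (fun t => complex.Re (phi t)) 0 = complex.Re b.
Proof.
move=> phiab; have [c [c0 h]] := phiab.
have phi0 : phi 0 = a.
  have := h 0; rewrite normr0 rC0 mul0r subr0 expr0n mulr0 => /(_ ler01) h1.
  by apply/eqP; rewrite -subr_eq0; apply/eqP/nC_eq0/eqP; rewrite eq_le h1 nC_ge0.
have lim : (fun t : R => t^-1 *: (complex.Re (phi (t + 0)) - complex.Re (phi 0))) @ 0^' --> complex.Re b.
  apply/cvgrPdist_lt => e e0.
  have d0 : 0 < c + 1 by rewrite ltr_wpDl.
  near=> t.
  have t0 : t != 0 by near: t; exact: nbhs_dnbhs_neq.
  have t1 : `|t| <= 1 by apply: ltW; near: t; exact: dnbhs0_lt.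
  have te : `|t| < e / (c + 1) by near: t; apply: dnbhs0_lt; rewrite divr_gt0.
  have ht := h t t1; rewrite addr0 phi0 -cReB.
  have -> : complex.Re b - t^-1 *: complex.Re (phi t - a) =
      - (t^-1 * complex.Re (phi t - a - rC t * b)).
    by rewrite [in RHS]cReB cReM cRe_rC cIm_rC mul0r subr0 mulrBr mulKf // opprB.
  rewrite normrN normrM normfV.
  apply: (@le_lt_trans _ _ (`|t|^-1 * (c * t ^+ 2))).
    by rewrite ler_wpM2l ?invr_ge0 //; apply: le_trans (cRe_nC _) ht.
  rewrite -[t ^+ 2]real_normK ?num_real // mulrCA expr2 mulKf ?normr_eq0 //.
  apply: (@le_lt_trans _ _ ((c + 1) * `|t|)); first by rewrite ler_wpM2r // lerDl.
  by rewrite mulrC -ltr_pdivlMr.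
have fE : (fun h : R => h^-1 *: (((fun t => complex.Re (phi t)) \o shift 0) (h *: (1 : R)) -
    complex.Re (phi 0))) = (fun t : R => t^-1 *: (complex.Re (phi (t + 0)) - complex.Re (phi 0))).
  by apply/funext => t /=; rewrite [t%:A]mulr1.
split; first by rewrite /derivable fE; apply/cvg_ex; exists (complex.Re b).
by rewrite /derive1; apply: cvg_lim lim; exact: norm_hausdorff.
Unshelve. all: by end_near.
Qed.

End QuadraticExpansion.

(** * Lie algebras of the groups preserving a form *)
Section LieAlgebra.
Variables (R : realType) (N : nat) (K : 'M[Cplx R]_N) (eps : Cplx R).
Local Notation C := (Cplx R).
Local Notation rC := (@real_to_C R).
Local Notation M := 'M[Cplx R]_N.
Hypothesis KT : K^T = eps *: K.
Hypothesis KKT : K *m K^T = 1%:M.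
Hypothesis Kreal : map_mx Num.conj K = K.
Hypothesis eps2 : eps * eps = 1.
Local Open Scope sesquilinear_scope.

Definition form_group : set M := [set g | g \is unitarymx /\ g^T *m K *m g = K].

Definition mx_expands (F : R -> M) (A B : M) :=
  forall i j, expands (fun t => F t i j) (A i j) (B i j).

Lemma mx_expands_expm X : mx_expands (fun t => expm (rC t *: X)) 1%:M X.
Proof.
move=> i j; have [c [c0 h]] := expm_quad X; exists c; split => // t t1.
by rewrite mxE; exact: h.
Qed.

Lemma mx_expands_cst A : mx_expands (fun=> A) A 0.
Proof. by move=> i j; rewrite mxE; exact: expands_cst. Qed.

Lemma mx_expandsM F A B F' A' B' : mx_expands F A B -> mx_expands F' A' B' ->
  mx_expands (fun t => F t *m F' t) (A *m A') (A *m B' + B *m A').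
Proof.
move=> h h' i j; rewrite 4!mxE -big_split /=; under eq_fun do rewrite mxE.
by apply: expands_sum => k _; exact: expandsM.
Qed.

Lemma mx_expands_tr F A B : mx_expands F A B -> mx_expands (fun t => (F t)^T) A^T B^T.
Proof. by move=> h i j; rewrite !mxE; under eq_fun do rewrite mxE; exact: h. Qed.

Lemma mx_expands_conj F A B : mx_expands F A B ->
  mx_expands (fun t => map_mx Num.conj (F t)) (map_mx Num.conj A) (map_mx Num.conj B).
Proof.
move=> h i j; rewrite !mxE; under eq_fun do rewrite mxE.
exact: expands_conj.
Qed.

Lemma mx_expands_constant F A B : mx_expands F A B -> (forall t, F t = A) -> B = 0.
Proof.
move=> h FA; apply/matrixP => i j; rewrite mxE.
have := expands_unique (h i j); under eq_fun do rewrite FA.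
by move=> /(_ _ _ (expands_cst _)) [].
Qed.

(** First order terms of the identities defining the group, along exp(tX). *)
Lemma lie_algebra_form (G : set M) X : G `<=` form_group -> lie_algebra G X ->
  X^t* = - X /\ in_form_lie K X.
Proof.
move=> GK lX; have eX := mx_expands_expm X.
have eXT := mx_expands_tr eX; have eXC := mx_expands_conj eXT.
split.
  have h := mx_expandsM eX eXC; apply/eqP; rewrite -addr_eq0; apply/eqP.
  have := mx_expands_constant h; rewrite trmx1 map_mx1 !mul1mx !mulmx1; apply => t.
  by have [/unitarymxP gg _] := GK _ (lX t).
have h := mx_expandsM (mx_expandsM eXT (mx_expands_cst K)) eX.
have := mx_expands_constant h; rewrite trmx1 !mul1mx !mulmx1 add0r.
rewrite addrC => hX; apply: hX => t.
by have [_ gKg] := GK _ (lX t).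
Qed.

(** Conjugation by K commutes with the exponential, and -X^T is the conjugate of X
    by K. *)
Lemma form_group_expm X : X^t* = - X -> in_form_lie K X -> form_group (expm X).
Proof.
move=> Xh lX; split.
  by apply/unitarymxP; rewrite expm_tr expm_conj Xh expmN.
have XT : X^T = - (K *m X *m K^T).
  have : X^T *m K = - (K *m X) by apply/eqP; rewrite -addr_eq0 lX.
  by move=> /(congr1 (mulmx^~ K^T)); rewrite -mulmxA KKT mulmx1 mulNmx.
have KTK : K^T *m K = 1%:M by rewrite mulmx1C.
rewrite expm_tr XT -mulNmx -mulmxN -(expm_similar (- X) KTK KKT).
rewrite -!mulmxA [K^T *m _]mulmxA KTK mul1mx.
have : expm (- X) *m expm X = 1%:M by rewrite -{2}[X]opprK expmN.
by move->; rewrite mulmx1.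
Qed.

Lemma in_form_lie_comb a b X Y : in_form_lie K X -> in_form_lie K Y ->
  in_form_lie K (a *: X + b *: Y).
Proof.
have lieZ c Z : in_form_lie K Z -> (c *: Z)^T *m K + K *m (c *: Z) = 0.
  move=> lZ; have lZ0 : Z^T *m K + K *m Z = 0 := lZ.
  by rewrite linearZ -scalemxAl -scalemxAr -scalerDr lZ0 scaler0.
move=> /(lieZ a) lX /(lieZ b) lY; rewrite /in_form_lie linearD mulmxDl mulmxDr addrACA.
by rewrite lX lY addr0.
Qed.

(** The complex Lie algebra is spanned by its anti-Hermitian elements: Y is A + iB, with
    A = (Y - Y^* ) / 2 and B = (Y + Y^* ) / 2i both anti-Hermitian. *)
Lemma lie_killed_of_algebra n (G : set M) (w : 'cV_#|{ffun 'I_n -> 'I_N}|) :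
  (forall X, X^t* = - X -> in_form_lie K X -> lie_algebra G X) ->
  (forall X, lie_algebra G X -> lie_act [set: 'I_n] X *m w = 0) ->
  lie_killed K [set: 'I_n] w.
Proof.
move=> GX kw Y lY.
have lYt : in_form_lie K (Y^t*).
  rewrite -map_trmx; apply: (in_form_lie_tr eps2 KT KKT).
  have eY : Y^T *m K + K *m Y = 0 := lY.
  have := congr1 (map_mx Num.conj) eY.
  by rewrite map_mxD !map_mxM Kreal -map_trmx map_mx0.
have half : (2^-1 : C)^* = 2^-1 by rewrite fmorphV rmorph_nat.
have adjD (Z Z' : M) : (Z + Z')^t* = Z^t* + Z'^t*.
  by apply/matrixP => i j; rewrite !mxE rmorphD.
have Nhalf : (- (2^-1) : C)^* = - (2^-1) by rewrite rmorphN /= half.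
have ihalf : (- 'i / 2 : C)^* = 'i / 2 by rewrite rmorphM rmorphN /= half conjCi opprK.
pose A := 2^-1 *: Y + (- (2^-1)) *: Y^t*.
pose B := (- 'i / 2) *: Y + (- 'i / 2) *: Y^t*.
have Ah : A^t* = - A.
  by rewrite /A adjD !adj_scale trmxCK half Nhalf opprD !scaleNr opprK addrC.
have Bh : B^t* = - B.
  by rewrite /B adjD !adj_scale trmxCK ihalf -!scalerDr addrC -scaleNr mulNr opprK.
have kA := kw _ (GX _ Ah (in_form_lie_comb _ _ lY lYt)).
have kB := kw _ (GX _ Bh (in_form_lie_comb _ _ lY lYt)).
have YAB : Y = A + 'i *: B.
  have h2 : 2^-1 + 2^-1 = 1 :> C by rewrite [RHS](splitr 1) mul1r.
  rewrite /B scalerDr !scalerA mulrA mulrN -expr2 sqrCi opprK mul1r /A.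
  by rewrite addrACA -!scalerDl addNr scale0r addr0 h2 scale1r.
move: kA kB YAB; clearbody A B => kA kB ->.
have -> : lie_act [set: 'I_n] (A + 'i *: B) =
    lie_act [set: 'I_n] A + 'i *: lie_act [set: 'I_n] B by rewrite lie_actD lie_actZ.
by rewrite mulmxDl kA add0r -scalemxAl kB scaler0.
Qed.

End LieAlgebra.

(** * Matrix coefficients of the tensor power *)
Section TraceFunctions.
Variables (R : realType) (N n : nat) (G : set 'M[Cplx R]_N).
Local Notation C := (Cplx R).
Local Notation rC := (@real_to_C R).
Local Notation M := 'M[Cplx R]_N.
Local Notation T := (tensor_End R N n).
Local Open Scope sesquilinear_scope.

Lemma tensor_powerE (g : M) : tensor_power n g = tens (fun=> g).
Proof. by []. Qed.

Lemma tensor_powerM (g h : M) :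
  tensor_power n (g *m h) = tensor_power n g *m tensor_power n h.
Proof. by rewrite !tensor_powerE tensM. Qed.

(** These functions form a finite-dimensional space that is stable under the
    left-invariant vector fields; the Laplacian acts on it by multiplying L by the
    Casimir operator, see [laplace_trace_fun]. *)
Definition trace_fun (L : T) (g : M) : R := complex.Re (\tr (L *m tensor_power n g)).

Lemma expands_tensor_power X a b :
  expands (fun t => tensor_power n (expm (rC t *: X)) a b) ((1%:M : T) a b)
    (lie_act [set: 'I_n] X a b).
Proof.
pose ev (c : 'I_#|{ffun 'I_n -> 'I_N}|) : {ffun 'I_n -> 'I_N} := enum_val c.
have h r : expands (fun t => expm (rC t *: X) (ev a r) (ev b r))
    ((1%:M : M) (ev a r) (ev b r)) (X (ev a r) (ev b r)) by exact: mx_expands_expm.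
have := expands_prod h.
have -> : \prod_r (1%:M : M) (ev a r) (ev b r) = (1%:M : T) a b.
  transitivity (tens (fun=> 1%:M : M) a b : C); first by rewrite mxE.
  by rewrite tens1.
have -> : \sum_r X (ev a r) (ev b r) * \prod_(t | t != r) (1%:M : M) (ev a t) (ev b t) =
    lie_act [set: 'I_n] X a b.
  rewrite /lie_act summxE; apply: eq_big => r; first by rewrite inE.
  by rewrite /site tens_put.
rewrite (_ : (fun t => tensor_power n _ a b) =
  fun t => \prod_r expm (rC t *: X) (ev a r) (ev b r)) //.
by apply/funext => t; rewrite tensor_powerE mxE.
Qed.

Lemma expands_trace (L : T) X g :
  expands (fun t => \tr (L *m tensor_power n (g *m expm (rC t *: X))))
    (\tr (L *m tensor_power n g)) (\tr (lie_act [set: 'I_n] X *m L *m tensor_power n g)).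
Proof.
pose A := L *m tensor_power n g.
have -> : (fun t => \tr (L *m tensor_power n (g *m expm (rC t *: X)))) =
    (fun t => \sum_a \sum_b A a b * tensor_power n (expm (rC t *: X)) b a).
  apply/funext => t; rewrite tensor_powerM mulmxA /mxtrace.
  by apply: eq_bigr => a _; rewrite mxE.
have -> : \tr A = \sum_a \sum_b A a b * (1%:M : T) b a.
  by rewrite -[A in LHS]mulmx1 /mxtrace; apply: eq_bigr => a _; rewrite mxE.
have -> : \tr (lie_act [set: 'I_n] X *m L *m tensor_power n g) =
    \sum_a \sum_b A a b * lie_act [set: 'I_n] X b a.
  rewrite -mulmxA mxtrace_mulC /mxtrace.
  by apply: eq_bigr => a _; rewrite mxE.
apply: expands_sum => a _; apply: expands_sum => b _.
have := expandsM (expands_cst (A a b)) (expands_tensor_power X b a).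
by rewrite mul0r addr0.
Qed.

Lemma trace_fun_derivable L X g :
  derivable (fun t : R => trace_fun L (g *m expm (rC t *: X))) 0 1.
Proof. exact: (expands_derive (expands_trace L X g)).1. Qed.

Lemma lie_derive_trace_fun L X :
  lie_derive X (trace_fun L) = trace_fun (lie_act [set: 'I_n] X *m L).
Proof. by apply/funext => g; exact: (expands_derive (expands_trace L X g)).2. Qed.

Lemma trace_fun_continuous L : continuous_on G (trace_fun L).
Proof.
apply: continuous_subspaceT => g.
apply: (cvg_Re (F := nbhs g)); rewrite /mxtrace.
apply: (cvg_big (op := +%R)) => //; first by move=> [x y]; exact: add_continuous.
move=> a _; rewrite mxE; under eq_fun do rewrite mxE.
apply: (cvg_big (op := +%R)) => //; first by move=> [x y]; exact: add_continuous.
move=> b _; apply: cvgM; first exact: cvg_cst.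
pose p (x : M) : C := \prod_(r < n) x ((enum_val b : {ffun 'I_n -> 'I_N}) r)
  ((enum_val a : {ffun 'I_n -> 'I_N}) r).
have pE x : tensor_power n x b a = p x by rewrite mxE.
rewrite pE (_ : (fun x => tensor_power n x b a) = p); last exact/funext.
rewrite /p; apply: (@cvg_big C 'I_n ( *%R : C -> C -> C) 1 predT) => //.
  by move=> [x y]; exact: mul_continuous.
by move=> r _; exact: coord_continuous.
Qed.

Lemma trace_fun_smooth L : smooth G (trace_fun L).
Proof.
move=> k; elim: k L => [|k IH] L; split=> //; try exact: trace_fun_continuous.
move=> X _; split; first by move=> g _; exact: trace_fun_derivable.
by rewrite lie_derive_trace_fun; exact: IH.
Qed.

Lemma laplace_trace_fun d (E : 'I_d -> M) L g :
  laplace_beltrami E (trace_fun L) g =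
  trace_fun ((\sum_a lie_act [set: 'I_n] (E a) *m lie_act [set: 'I_n] (E a)) *m L) g.
Proof.
rewrite /laplace_beltrami.
have -> : trace_fun ((\sum_a lie_act [set: 'I_n] (E a) *m lie_act [set: 'I_n] (E a)) *m L) g =
    \sum_a trace_fun (lie_act [set: 'I_n] (E a) *m lie_act [set: 'I_n] (E a) *m L) g.
  by rewrite /trace_fun -cRe_sum; congr complex.Re; rewrite !mulmx_suml linear_sum.
by apply: eq_bigr => a _; rewrite !lie_derive_trace_fun mulmxA.
Qed.

End TraceFunctions.

(** * Approximate solutions of a linear differential equation *)
Section EulerRecursion.
Variables (R : realType) (a : R -> R) (c lam : R).
Hypothesis a_bounded : forall t, 0 <= t -> `|a t| <= c.
Hypothesis euler : forall e : R, 0 < e -> exists2 d : R, 0 < d &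
  forall s t, 0 <= s -> 0 < t < d -> `|a (s + t) - (1 + t * lam) * a s| <= t * e.

(** Over k steps of length t / k the errors add up to at most e. *)
Lemma euler_constant : lam = 0 -> forall t, 0 <= t -> a t = a 0.
Proof.
move=> lam0 t t0; apply/eqP; rewrite -subr_eq0 -normr_eq0 eq_le normr_ge0 andbT.
have [->|tn0] := eqVneq t 0; first by rewrite subrr normr0.
have {t0 tn0}t0 : 0 < t by rewrite lt_neqAle eq_sym tn0.
apply/ler_addgt0Pl => e e0; rewrite addr0.
have [d d0 h] := euler (divr_gt0 e0 t0).
pose k := (Num.trunc (t / d)).+1; pose u := t / k%:R.
have k0 : 0 < k%:R :> R by rewrite ltr0n.
have u0 : 0 < u by rewrite divr_gt0.
have ud : u < d.
  rewrite /u ltr_pdivrMr // mulrC -ltr_pdivrMr //.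
  by have /andP[] := truncn_itv (ltW (divr_gt0 t0 d0)).
have step (j : nat) : `|a (j%:R * u) - a 0| <= j%:R * (u * (e / t)).
  elim: j => [|j IH]; first by rewrite !mul0r subrr normr0.
  rewrite -natr1 !mulrDl !mul1r.
  rewrite (_ : _ - _ = (a (j%:R * u + u) - a (j%:R * u)) + (a (j%:R * u) - a 0)); last by ring.
  apply: le_trans (ler_normD _ _) _; rewrite addrC lerD //.
  have := h (j%:R * u) u; rewrite lam0 mulr0 addr0 mul1r; apply.
    by rewrite mulr_ge0 // ltW.
  by rewrite u0 ud.
have := step k; rewrite /u [k%:R * (t / _)]mulrC mulfVK ?gt_eqF //.
rewrite mulrA [k%:R * _]mulrC mulfVK ?gt_eqF // mulrC mulfVK ?gt_eqF //.
Qed.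

(** A step of length u multiplies a by q = 1 + u lam < 1, up to an error that is small
    compared with u |lam| = 1 - q; so repeated steps bring |a| below any bound,
    uniformly in the starting time. *)
Lemma euler_decay : lam < 0 -> a t @[t --> +oo] --> (0 : R).
Proof.
move=> lam0; have l0 : 0 < - lam by rewrite oppr_gt0.
apply/cvgrPdist_lt => e e0.
have e20 : 0 < e / 2 by rewrite divr_gt0.
have [d d0 h] := euler (mulr_gt0 e20 l0).
(* The second bound makes q nonnegative. *)
pose u := Num.min (d / 2) ((- lam)^-1).
have u0 : 0 < u by rewrite lt_min divr_gt0 // invr_gt0.
have ud : u < d by rewrite gt_min ltr_pdivrMr // mulr_natr mulr2n ltrDl d0.
have ul : u * - lam <= 1.
  by rewrite -(mulVf (lt0r_neq0 l0)) ler_pM2r // ge_min lexx orbT.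
pose q := 1 + u * lam.
have q0 : 0 <= q by rewrite /q -[u * lam]opprK -mulrN subr_ge0.
have q1 : q < 1 by rewrite /q -[u * lam]opprK -mulrN ltrBlDr ltrDl mulr_gt0.
have step s (j : nat) : 0 <= s -> `|a (s + j%:R * u)| <= q ^+ j * c + e / 2.
  move=> s0; elim: j => [|j IH].
    by rewrite mul0r addr0 expr0 mul1r; apply: le_trans (a_bounded s0) _; rewrite lerDl ltW.
  have sj : 0 <= s + j%:R * u by rewrite addr_ge0 // mulr_ge0 // ltW.
  have := h _ u sj; rewrite u0 ud -/q => /(_ isT) hj.
  rewrite -natr1 mulrDl mul1r addrA.
  rewrite (_ : a _ = (a (s + j%:R * u + u) - q * a (s + j%:R * u)) + q * a (s + j%:R * u)); last by ring.
  apply: le_trans (ler_normD _ _) _; apply: le_trans (lerD hj (lexx _)) _.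
  rewrite normrM (ger0_norm q0).
  apply: le_trans (lerD (lexx _) (ler_wpM2l q0 IH)) _.
  rewrite exprS /q le_eqVlt; apply/orP; left; apply/eqP; ring.
have c0 : 0 <= c by apply: le_trans (a_bounded (lexx 0)).
have [j qj] : exists j : nat, q ^+ j * c < e / 2.
  have : q ^+ j * c @[j --> \oo] --> (0 * c : R).
    apply: cvgM; last exact: cvg_cst.
    by apply: cvg_expr; rewrite ger0_norm.
  rewrite mul0r => /cvgrPdist_lt/(_ _ e20)/filter_ex[j].
  by rewrite sub0r normrN => hj; exists j; apply: le_lt_trans hj; exact: ler_norm.
near=> t; rewrite sub0r normrN.
have tj : j%:R * u <= t by near: t; apply: nbhs_pinfty_ge; exact: num_real.
rewrite -[t](subrK (j%:R * u)).
apply: le_lt_trans (step _ j _) _; first by rewrite subr_ge0.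
by rewrite [ltRHS](splitr e) ltrD2r.
Unshelve. all: by end_near.
Qed.

End EulerRecursion.

(** * Spectral projections *)
Section SpectralProjector.
Variables (C : numClosedFieldType) (m : nat) (A : 'M[C]_m).
Local Open Scope sesquilinear_scope.
Hypothesis A_herm : A^t* = A.
Hypothesis A_le0 : forall x : 'cV_m, (x^t* *m A *m x) 0 0 <= 0.

Local Notation U := (spectralmx A).
Local Notation lam := (spectral_diag A).

Definition eigen_proj k : 'M[C]_m := U^t* *m delta_mx k k *m U.

Let UUt : U *m U^t* = 1%:M. Proof. exact/unitarymxP/spectral_unitarymx. Qed.
Let UtU : U^t* *m U = 1%:M. Proof. exact: mulmx1C UUt. Qed.

Let AE : A = U^t* *m diag_mx lam *m U.
Proof.
have nA : A \is normalmx by apply/normalmxP; rewrite A_herm.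
rewrite -invmx_unitary ?spectral_unitarymx //.
by case: (@orthomx_spectralP C m A nA).
Qed.

Lemma sum_eigen_proj : \sum_k eigen_proj k = 1%:M.
Proof.
rewrite -mulmx_suml -mulmx_sumr -UtU; congr (_ *m _); rewrite -[RHS]mulmx1; congr (_ *m _).
apply/matrixP => i j; rewrite summxE !mxE (bigD1 i) //= mxE eqxx /= big1 ?addr0 1?eq_sym // => k ki.
by rewrite mxE [i == k]eq_sym (negPf ki).
Qed.

Lemma diag_delta k : diag_mx lam *m delta_mx k k = lam 0 k *: delta_mx k k.
Proof.
apply/matrixP => i j; rewrite mul_diag_mx !mxE.
by case: (i =P k) => [->|]; rewrite ?mulr0.
Qed.

Lemma mul_eigen_proj k : A *m eigen_proj k = lam 0 k *: eigen_proj k.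
Proof.
rewrite {1}AE /eigen_proj -!mulmxA [U *m _]mulmxA UUt mul1mx.
by rewrite [diag_mx _ *m _]mulmxA diag_delta -scalemxAl -scalemxAr.
Qed.

Lemma eigen_proj_herm k : (eigen_proj k)^t* = eigen_proj k.
Proof. by rewrite /eigen_proj !adj_mul trmxCK trmx_delta map_delta_mx mulmxA. Qed.

Lemma eigenvalue_le0 k : lam 0 k <= 0.
Proof.
have := A_le0 (U^t* *m delta_mx k 0); rewrite adj_mul trmxCK trmx_delta map_delta_mx.
have -> B D : (B *m U *m A *m (U^t* *m D)) = B *m diag_mx lam *m D :> 'M[C]_1.
  rewrite (_ : B *m U *m A = B *m U *m (U^t* *m diag_mx lam *m U)); last by rewrite -AE.
  rewrite -!mulmxA [U *m (U^t* *m D)]mulmxA UUt mul1mx.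
  by rewrite [U *m (U^t* *m _)]mulmxA UUt mul1mx.
by rewrite -rowE -colE !mxE eqxx mulr1n.
Qed.

Lemma eigenvalue_real k : (lam 0 k)^* = lam 0 k.
Proof. by apply/CrealP; rewrite realE eigenvalue_le0 orbT. Qed.

Lemma eigen_proj_mul k : eigen_proj k *m A = lam 0 k *: eigen_proj k.
Proof.
have := congr1 (fun M : 'M[C]_m => M^t*) (mul_eigen_proj k).
by rewrite adj_mul A_herm eigen_proj_herm adj_scale eigenvalue_real eigen_proj_herm.
Qed.

(** The orthogonal projection on the kernel of A. *)
Definition ker_proj : 'M[C]_m := \sum_(k | lam 0 k == 0) eigen_proj k.

Lemma mul_ker_proj : A *m ker_proj = 0.
Proof.
rewrite mulmx_sumr big1 // => k /eqP lk.
by rewrite mul_eigen_proj lk scale0r.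
Qed.

Lemma ker_proj_fix (x : 'cV_m) : A *m x = 0 -> ker_proj *m x = x.
Proof.
move=> Ax; rewrite -[RHS]mul1mx -sum_eigen_proj (bigID (fun k => lam 0 k == 0)) /=.
rewrite mulmxDl -[LHS]addr0; congr (_ + _); rewrite mulmx_suml big1 // => k lk.
apply: (scalerI lk); rewrite scaler0 scalemxAl -eigen_proj_mul -mulmxA Ax mulmx0.
by [].
Qed.

Lemma ker_proj_herm : ker_proj^t* = ker_proj.
Proof. by rewrite adj_sum; apply: eq_bigr => k _; exact: eigen_proj_herm. Qed.

End SpectralProjector.

(** * Expectations of bounded random variables *)
Section BoundedExpectation.
Context {d : measure_display} {Om : measurableType d} {R : realType}.
Variable P : probability Om R.
Local Notation C := (Cplx R).
Local Notation rC := (@real_to_C R).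
Implicit Types (f g h : Om -> R) (X Y : Om -> C).

Definition bounded_rv f := measurable_fun setT f /\ exists c : R, forall w, `|f w| <= c.

Lemma bounded_rv_integrable f : bounded_rv f -> P.-integrable setT (EFin \o f).
Proof.
move=> [mf [c fc]]; apply: measurable_bounded_integrable => //.
  by apply: (eq_ind_r (fun x => (x < +oo)%E) _ (probability_setT P)); exact: ltry.
exists c; split; first exact: num_real.
by move=> x cx w _ /=; apply: le_trans (fc w) (ltW cx).
Qed.

Lemma bounded_rv_cst c : bounded_rv (fun=> c).
Proof. by split; [exact: measurable_cst|exists `|c|]. Qed.

Lemma bounded_rvD f g : bounded_rv f -> bounded_rv g -> bounded_rv (fun w => f w + g w).
Proof.
move=> [mf [c fc]] [mg [c' gc]]; split; first exact: measurable_funD.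
by exists (c + c') => w; apply: le_trans (ler_normD _ _) (lerD _ _).
Qed.

Lemma bounded_rvM f g : bounded_rv f -> bounded_rv g -> bounded_rv (fun w => f w * g w).
Proof.
move=> [mf [c fc]] [mg [c' gc]]; split; first exact: measurable_funM.
by exists (c * c') => w; rewrite normrM ler_pM.
Qed.

Lemma bounded_rvN f : bounded_rv f -> bounded_rv (fun w => - f w).
Proof.
move=> /(bounded_rvM (bounded_rv_cst (-1))).
by rewrite (_ : (fun w => -1 * f w) = fun w => - f w) //; apply/funext => w; rewrite mulN1r.
Qed.

Lemma Rintegral_lin (a b : R) f g : bounded_rv f -> bounded_rv g ->
  \int[P]_w (a * f w + b * g w) = a * \int[P]_w f w + b * \int[P]_w g w.
Proof.
move=> bf bg; rewrite RintegralD //; last first.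
- by apply: bounded_rv_integrable; apply: bounded_rvM => //; exact: bounded_rv_cst.
- by apply: bounded_rv_integrable; apply: bounded_rvM => //; exact: bounded_rv_cst.
by rewrite !RintegralZl //; exact: bounded_rv_integrable.
Qed.

Lemma Rintegral1 (c : R) : \int[P]_w c = c.
Proof. by rewrite Rintegral_cst // (congr1 fine (probability_setT P)) mulr1. Qed.

(** The integral of a nonnegative function is a supremum over simple functions below
    it, hence is monotone without measurability. *)
Lemma ge0_le_integral_nomeas (f g : Om -> \bar R) :
  (forall w, (0 <= f w)%E) -> (forall w, (f w <= g w)%E) ->
  (\int[P]_w f w <= \int[P]_w g w)%E.
Proof.
move=> f0 fg; have g0 w : (0 <= g w)%E by apply: le_trans (f0 w) (fg w).
rewrite !ge0_integralTE // ge_ereal_sup // => _ [h /= hf] <-.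
apply: ereal_sup_ubound; exists h => //= w; exact: le_trans (hf w) (fg w).
Qed.

Lemma le_integral_nomeas (f g : Om -> \bar R) : (forall w, (f w <= g w)%E) ->
  (\int[P]_w f w <= \int[P]_w g w)%E.
Proof.
move=> fg; rewrite [leLHS]integralE [leRHS]integralE; apply: leeB.
  apply: ge0_le_integral_nomeas => w; first by rewrite funeposE le_max lexx orbT.
  by rewrite !funeposE ge_max le_max fg le_max lexx orbT.
apply: ge0_le_integral_nomeas => w; first by rewrite funenegE le_max lexx orbT.
by rewrite !funenegE ge_max le_max leeN2 fg le_max lexx orbT.
Qed.

(** Meant for h = S t f (B s), where the semigroup only gives values on the group, so
    that the measurability of h is not at hand. *)
Lemma Rintegral_sandwich f h g : bounded_rv f -> bounded_rv g ->
  (forall w, f w <= h w <= g w) ->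
  \int[P]_w f w <= \int[P]_w h w <= \int[P]_w g w.
Proof.
move=> /bounded_rv_integrable bf /bounded_rv_integrable bg fhg.
have lefh : (\int[P]_w (f w)%:E <= \int[P]_w (h w)%:E)%E.
  by apply: le_integral_nomeas => w; rewrite lee_fin; case/andP: (fhg w).
have lehg : (\int[P]_w (h w)%:E <= \int[P]_w (g w)%:E)%E.
  by apply: le_integral_nomeas => w; rewrite lee_fin; case/andP: (fhg w).
have ff := integrable_fin_num measurableT bf; have fg := integrable_fin_num measurableT bg.
have fh : (\int[P]_w (h w)%:E)%E \is a fin_num.
  rewrite fin_numElt; apply/andP; split.
    by apply: lt_le_trans lefh; move: ff; rewrite fin_numElt => /andP[].
  by apply: le_lt_trans lehg _; move: fg; rewrite fin_numElt => /andP[].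
by rewrite /Rintegral !fine_le.
Qed.

Definition bounded_crv X := bounded_rv (fun w => complex.Re (X w)) /\
  bounded_rv (fun w => complex.Im (X w)).

Lemma bounded_crv_cst z : bounded_crv (fun=> z).
Proof. by split; exact: bounded_rv_cst. Qed.

Lemma bounded_crvD X Y : bounded_crv X -> bounded_crv Y -> bounded_crv (fun w => X w + Y w).
Proof.
move=> [xr xi] [yr yi]; split.
  by under eq_fun do rewrite cReD; exact: bounded_rvD.
by under eq_fun do rewrite cImD; exact: bounded_rvD.
Qed.

Lemma bounded_crvM X Y : bounded_crv X -> bounded_crv Y -> bounded_crv (fun w => X w * Y w).
Proof.
move=> [xr xi] [yr yi]; split.
  under eq_fun do rewrite cReM; apply: bounded_rvD; first exact: bounded_rvM.
  by apply: bounded_rvN; exact: bounded_rvM.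
by under eq_fun do rewrite cImM; apply: bounded_rvD; exact: bounded_rvM.
Qed.

Lemma bounded_crv_conj X : bounded_crv X -> bounded_crv (fun w => (X w)^*).
Proof.
move=> [xr xi]; split.
  by rewrite (_ : (fun w => _) = fun w => complex.Re (X w)) //; apply/funext => w; case: (X w).
rewrite (_ : (fun w => _) = fun w => - complex.Im (X w)); first exact: bounded_rvN.
by apply/funext => w; case: (X w).
Qed.

Lemma bounded_crv_sum (I : Type) (s : seq I) (Q : pred I) (X : I -> Om -> C) :
  (forall i, Q i -> bounded_crv (X i)) -> bounded_crv (fun w => \sum_(i <- s | Q i) X i w).
Proof.
move=> h; elim: s => [|i s IH].
  by under eq_fun do rewrite big_nil; exact: bounded_crv_cst.
case Qi : (Q i); under eq_fun do rewrite big_cons Qi; last exact: IH.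
by apply: bounded_crvD => //; exact: h.
Qed.

Lemma bounded_crv_prod (I : Type) (s : seq I) (Q : pred I) (X : I -> Om -> C) :
  (forall i, Q i -> bounded_crv (X i)) -> bounded_crv (fun w => \prod_(i <- s | Q i) X i w).
Proof.
move=> h; elim: s => [|i s IH].
  by under eq_fun do rewrite big_nil; exact: bounded_crv_cst.
case Qi : (Q i); under eq_fun do rewrite big_cons Qi; last exact: IH.
by apply: bounded_crvM => //; exact: h.
Qed.

Lemma Re_expectationC X : complex.Re (expectationC P X) = \int[P]_w complex.Re (X w).
Proof. by rewrite /expectationC cReD cReM !cRe_rC !cIm_rC mulr0 /= mul0r subr0 addr0. Qed.

Lemma Im_expectationC X : complex.Im (expectationC P X) = \int[P]_w complex.Im (X w).
Proof. by rewrite /expectationC cImD cImM !cRe_rC !cIm_rC mulr0 /= mul1r !add0r. Qed.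

Lemma expectationC_lin z X Y : bounded_crv X -> bounded_crv Y ->
  expectationC P (fun w => z * X w + Y w) = z * expectationC P X + expectationC P Y.
Proof.
move=> bX bY; have [xr xi] := bX; have [yr yi] := bY.
pose x := complex.Re z; pose y := complex.Im z; apply: C_eq.
  rewrite [LHS]Re_expectationC [RHS]cReD [complex.Re (z * _)]cReM.
  rewrite !Re_expectationC Im_expectationC -/x -/y.
  under eq_Rintegral do rewrite cReD cReM -/x -/y.
  rewrite (_ : (fun w => _) = fun w => x * complex.Re (X w) +
     1 * ((- y) * complex.Im (X w) + 1 * complex.Re (Y w))); last first.
    by apply/funext => w; ring.
  rewrite Rintegral_lin //; last first.
    apply: bounded_rvD; apply: bounded_rvM => //; exact: bounded_rv_cst.
  by rewrite Rintegral_lin // !mul1r mulNr addrA.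
rewrite [LHS]Im_expectationC [RHS]cImD [complex.Im (z * _)]cImM.
rewrite !Im_expectationC Re_expectationC -/x -/y.
under eq_Rintegral do rewrite cImD cImM -/x -/y.
rewrite (_ : (fun w => _) = fun w => x * complex.Im (X w) +
   1 * (y * complex.Re (X w) + 1 * complex.Im (Y w))); last first.
  by apply/funext => w; ring.
rewrite Rintegral_lin //; last first.
  apply: bounded_rvD; apply: bounded_rvM => //; exact: bounded_rv_cst.
by rewrite Rintegral_lin // !mul1r addrA.
Qed.

Lemma expectationC_cst z : expectationC P (fun=> z) = z.
Proof. by apply: C_eq; rewrite ?Re_expectationC ?Im_expectationC Rintegral1. Qed.

Lemma expectationC_sum (I : Type) (s : seq I) (z : I -> C) (X : I -> Om -> C) :
  (forall i, bounded_crv (X i)) ->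
  expectationC P (fun w => \sum_(i <- s) z i * X i w) =
  \sum_(i <- s) z i * expectationC P (X i).
Proof.
move=> bX; elim: s => [|i s IH].
  by under [in LHS]eq_fun do rewrite big_nil; rewrite expectationC_cst big_nil.
rewrite big_cons -IH -expectationC_lin //.
  by congr expectationC; apply/funext => w; rewrite big_cons.
apply: bounded_crv_sum => j _; apply: bounded_crvM => //; exact: bounded_crv_cst.
Qed.

Lemma expectationC_conj X : bounded_crv X ->
  expectationC P (fun w => (X w)^*) = (expectationC P X)^*.
Proof.
move=> [xr xi].
have Rec (z : C) : complex.Re z^* = complex.Re z by case: z.
have Imc (z : C) : complex.Im z^* = - complex.Im z by case: z.
apply: C_eq; rewrite ?Rec ?Imc ?Re_expectationC ?Im_expectationC.
  by apply: eq_Rintegral => w _; rewrite Rec.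
under eq_Rintegral do rewrite Imc -mulN1r.
by rewrite RintegralZl ?mulN1r //; exact: bounded_rv_integrable.
Qed.

End BoundedExpectation.

(** * Tensor moments of a random unitary matrix *)
Section RandomUnitary.
Context {d : measure_display} {Om : measurableType d} {R : realType}.
Variables (P : probability Om R) (N n : nat).
Local Notation C := (Cplx R).
Local Notation rC := (@real_to_C R).
Local Notation M := 'M[Cplx R]_N.
Local Notation T := (tensor_End R N n).
Local Open Scope sesquilinear_scope.

Lemma unitary_entry_le1 (g : M) i j : g \is unitarymx -> nC (g i j) <= 1.
Proof.
move=> /unitarymxP/matrixP/(_ i i); rewrite !mxE eqxx => gg.
have : `|g i j| ^+ 2 <= 1.
  rewrite -[leRHS]/(true%:R) -gg (bigD1 j) //= !mxE -normCK lerDl sumr_ge0 // => k _.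
  by rewrite !mxE -normCK exprn_ge0.
rewrite norm_nC -rCX -rC1 rC_le => h.
by rewrite -(@ler_sqr R) ?nnegrE ?nC_ge0 // expr1n.
Qed.

Variable X : Om -> M.
Hypothesis mX : random_mx X.
Hypothesis uX : forall w, X w \is unitarymx.

Lemma bounded_entry i j : bounded_crv (fun w => X w i j).
Proof.
have [mr mi] := mX i j; split; split=> //; exists 1 => w.
  exact: le_trans (cRe_nC _) (unitary_entry_le1 i j (uX w)).
exact: le_trans (cIm_nC _) (unitary_entry_le1 i j (uX w)).
Qed.

Lemma bounded_tensor a b : bounded_crv (fun w => tensor_power n (X w) a b).
Proof.
rewrite (_ : (fun w => _) = fun w => \prod_(r < n) X w ((enum_val a : {ffun 'I_n -> 'I_N}) r)
  ((enum_val b : {ffun 'I_n -> 'I_N}) r)).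
  by apply: bounded_crv_prod => r _; exact: bounded_entry.
by apply/funext => w; rewrite mxE.
Qed.

Local Notation mean := (expectation_mx P (fun w => tensor_power n (X w))).

Lemma expectation_trace (L : T) :
  expectationC P (fun w => \tr (L *m tensor_power n (X w))) = \tr (L *m mean).
Proof.
have trE (A B : T) : \tr (A *m B) =
    \sum_(ab : 'I_#|{ffun 'I_n -> 'I_N}| * 'I_#|{ffun 'I_n -> 'I_N}|) A ab.1 ab.2 * B ab.2 ab.1.
  rewrite /mxtrace -(pair_bigA _ (fun a b => A a b * B b a)) /=.
  by apply: eq_bigr => a _; rewrite mxE.
rewrite (_ : (fun w => _) = fun w => \sum_(ab : 'I_#|{ffun 'I_n -> 'I_N}| * 'I_#|{ffun 'I_n -> 'I_N}|)
    L ab.1 ab.2 * tensor_power n (X w) ab.2 ab.1); last by apply/funext => w; rewrite trE.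
rewrite expectationC_sum => [|ab]; last exact: bounded_tensor.
by rewrite trE; apply: eq_bigr => ab _; rewrite [in RHS]mxE.
Qed.

Lemma bounded_trace (L : T) : bounded_crv (fun w => \tr (L *m tensor_power n (X w))).
Proof.
rewrite (_ : (fun w => _) = fun w => \sum_a \sum_b L a b * tensor_power n (X w) b a).
  apply: bounded_crv_sum => a _; apply: bounded_crv_sum => b _; apply: bounded_crvM.
    exact: bounded_crv_cst.
  exact: bounded_tensor.
by apply/funext => w; apply: eq_bigr => a _; rewrite mxE.
Qed.

Lemma bounded_trace_fun (L : T) : bounded_rv (fun w => trace_fun L (X w)).
Proof. exact: (bounded_trace L).1. Qed.

Lemma integral_trace_fun (L : T) :
  \int[P]_w trace_fun L (X w) = complex.Re (\tr (L *m mean)).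
Proof. by rewrite -expectation_trace Re_expectationC. Qed.

End RandomUnitary.

(** * Large time limit of the tensor moments of a Brownian motion *)
Section BrownianLimit.
Context {d : measure_display} {Om : measurableType d} {R : realType}.
Variables (P : probability Om R) (N n : nat) (G : set 'M[Cplx R]_N).
Local Notation C := (Cplx R).
Local Notation rC := (@real_to_C R).
Local Notation M := 'M[Cplx R]_N.
Local Notation T := (tensor_End R N n).
Local Open Scope sesquilinear_scope.
Variables (B : R -> Om -> M) (k : nat) (E : 'I_k -> M).
Variable S : R -> (M -> R) -> (M -> R).
Hypothesis GU : forall g, G g -> g \is unitarymx.
Hypothesis B_random : forall t : R, 0 <= t -> random_mx (B t).
Hypothesis B_in : forall (t : R) w, 0 <= t -> G (B t w).
Hypothesis B_0 : forall w, B 0 w = 1%:M.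
Hypothesis S_generator : has_generator G S (fun f g => 2^-1 * laplace_beltrami E f g).
Hypothesis B_markov : markov_process G P S B.

Definition casimir_mx : T :=
  2^-1 *: \sum_a lie_act [set: 'I_n] (E a) *m lie_act [set: 'I_n] (E a).

Local Notation mean t := (expectation_mx P (fun w => tensor_power n (B t w))).

Lemma trace_funZ (c : R) (L : T) g : trace_fun (rC c *: L) g = c * trace_fun L g.
Proof.
by rewrite /trace_fun -scalemxAl linearZ /= cReM cRe_rC cIm_rC mul0r subr0.
Qed.

Lemma generator_trace_fun (L : T) g :
  2^-1 * laplace_beltrami E (trace_fun L) g = trace_fun (casimir_mx *m L) g.
Proof.
by rewrite laplace_trace_fun -trace_funZ rCV rC_nat scalemxAl.
Qed.

Lemma natural_filtration_setT s : natural_filtration B s setT.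
Proof.
rewrite -(setD0 setT).
have [h0 hC _] := smallest_sigma_algebra setT [set A | exists (u : R) (i j : 'I_N) (U : set R),
         [/\ 0 <= u <= s, measurable U &
             A = [set w | U (complex.Re (B u w i j))] \/
             A = [set w | U (complex.Im (B u w i j))]] ].
exact: hC.
Qed.

Definition mean_trace (L : T) t := \int[P]_w trace_fun L (B t w).

(** The Markov property over the time interval [s, s + t], with the generator applied to
    the matrix coefficient L; the error is uniform on the group, hence in s. *)
Lemma markov_euler (L : T) (e : R) : 0 < e -> exists2 d0 : R, 0 < d0 &
  forall s t, 0 <= s -> 0 < t < d0 ->
  `|mean_trace L (s + t) - (mean_trace L s + t * mean_trace (casimir_mx *m L) s)| <= t * e.
Proof.
move=> e0; have [d0 /= d00 hd] := S_generator (trace_fun_smooth G L) e0.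
exists d0 => // s t s0 /andP[t0 td].
have st0 : 0 <= s + t by rewrite addr_ge0 // ltW.
have uB u : 0 <= u -> forall w, B u w \is unitarymx by move=> u0 w; apply/GU/B_in.
rewrite [mean_trace L (s + t)](B_markov s0 (ltW t0) (@trace_fun_continuous R N n G L)
  (@natural_filtration_setT s)).
rewrite /mean_trace.
have bL := bounded_trace_fun (B_random s0) (uB s s0) L.
have bCL := bounded_trace_fun (B_random s0) (uB s s0) (casimir_mx *m L).
set I0 := \int[P]_w trace_fun L (B s w); set I1 := \int[P]_w trace_fun (_ *m L) (B s w).
have intE c : \int[P]_w (1 * (1 * trace_fun L (B s w) + t * trace_fun (casimir_mx *m L) (B s w)) + 1 * c)
    = I0 + t * I1 + c.
  rewrite Rintegral_lin; last exact: bounded_rv_cst; last first.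
    by apply: bounded_rvD; apply: bounded_rvM => //; exact: bounded_rv_cst.
  by rewrite Rintegral_lin // Rintegral1 !mul1r.
have bE c : bounded_rv (fun w => 1 * (1 * trace_fun L (B s w) + t * trace_fun (casimir_mx *m L) (B s w)) + 1 * c).
  apply: bounded_rvD; last exact: bounded_rv_cst.
  apply: bounded_rvM; first exact: bounded_rv_cst.
  by apply: bounded_rvD; apply: bounded_rvM => //; exact: bounded_rv_cst.
have := @Rintegral_sandwich _ _ _ P _ (fun w => S t (trace_fun L) (B s w)) _
  (bE (- (t * e))) (bE (t * e)).
rewrite !intE => sw; rewrite ler_distl; apply: sw => w.
have := hd t; rewrite /ball_ /= sub0r normrN gtr0_norm // => /(_ td t0 _ (B_in w s0)).
rewrite generator_trace_fun ltr_distl => /andP[h1 h2].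
rewrite !mul1r; set f := trace_fun L _ in h1 h2 *; set g := trace_fun _ _ in h1 h2 *.
move: h1 h2; rewrite ltr_pdivlMr // ltr_pdivrMr // => h1 h2.
by apply/andP; split; lra.
Qed.

Lemma mean_trace_0 (L : T) : mean_trace L 0 = complex.Re (\tr L).
Proof.
have rho1 : tensor_power n (1%:M : M) = 1%:M by rewrite tensor_powerE tens1.
rewrite -[RHS](Rintegral1 P); apply: eq_Rintegral => w _.
by rewrite B_0 /trace_fun rho1 mulmx1.
Qed.

Lemma mean_trace_bounded (L : T) : exists c, forall t, 0 <= t -> `|mean_trace L t| <= c.
Proof.
pose c := \sum_a \sum_b nC (L a b); exists c => t t0.
have uB w : B t w \is unitarymx by apply/GU/B_in.
have h w : - c <= trace_fun L (B t w) <= c.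
  rewrite -ler_norml; apply: le_trans (cRe_nC _) _; rewrite /mxtrace.
  apply: le_trans (nC_sum _ _ _) (ler_sum _ _) => a _; rewrite mxE.
  apply: le_trans (nC_sum _ _ _) (ler_sum _ _) => b _; rewrite nCM ler_piMr ?nC_ge0 //.
  rewrite mxE -rC_le -norm_nC normr_prod rC1; apply: prodr_ile1 => r _.
  by rewrite normr_ge0 norm_nC -rC1 rC_le unitary_entry_le1.
have := Rintegral_sandwich P (bounded_rv_cst (- c)) (bounded_rv_cst c) h.
by rewrite !Rintegral1 ler_norml.
Qed.

Lemma mean_trace_sum (I : finType) (L : I -> T) t : 0 <= t ->
  mean_trace (\sum_i L i) t = \sum_i mean_trace (L i) t.
Proof.
move=> t0; have uB w : B t w \is unitarymx by apply/GU/B_in.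
under [RHS]eq_bigr do rewrite /mean_trace (integral_trace_fun P (B_random t0) uB).
rewrite /mean_trace (integral_trace_fun P (B_random t0) uB) -cRe_sum.
by congr complex.Re; rewrite mulmx_suml linear_sum.
Qed.

(** On an eigenspace of the Casimir operator, [markov_euler] says that the mean is an
    approximate solution of x' = lam x; it is constant or decays. *)
Lemma mean_trace_eigen (L : T) (lam : R) : casimir_mx *m L = rC lam *: L -> lam <= 0 ->
  mean_trace L t @[t --> +oo] --> (if lam == 0 then complex.Re (\tr L) else 0 : R).
Proof.
move=> CL lam0; have [c hc] := mean_trace_bounded L.
have eu e : 0 < e -> exists2 d0 : R, 0 < d0 & forall s t, 0 <= s -> 0 < t < d0 ->
    `|mean_trace L (s + t) - (1 + t * lam) * mean_trace L s| <= t * e.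
  move=> e0; have [d0 d00 h] := markov_euler L e0; exists d0 => // s t s0 t0.
  have -> : (1 + t * lam) * mean_trace L s =
      mean_trace L s + t * mean_trace (casimir_mx *m L) s.
    rewrite mulrDl mul1r -mulrA; congr (_ + t * _).
    have uB w : B s w \is unitarymx by apply/GU/B_in.
    rewrite CL /mean_trace -RintegralZl //; last first.
      exact/bounded_rv_integrable/(bounded_trace_fun (B_random s0) uB).
    by apply: eq_Rintegral => w _; rewrite trace_funZ.
  exact: h.
have [l0|l0] := eqVneq lam 0.
  rewrite -mean_trace_0; apply: cvg_near_cst.
  by near=> t; apply: (euler_constant eu).
by apply: (euler_decay hc eu); rewrite lt_neqAle l0.
Unshelve. all: by end_near.
Qed.

Hypothesis E_antiherm : forall a, (E a)^t* = - E a.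

Lemma casimir_herm : casimir_mx^t* = casimir_mx.
Proof.
rewrite /casimir_mx; set S0 := \sum_a _.
have S0E : S0^t* = S0.
  rewrite /S0 adj_sum; apply: eq_bigr => a _.
  by rewrite adj_mul adj_lie_act E_antiherm lie_actN mulNmx mulmxN opprK.
clearbody S0; apply/matrixP => i j; rewrite -[in RHS]S0E !mxE.
by rewrite rmorphM fmorphV rmorph_nat.
Qed.

(** The Casimir operator is a sum of squares of anti-Hermitian operators. *)
Lemma casimir_quadratic (x : 'cV_#|{ffun 'I_n -> 'I_N}|) : (x^t* *m casimir_mx *m x) 0 0 =
  - 2^-1 * \sum_a nrm2 (lie_act [set: 'I_n] (E a) *m x).
Proof.
rewrite /casimir_mx -scalemxAr -scalemxAl mxE mulNr -mulrN; congr (_ * _).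
rewrite mulmx_sumr mulmx_suml summxE -sumrN; apply: eq_bigr => a _.
by rewrite /nrm2 adj_mul adj_lie_act E_antiherm lie_actN mulmxN mulNmx [X in - X]mxE opprK !mulmxA.
Qed.

Lemma casimir_le0 (x : 'cV_#|{ffun 'I_n -> 'I_N}|) : (x^t* *m casimir_mx *m x) 0 0 <= 0.
Proof.
rewrite casimir_quadratic mulNr oppr_le0 mulr_ge0 ?invr_ge0 // sumr_ge0 // => a _.
exact: nrm2_ge0.
Qed.

Lemma casimir_ker (x : 'cV_#|{ffun 'I_n -> 'I_N}|) : casimir_mx *m x = 0 ->
  forall a, lie_act [set: 'I_n] (E a) *m x = 0.
Proof.
move=> Cx a; apply: nrm2_eq0.
have /eqP := casimir_quadratic x; rewrite -mulmxA Cx mulmx0 mxE eq_sym.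
rewrite mulf_eq0 oppr_eq0 invr_eq0 pnatr_eq0 /= psumr_eq0 => [|b _]; last exact: nrm2_ge0.
by move=> /allP/(_ a (mem_index_enum _))/eqP.
Qed.

(** Split L along the eigenspaces of the Casimir operator. *)
Lemma mean_trace_limit (L : T) : mean_trace L t @[t --> +oo] -->
  complex.Re (\tr (ker_proj casimir_mx *m L)).
Proof.
pose lam i := complex.Re (spectral_diag casimir_mx 0 i).
have lamE i : spectral_diag casimir_mx 0 i = rC (lam i).
  have := eigenvalue_le0 casimir_herm casimir_le0 i; rewrite -oppr_ge0 => h.
  by apply: C_eq => //; apply/eqP; rewrite -oppr_eq0 -(ger0_Im h); case: (spectral_diag _ _ _).
have lam0 i : lam i <= 0.
  by rewrite -rC_le rC0 -lamE; exact: (eigenvalue_le0 casimir_herm casimir_le0).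
have -> : complex.Re (\tr (ker_proj casimir_mx *m L)) =
    \sum_i (if lam i == 0 then complex.Re (\tr (eigen_proj casimir_mx i *m L)) else 0).
  transitivity (\sum_(i | spectral_diag casimir_mx 0 i == 0)
      complex.Re (\tr (eigen_proj casimir_mx i *m L))).
    by rewrite -cRe_sum; congr complex.Re; rewrite /ker_proj mulmx_suml linear_sum.
  rewrite big_mkcond; apply: eq_bigr => i _.
  by rewrite lamE -rC0 (inj_eq (@rC_inj R)).
apply: (@cvg_trans _ (\sum_i mean_trace (eigen_proj casimir_mx i *m L) t @[t --> +oo])).
  apply: near_eq_cvg; near=> t; rewrite -mean_trace_sum.
    by rewrite -mulmx_suml sum_eigen_proj mul1mx.
  by near: t; apply: nbhs_pinfty_ge; exact: num_real.
apply: (cvg_big (op := +%R)) => //; first by move=> [x y]; exact: add_continuous.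
move=> i _; apply: mean_trace_eigen => //.
by rewrite mulmxA (mul_eigen_proj casimir_herm) lamE scalemxAl.
Unshelve. all: by end_near.
Qed.

Lemma mean_limit : mean t @[t --> +oo] --> ker_proj casimir_mx.
Proof.
have trE (A : T) a b c : \tr (c *: delta_mx b a *m A) = c * A a b.
  rewrite -scalemxAl linearZ /= /mxtrace (bigD1 b) //= mxE (bigD1 a) //= !mxE !eqxx.
  rewrite mul1r big1 => [|x xa]; last by rewrite mxE eqxx (negPf xa) mul0r.
  rewrite addr0 big1 ?addr0 // => y yb; rewrite mxE big1 // => x _.
  by rewrite mxE (negPf yb) mul0r.
have lim a b c : complex.Re (c * mean t a b) @[t --> +oo] -->
    complex.Re (c * ker_proj casimir_mx a b).
  have := mean_trace_limit (L := c *: delta_mx b a); rewrite mxtrace_mulC trE.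
  apply: cvg_trans; apply: near_eq_cvg; near=> t.
  have t0 : 0 <= t by near: t; apply: nbhs_pinfty_ge; exact: num_real.
  have uB w : B t w \is unitarymx by apply/GU/B_in.
  by rewrite /mean_trace (integral_trace_fun P (B_random t0) uB) trE.
(* Real parts of the trace functions give the imaginary parts as well. *)
have Im_i (z : C) : complex.Re (- 'i * z) = complex.Im z.
  by case: z => x y /=; rewrite !(mul0r, oppr0) mulN1r sub0r opprK.
apply: cvg_mx_entries => a b; apply: cvg_ReIm.
  by have := lim a b 1; under eq_fun do rewrite mul1r; rewrite mul1r.
by have := lim a b (- 'i); under eq_fun do rewrite Im_i; rewrite Im_i.
Unshelve. all: by end_near.
Qed.

End BrownianLimit.

(** * Brownian motions on the groups preserving a form *)
Section BrownianForm.
Context {d : measure_display} {Om : measurableType d} {R : realType}.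
Variables (P : probability Om R) (N n : nat) (K : 'M[Cplx R]_N) (eps : Cplx R).
Local Notation C := (Cplx R).
Local Notation rC := (@real_to_C R).
Local Notation M := 'M[Cplx R]_N.
Local Open Scope sesquilinear_scope.
Hypothesis KT : K^T = eps *: K.
Hypothesis KKT : K *m K^T = 1%:M.
Hypothesis Kreal : map_mx Num.conj K = K.
Hypothesis eps2 : eps * eps = 1.

(** The hypotheses on G leave out its components: O(N) and SO(N) have the same Lie
    algebra, and the same limit Pi, the projection on the vectors that it kills. *)
Lemma brownian_mean_limit (G : set M) (B : R -> Om -> M) :
  G `<=` form_group K ->
  (forall X : M, X^t* = - X -> in_form_lie K X -> lie_algebra G X) ->
  brownian_motion G P B ->
  exists2 Pi : tensor_End R N n, invariant_projection K Pi &
    expectation_mx P (fun w => tensor_power n (B t w)) @[t --> +oo] --> Pi.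
Proof.
move=> GK GX [B_random B_in B_0 _ [k [E [S [[lE _ bE] _ SE BS]]]]].
have GU g : G g -> g \is unitarymx by move=> /GK [].
have Eh a : (E a)^t* = - E a by case: (lie_algebra_form GK (lE a)).
exists (ker_proj (casimir_mx n E)); last exact: (mean_limit GU B_random B_in B_0 SE BS Eh).
split.
- exact: ker_proj_herm.
- move=> x; apply: (lie_killed_of_algebra KT KKT Kreal eps2 GX) => X /bE[c ->].
  rewrite lie_act_sum mulmx_suml big1 // => a _.
  rewrite lie_actZ -scalemxAl (casimir_ker Eh) ?scaler0 // mulmxA.
  by rewrite (mul_ker_proj (casimir_herm n Eh)) mul0mx.
move=> x kx; apply: (ker_proj_fix (casimir_herm n Eh) (casimir_le0 Eh)).
rewrite /casimir_mx -scalemxAl mulmx_suml big1 ?scaler0 // => a _.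
by rewrite -mulmxA kx ?mulmx0 //; case: (lie_algebra_form GK (lE a)).
Qed.

End BrownianForm.

(** * The limit as a Weingarten sum *)
Section WeingartenProjector.
Variables (R : realType) (N n : nat) (K : 'M[Cplx R]_N) (eps : Cplx R).
Variables (delta : 'I_n -> 'I_n -> Cplx R) (zeta : R).
Local Notation C := (Cplx R).
Local Notation rC := (@real_to_C R).
Local Open Scope sesquilinear_scope.
Hypothesis KT : K^T = eps *: K.
Hypothesis KKT : K *m K^T = 1%:M.
Hypothesis Kreal : map_mx Num.conj K = K.
Hypothesis eps2 : eps * eps = 1.
Hypothesis deltaC : forall a b, delta a b = eps * delta b a.
Hypothesis delta_neq0 : forall a b, a != b -> delta a b != 0.
Hypothesis delta_real : forall a b, (delta a b)^* = delta a b.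
Hypothesis N_gt0 : (0 < N)%N.
Hypothesis zetaE : rC zeta = eps * N%:R.

Local Notation D0 := (alt delta (enum 'I_n)).
Local Notation mx m := (pairing delta K (matching_pairs (enum_val m : matching 'I_n))).

(** The normalisation makes the sign of the identity word equal to 1. *)
Definition pairing_mx : 'M[C]_(#|{ffun 'I_n -> 'I_N}|, #|{: matching 'I_n}|) :=
  \matrix_(x, a) (D0^-1 * mx a x 0).

(** By [gram_pairing_mx] the Gram matrix of the pairing vectors is eps^(n/2) times
    [gram_mx]; its generalised inverse carries the same sign. *)
Definition weingarten_mx : 'M[C]_#|{: matching 'I_n}| :=
  eps ^+ n./2 *: map_mx rC (pseudo_inverse (gram_mx n zeta)).

Lemma alt_real w : (alt delta w)^* = alt delta w.
Proof.
elim: w => [|x w IH] /=; first by rewrite rmorph1.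
rewrite rmorphM rmorph_prod /= IH. congr (_ * _). by apply: eq_bigr => y _.
Qed.

Lemma pairing_mx_real : map_mx Num.conj pairing_mx = pairing_mx.
Proof.
apply/matrixP => x a; rewrite !mxE !rmorphM fmorphV /= !alt_real; congr (_ * (_ * _)).
rewrite /form_prod rmorph_prod; apply: eq_bigr => ab _.
by have /matrixP/(_ (enum_val x ab.1) (enum_val x ab.2)) := Kreal; rewrite mxE.
Qed.

Lemma D0_neq0 : D0 != 0.
Proof. by apply: alt_neq0 => //; exact: enum_uniq. Qed.

Lemma gram_pairing_mx : pairing_mx^T *m pairing_mx = eps ^+ n./2 *: map_mx rC (gram_mx n zeta).
Proof.
apply/matrixP => a b; rewrite [RHS]mxE [map_mx _ _ _ _]mxE [gram_mx _ _ _ _]mxE rCX zetaE.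
have := gram_value eps2 deltaC KT KKT N_gt0 (enum_val a) (enum_val b).
set r := eps ^+ _ * _ => gE.
transitivity (D0^-1 ^+ 2 * gram delta K (enum_val a) (enum_val b)).
  rewrite /gram !mxE mulr_sumr; apply: eq_bigr => x _.
  by rewrite [(_^T) 0 x]mxE [(_^T) a x]mxE ![pairing_mx _ _]mxE expr2 [RHS]mulrACA.
by rewrite gE mulrA -exprMn mulVf ?D0_neq0 // expr1n mul1r.
Qed.

(** This is the symmetry of the number of cycles, read off from V^T V. *)
Lemma gram_mx_sym : (gram_mx n zeta)^T = gram_mx n zeta.
Proof.
have e0 : eps ^+ n./2 != 0 by rewrite expf_neq0 //; apply: contra_eq_neq eps2 => ->; rewrite mul0r eq_sym oner_eq0.
have : (eps ^+ n./2 *: map_mx rC (gram_mx n zeta))^T = eps ^+ n./2 *: map_mx rC (gram_mx n zeta).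
  by rewrite -gram_pairing_mx trmx_mul trmxK.
move=> /matrixP h; apply/matrixP => a b; have := h a b.
by rewrite [LHS]mxE [LHS]mxE [RHS]mxE => /(mulfI e0); rewrite !mxE => /rC_inj.
Qed.

Lemma gram_weingarten_gram :
  pairing_mx^T *m pairing_mx *m weingarten_mx *m (pairing_mx^T *m pairing_mx) =
  pairing_mx^T *m pairing_mx.
Proof.
have [GWG _ _ _] := pseudo_inverseP gram_mx_sym.
rewrite gram_pairing_mx /weingarten_mx -!(scalemxAl, scalemxAr) !scalerA.
rewrite -[eps ^+ _ * eps ^+ _]expr2 (epsX eps2) mul1r.
pose f : {rmorphism R -> C} := real_complex R.
by rewrite -!(map_mxM f) GWG.
Qed.

Definition matching_sign (p : matching 'I_n) : C := D0^-1 * alt delta (word (matching_pairs p)).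

Lemma projector_entry x y : projector pairing_mx weingarten_mx x y =
  \sum_(p : matching 'I_n) \sum_(q : matching 'I_n) rC (Wg zeta p q) *
    (eps ^+ n./2 * matching_sign p * matching_sign q *
     form_prod K (matching_pairs p) (enum_val x) * form_prod K (matching_pairs q) (enum_val y)).
Proof.
rewrite /projector mxE; under eq_bigr do rewrite mxE mulr_suml.
rewrite exchange_big (reindex (@enum_rank (matching 'I_n))); last first.
  by exists enum_val => a _; rewrite ?enum_rankK ?enum_valK.
apply: eq_bigr => p _; rewrite (reindex (@enum_rank (matching 'I_n))); last first.
  by exists enum_val => a _; rewrite ?enum_rankK ?enum_valK.
apply: eq_bigr => q _; rewrite !(mxE matrix_key) !enum_rankK.
rewrite [weingarten_mx _ _]mxE [map_mx _ _ _ _]mxE -/(Wg zeta p q).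
rewrite [(_^T) _ _]mxE [pairing_mx _ _]mxE enum_rankK [pairing _ _ _ y 0]mxE /matching_sign.
by ring.
Qed.

Lemma pairing_mx_killed a : lie_killed K [set: 'I_n] (col a pairing_mx).
Proof.
move=> X lX; have := lie_killed_pairing eps2 deltaC KT KKT N_gt0 (enum_val a) lX.
have -> : col a pairing_mx = D0^-1 *: mx a by apply/colP => x; rewrite 2!mxE [RHS]mxE.
by move=> h; rewrite -scalemxAr h scaler0.
Qed.

Lemma pairing_mx_orthogonal (u : 'cV[C]_#|{ffun 'I_n -> 'I_N}|) : pairing_mx^T *m u = 0 ->
  forall s, perm_eq (word s) (enum 'I_n) -> \sum_j form_prod K s j * vat u j = 0.
Proof.
move=> Vu s ws; have [p [sp _]] := matching_of_list ws.
have pE : pairing delta K (matching_pairs p) = pairing delta K s.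
  rewrite -(pairing_ordp eps2 deltaC KT s).
  by apply/esym/(pairing_perm eps2 deltaC).
have us : uniq (word s) by rewrite (perm_uniq ws) enum_uniq.
apply: (mulfI (mulf_neq0 (invr_neq0 D0_neq0) (alt_neq0 delta_neq0 us))); rewrite mulr0.
transitivity ((pairing_mx^T *m u) (enum_rank p) 0); last by rewrite Vu mxE.
rewrite mxE.
rewrite [RHS](reindex (@enum_rank {ffun 'I_n -> 'I_N})); last first.
  by exists enum_val => x _; rewrite ?enum_rankK ?enum_valK.
rewrite mulr_sumr; apply: eq_bigr => j _.
by rewrite [(_^T) _ _]mxE [pairing_mx _ _]mxE enum_rankK pE -/(vat _ j) vat_pairing /vat !mulrA.
Qed.

Lemma pairing_mx_fix X X' : X^T *m K *m X = K -> X' *m X = 1%:M ->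
  (tens (fun=> X))^T *m pairing_mx = pairing_mx.
Proof.
move=> XKX X'X; apply/matrixP => x a.
have /colP/(_ x) := tens_pairing delta (enum_val a) XKX X'X; set v := pairing _ _ _ => h.
transitivity (D0^-1 * v x 0); last by rewrite [RHS]mxE.
rewrite -h [in LHS]mxE [in RHS]mxE mulr_sumr; apply: eq_bigr => y _.
by rewrite [pairing_mx _ _]mxE mulrCA.
Qed.

(** F is meant to be the mean at time t of a tensor power, and Rm the mean of an initial
    condition, whose adjoint fixes the pairing vectors and kills the invariants
    orthogonal to them. *)
Lemma weingarten_limit (Pi Rm : tensor_End R N n) (F : R -> tensor_End R N n) :
  invariant_projection K Pi -> F t @[t --> +oo] --> Pi ->
  Rm^t* *m pairing_mx = pairing_mx ->
  (forall u : 'cV_#|{ffun 'I_n -> 'I_N}|, lie_killed K [set: 'I_n] u ->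
     (forall s, perm_eq (word s) (enum 'I_n) -> \sum_j form_prod K s j * vat u j = 0) ->
     Rm^t* *m u = 0) ->
  F t *m Rm @[t --> +oo] --> projector pairing_mx weingarten_mx.
Proof.
move=> PiK FPi RV Ru.
rewrite -(limit_projector pairing_mx_real gram_weingarten_gram pairing_mx_killed PiK RV).
  2: by move=> u ku Vu; apply: Ru => //; exact: pairing_mx_orthogonal.
apply: cvg_mx_entries => a b; rewrite mxE; under eq_fun do rewrite mxE.
apply: (cvg_big (op := +%R)) => //; first by move=> [x y]; exact: add_continuous.
move=> x _; apply: cvgM; last exact: cvg_cst.
have := @cvg_comp _ _ _ _ (fun A : tensor_End R N n => A a x) _ _ _ FPi; apply.
exact: coord_continuous.
Qed.

End WeingartenProjector.

(** * Orthogonal groups and random orthogonal matrices *)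
Section LieAlgebras.
Variables (R : realType) (N : nat).
Local Notation C := (Cplx R).
Local Notation rC := (@real_to_C R).
Local Notation M := 'M[Cplx R]_N.
Local Open Scope sesquilinear_scope.

Lemma conj_entry_real (z : C) : complex.Im z = 0 -> z^* = z.
Proof. by move=> z0; rewrite [z in RHS]C_ReIm [z in LHS]C_ReIm z0 rC0 mulr0 !addr0 rC_conj. Qed.

Lemma real_of_conj (z : C) : z^* = z -> complex.Im z = 0.
Proof.
case: z => x y /= [] /eqP; rewrite eq_sym -subr_eq0 opprK -mulr2n mulrn_eq0 /=.
by move/eqP.
Qed.

Lemma orthogonal_group_form : @orthogonal_group R N = form_group (1%:M : M).
Proof.
apply/seteqP; split=> g /=.
  move=> [gr gg]; have gc : map_mx Num.conj g = g.
    by apply/matrixP => i j; rewrite mxE conj_entry_real.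
  split; last by rewrite mulmx1.
  by apply/unitarymxP; rewrite -map_trmx gc; exact: mulmx1C.
move=> [/unitarymxP ug gg]; rewrite mulmx1 in gg; split=> // i j.
apply: real_of_conj; have gE : map_mx Num.conj g = g.
  apply: trmx_inj; rewrite map_trmx -[LHS]mul1mx -gg -mulmxA.
  by rewrite ug mulmx1.
by rewrite -[in RHS]gE mxE.
Qed.

Lemma lie_algebra_form_group (K : M) (eps : C) : K^T = eps *: K -> K *m K^T = 1%:M ->
  eps * eps = 1 ->
  forall X, X^t* = - X -> in_form_lie K X -> lie_algebra (form_group K) X.
Proof.
move=> KT KKT eps2 X Xh lX t.
apply: (form_group_expm KKT); first by rewrite adj_scale rC_conj Xh scalerN.
rewrite -[_ *: X]addr0 -[0](scale0r X); exact: in_form_lie_comb.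
Qed.

(** exp(tX) is the square of the orthogonal matrix exp(tX/2), so has determinant 1. *)
Lemma lie_algebra_special_orthogonal (X : M) : X^t* = - X -> in_form_lie 1%:M X ->
  lie_algebra (@special_orthogonal_group R N) X.
Proof.
move=> Xh lX t; have T1 : (1%:M : M)^T = 1 *: 1%:M by rewrite trmx1 scale1r.
have T2 : (1%:M : M) *m 1%:M^T = 1%:M by rewrite trmx1 mulmx1.
have h s : orthogonal_group (expm (rC s *: X)).
  by rewrite orthogonal_group_form; exact: (lie_algebra_form_group T1 T2 (mulr1 1)).
split; first exact: h.
have -> : rC t *: X = rC (t / 2) *: X + rC (t / 2) *: X.
  by rewrite -scalerDl -rCD -splitr.
rewrite -expmD // det_mulmx; have [_ /(congr1 determinant)] := h (t / 2).
by rewrite det_mulmx det_tr det1.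
Qed.

End LieAlgebras.

Section AdjointExpectation.
Context {d : measure_display} {Om : measurableType d} {R : realType}.
Variables (P : probability Om R) (m : nat) (Y : Om -> 'M[Cplx R]_m).
Hypothesis Yb : forall i j, bounded_crv (fun w => Y w i j).
Local Open Scope sesquilinear_scope.

Lemma expectation_mx_adj k (v : 'M[Cplx R]_(m, k)) x a :
  ((expectation_mx P Y)^t* *m v) x a = expectationC P (fun w => ((Y w)^t* *m v) x a).
Proof.
transitivity (expectationC P (fun w => \sum_y v y a * (Y w y x)^*)).
  rewrite expectationC_sum => [|y]; last exact: bounded_crv_conj.
  rewrite mxE; apply: eq_bigr => y _; rewrite expectationC_conj //.
  by rewrite [in LHS]mxE [in LHS]mxE [in LHS]mxE mulrC.
congr expectationC; apply/funext => w; rewrite mxE; apply: eq_bigr => y _.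
by rewrite [in RHS]mxE [in RHS]mxE mulrC.
Qed.

End AdjointExpectation.

Section RandomOrthogonal.
Context {d : measure_display} {Om : measurableType d} {R : realType}.
Variables (P : probability Om R) (N n : nat) (O : Om -> 'M[Cplx R]_N).
Local Notation C := (Cplx R).
Local Notation M := 'M[Cplx R]_N.
Local Open Scope sesquilinear_scope.
Hypothesis O_random : random_mx O.
Hypothesis O_orth : forall w, orthogonal_group (O w).

Lemma orthogonal_unitary w : O w \is unitarymx.
Proof. by have := O_orth w; rewrite orthogonal_group_form => -[]. Qed.

Lemma orthogonal_conj w : map_mx Num.conj (O w) = O w.
Proof. by apply/matrixP => i j; rewrite mxE conj_entry_real //; case: (O_orth w). Qed.

Lemma bounded_det : bounded_crv (fun w => \det (O w)).
Proof.
apply: bounded_crv_sum => s _; apply: bounded_crvM; first exact: bounded_crv_cst.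
by apply: bounded_crv_prod => i _; exact: (bounded_entry O_random orthogonal_unitary).
Qed.

Lemma det_orthogonal w : \det (O w) = 1 \/ \det (O w) = -1.
Proof.
have [_ /(congr1 determinant)] := O_orth w; rewrite det_mulmx det_tr det1 -expr2 => /eqP.
by rewrite sqrf_eq1 => /orP[]/eqP; [left|right].
Qed.

Lemma expectation_det0 :
  P [set w | \det (O w) = 1] = P [set w | \det (O w) = -1] ->
  expectationC P (fun w => \det (O w)) = 0.
Proof.
move=> Peq; have [[mr _] _] := bounded_det.
have N10 : (-1 : R) <> 1 by move=> /eqP; rewrite -subr_eq0 -opprD oppr_eq0 -mulr2n pnatr_eq0.
pose A := [set w | \det (O w) = 1]; pose B := [set w | \det (O w) = -1].
have AE : A = (fun w => complex.Re (\det (O w))) @^-1` [set 1].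
  apply/seteqP; split=> w /=; first by rewrite /A /= => ->.
  by rewrite /A /=; case: (det_orthogonal w) => -> //= /N10.
have BE : B = (fun w => complex.Re (\det (O w))) @^-1` [set -1].
  apply/seteqP; split=> w /=; first by rewrite /B /= => ->.
  by rewrite /B /=; case: (det_orthogonal w) => -> //= /esym/N10.
have mA : measurable A by rewrite AE -[X in measurable X]setTI; exact: mr.
have mB : measurable B by rewrite BE -[X in measurable X]setTI; exact: mr.
have bI (D : set Om) : measurable D -> bounded_rv (fun w => \1_D w : R).
  move=> mD; split; first exact: measurable_indic.
  by exists 1 => w; rewrite indicE; case: (_ \in _); rewrite ?normr1 ?normr0.
have intI (D : set Om) : measurable D -> \int[P]_w (\1_D w : R) = fine (P D).
  by move=> mD; rewrite /Rintegral integral_indic // setIT.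
apply: C_eq; rewrite ?Re_expectationC ?Im_expectationC.
  transitivity (\int[P]_w (1 * \1_A w + -1 * \1_B w : R)).
    apply: eq_Rintegral => w _; rewrite !indicE; have [dw|dw] := det_orthogonal w.
      rewrite dw mem_set // memNset ?mulr0 ?addr0 ?mulr1 //.
      by rewrite /B /= dw => /(congr1 (@complex.Re R)) /= /esym/N10.
    rewrite dw memNset ?mem_set ?mulr0 ?add0r ?mulr1 //.
    by rewrite /A /= dw => /(congr1 (@complex.Re R)) /= /N10.
  rewrite Rintegral_lin; [|exact: bI|exact: bI].
  by rewrite !intI // /A /B Peq mulN1r mul1r subrr.
rewrite -[RHS](Rintegral1 P); apply: eq_Rintegral => w _.
by case: (det_orthogonal w) => -> /=; rewrite ?oppr0.
Qed.

Local Notation mean := (expectation_mx P (fun w => tensor_power n (O w))).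

Lemma orthogonal_mean_fix k (V : 'M[C]_(#|{ffun 'I_n -> 'I_N}|, k)) :
  (forall w, (tens (fun=> O w))^T *m V = V) -> mean^t* *m V = V.
Proof.
move=> OV; apply/matrixP => x a.
rewrite (expectation_mx_adj P (bounded_tensor O_random orthogonal_unitary)).
rewrite -[RHS](expectationC_cst P); congr expectationC; apply/funext => w.
have -> : (tensor_power n (O w))^t* = (tens (fun=> O w))^T.
  rewrite tensor_powerE; apply/matrixP => i j; rewrite !mxE rmorph_prod.
  by apply: eq_bigr => r _; have /matrixP/(_ (enum_val j r) (enum_val i r)) := orthogonal_conj w; rewrite mxE.
by rewrite OV.
Qed.

(** Meant for the invariants u orthogonal to the pairings, on which orthogonal matrices
    act through their determinant. *)
Lemma orthogonal_mean_kill (u : 'cV[C]_#|{ffun 'I_n -> 'I_N}|) :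
  expectationC P (fun w => \det (O w)) = 0 ->
  (forall w, tens (fun=> (O w)^t*) *m u = \det ((O w)^t*) *: u) -> mean^t* *m u = 0.
Proof.
move=> E0 Ou; apply/matrixP => x a.
rewrite (expectation_mx_adj P (bounded_tensor O_random orthogonal_unitary)).
transitivity (expectationC P (fun w => \sum_(i <- [:: u x a]) i * \det (O w))).
  congr expectationC; apply/funext => w; rewrite big_seq1.
  rewrite tensor_powerE adj_tens Ou mxE -map_trmx orthogonal_conj det_tr.
  by rewrite mulrC.
by rewrite expectationC_sum => [|?]; [rewrite big_seq1 E0 mulr0 mxE|exact: bounded_det].
Qed.

End RandomOrthogonal.

(** * Signs of matchings and the symplectic form *)
Section VandermondeSign.
Variables (R : realType) (n : nat).
Local Notation C := (Cplx R).

(** With this delta, [alt] is the classical Vandermonde product. *)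
Definition ord_diff (a b : 'I_n) : C := b%:R - a%:R.

Lemma alt_map (f : 'I_n -> 'I_n) : alt ord_diff [seq f i | i <- enum 'I_n] =
  \prod_(i < n) \prod_(j < n | (i < j)%N) ord_diff (f i) (f j).
Proof.
have h (s : seq 'I_n) : sorted (fun i j : 'I_n => (i < j)%N) s ->
    alt ord_diff [seq f i | i <- s] =
    \prod_(i <- s) \prod_(j <- s | (i < j)%N) ord_diff (f i) (f j).
  have tr : transitive (fun i j : 'I_n => (i < j)%N) by move=> y x z; exact: ltn_trans.
  elim: s => [|x s IH] /= ps; first by rewrite big_nil.
  have /allP xs : all (fun j : 'I_n => (x < j)%N) s := order_path_min tr ps.
  rewrite IH ?(path_sorted ps) // !big_cons ltnn big_map; congr (_ * _).
    by rewrite big_seq [RHS]big_seq_cond; apply: eq_bigl => j; case: (j \in s) (xs j) => // ->.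
  rewrite big_seq [RHS]big_seq; apply: eq_bigr => i /xs xi.
  by rewrite big_cons ltnNge (ltnW xi).
rewrite h; last first.
  have := iota_ltn_sorted 0 n; rewrite -val_enum_ord sorted_map.
  by apply: sub_sorted.
by rewrite big_enum /=; apply: eq_bigr => i _; rewrite big_enum_cond.
Qed.

(** Permuting the columns of a Vandermonde determinant multiplies it by the sign. *)
Lemma alt_ord_diff_perm (s : 'S_n) : alt ord_diff [seq s i | i <- enum 'I_n] =
  (-1) ^+ s * alt ord_diff (enum 'I_n).
Proof.
pose v : 'rV[C]_n := \row_i i%:R.
have E (f : 'I_n -> 'I_n) : alt ord_diff [seq f i | i <- enum 'I_n] =
    \det (\matrix_(i < n, j < n) (f j)%:R ^+ i : 'M[C]_n).
  rewrite alt_map -[RHS]/(\det _).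
  have -> : (\matrix_(i, j) (f j)%:R ^+ i : 'M[C]_n) = Vandermonde n (\row_j (f j)%:R).
    by apply/matrixP => i j; rewrite !mxE.
  by rewrite det_Vandermonde; apply: eq_bigr => i _; apply: eq_bigr => j _; rewrite !mxE.
rewrite E -[X in _ * alt _ X]map_id E.
have -> : \matrix_(i, j) (s j)%:R ^+ i = (\matrix_(i, j) j%:R ^+ i : 'M[C]_n) *m (perm_mx s)^T.
  by rewrite tr_perm_mx -col_permE; apply/matrixP => i j; rewrite !mxE.
by rewrite det_mulmx det_tr det_perm mulrC.
Qed.

Lemma ord_diffC a b : ord_diff a b = -1 * ord_diff b a.
Proof. by rewrite mulN1r opprB. Qed.

Lemma ord_diff_neq0 a b : a != b -> ord_diff a b != 0.
Proof. by move=> ab; rewrite subr_eq0 eqr_nat eq_sym. Qed.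

Lemma ord_diff_real a b : (ord_diff a b)^* = ord_diff a b.
Proof. by rewrite rmorphB !rmorph_nat. Qed.

Lemma matching_sign_ord_diff (p : matching 'I_n) :
  matching_sign ord_diff p = (-1) ^+ sigma_matching p.
Proof.
have wE : word (matching_pairs p) = [seq sigma_matching p i | i <- enum 'I_n].
  have sz : size (word (matching_pairs p)) = n.
    by rewrite (perm_size (perm_matching_word p)) size_enum_ord.
  case: n p sz => [p /size0nil ->|m p sz].
    by apply/esym/size0nil; rewrite size_map size_enum_ord.
  have sz' : size [seq sigma_matching p i | i <- enum 'I_m.+1] = m.+1.
    by rewrite size_map size_enum_ord.
  apply: (eq_from_nth (x0 := ord0)) => [|i]; rewrite sz ?sz' // => im.
  rewrite (nth_map ord0) ?size_enum_ord // sigma_matchingE nth_enum_ord //.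
  by apply: set_nth_default; rewrite -/(word _) sz.
rewrite /matching_sign wE alt_ord_diff_perm mulrC mulfK //.
apply: alt_neq0; last exact: enum_uniq.
exact: ord_diff_neq0.
Qed.

End VandermondeSign.

Section SymplecticForm.
Variables (R : realType) (N : nat).
Local Notation C := (Cplx R).
Hypothesis N_even : ~~ odd N.
Local Notation J := (symplectic_J R N).
Local Notation h := N./2.

Lemma symplectic_J_tr : J^T = -1 *: J.
Proof.
apply/matrixP => i j; rewrite !mxE mulN1r.
have Nh : N = (h + h)%N by rewrite addnn even_halfK.
have [ij|_] := eqVneq (i : nat) (j + h)%N.
  by rewrite ifN ?opprK //; apply/eqP; have := ltn_ord i; lia.
by case: ifP; rewrite ?opprK ?oppr0.
Qed.

Lemma symplectic_J_mul_tr : J *m J^T = 1%:M.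
Proof.
have Nh : N = (h + h)%N by rewrite addnn even_halfK.
apply/matrixP => i k; rewrite !mxE; under eq_bigr do rewrite mxE.
have [ih|hi] := ltnP i h.
  have lt : (i + h < N)%N by lia.
  rewrite (bigD1 (Ordinal lt)) //= big1 => [|j jn]; last first.
    rewrite mxE ifN; last by apply: contra jn.
    by rewrite ifN ?mul0r //; apply/eqP; lia.
  rewrite !mxE /= eqxx mul1r addr0 eqn_add2r.
  have [->|ki] := eqVneq k i; first by rewrite !eqxx.
  rewrite ifN; last by rewrite eq_sym.
  rewrite ifN //.
  by apply/eqP; have := ltn_ord k; lia.
have lt : (i - h < N)%N by have := ltn_ord i; lia.
rewrite (bigD1 (Ordinal lt)) //= big1 => [|j jn]; last first.
  rewrite mxE ifN; last by apply/eqP; have := ltn_ord j; lia.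
  rewrite ifN ?mul0r //; apply: contra jn => /eqP ij; apply/eqP/val_inj => /=.
  by rewrite ij addnK.
rewrite !mxE /= addr0 subnK // eqxx.
have i0 : (0 < h)%N by have := ltn_ord i; lia.
rewrite ifN; last by apply/eqP; lia.
rewrite ifN; last by apply/eqP; have := ltn_ord i; lia.
have [->|ki] := eqVneq k i; first by rewrite !eqxx mulrNN mulr1.
by rewrite val_eqE (negPf ki) mulr0.
Qed.

Lemma symplectic_J_real : map_mx Num.conj J = J.
Proof.
apply/matrixP => i j; rewrite !mxE; case: ifP => _; first by rewrite rmorph1.
by case: ifP => _; rewrite ?rmorphN1 ?rmorph0.
Qed.

End SymplecticForm.

(** * The two limits *)
Section Diagrams.
Variables (R : realType) (N n : nat).
Local Notation C := (Cplx R).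
Local Notation rC := (@real_to_C R).
Implicit Types p q : matching 'I_n.

Lemma forall_bracket p q (v : 'I_n + 'I_n -> 'I_N) :
  [forall b in bracket p q, forall x in b, forall y in b, v x == v y] =
  all (fun ab => v (inl ab.1) == v (inl ab.2)) (matching_pairs p) &&
  all (fun ab => v (inr ab.1) == v (inr ab.2)) (matching_pairs q).
Proof.
have blk (r : matching 'I_n) (g : 'I_n -> 'I_N) : (forall b, b \in val r ->
    forall x y, x \in b -> y \in b -> g x = g y) <->
    all (fun ab => g ab.1 == g ab.2) (matching_pairs r).
  have -> : all (fun ab => g ab.1 == g ab.2) (matching_pairs r) =
      all (fun ab => [ffun x => g x] ab.1 == [ffun x => g x] ab.2) (matching_pairs r).
    by apply: eq_all => ab; rewrite !ffunE.
  rewrite all_matching_pairs; split=> [h|/forallP h b br x y xb yb].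
    apply/forallP => a; apply/forallP => b; apply/implyP => /andP[ab abr].
    by rewrite !ffunE; apply/eqP/(h _ abr); rewrite !inE eqxx ?orbT.
  have [->//|xy] := eqVneq x y; have /forallP/(_ y)/implyP := h x; rewrite xy !ffunE.
  have -> : [set x; y]%SET = b.
    apply/eqP; rewrite eqEcard; apply/andP; split.
      by apply/fintype.subsetP => z; rewrite !inE => /orP[]/eqP ->.
    have /andP[_ /forall_inP/(_ _ br)/eqP ->] := valP r.
    by rewrite cards2 xy.
  by rewrite br => /(_ isT)/eqP.
apply/idP/andP => [/forall_inP h|[hp hq]].
  split; [apply/(blk p (fun r => v (inl r))) | apply/(blk q (fun r => v (inr r)))] => b bp x y xb yb.
    have bb : [set inl z | z in b]%SET \in bracket p q by rewrite inE imset_f.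
    by have /forall_inP/(_ _ (imset_f inl xb))/forall_inP/(_ _ (imset_f inl yb))/eqP := h _ bb.
  have bb : [set inr z | z in b]%SET \in bracket p q by rewrite inE imset_f ?orbT.
  by have /forall_inP/(_ _ (imset_f inr xb))/forall_inP/(_ _ (imset_f inr yb))/eqP := h _ bb.
apply/forall_inP => b; rewrite inE => /orP[]/imsetP[c cp ->]; apply/forall_inP => _ /imsetP[x xc ->];
  apply/forall_inP => _ /imsetP[y yc ->]; apply/eqP.
  by have /(blk p (fun r => v (inl r)))/(_ c cp x y xc yc) := hp.
by have /(blk q (fun r => v (inr r)))/(_ c cp x y xc yc) := hq.
Qed.

Lemma rho_plus_bracket p q x y : rho_plus R N (bracket p q) x y =
  form_prod (1%:M : 'M[C]_N) (matching_pairs p) (enum_val x) *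
  form_prod (1%:M : 'M[C]_N) (matching_pairs q) (enum_val y).
Proof.
have fb := forall_bracket p q (fun u => match u with
  | inl r => (enum_val x : {ffun 'I_n -> 'I_N}) r
  | inr r => (enum_val y : {ffun 'I_n -> 'I_N}) r end).
rewrite !form_prod1 -natrM mulnb -fb.
by rewrite [LHS]mxE.
Qed.

Lemma projector_orthogonal :
  projector (pairing_mx (1%:M : 'M[C]_N) (fun _ _ => 1)) (weingarten_mx n 1 N%:R) =
  \sum_(p : matching 'I_n) \sum_(q : matching 'I_n)
      rC (Wg (N%:R : R) p q) *: rho_plus R N (bracket p q).
Proof.
apply/matrixP => x y; rewrite projector_entry summxE; apply: eq_bigr => p _.
rewrite summxE; apply: eq_bigr => q _; rewrite mxE rho_plus_bracket; congr (_ * _).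
by rewrite /matching_sign !alt_1 invr1 expr1n !mul1r.
Qed.

Lemma projector_symplectic :
  projector (pairing_mx (symplectic_J R N) (@ord_diff R n)) (weingarten_mx n (-1) (- N%:R)) =
  \sum_(p : matching 'I_n) \sum_(q : matching 'I_n)
      rC (Wg (- N%:R : R) p q) *: rho_minus_bracket R N p q.
Proof.
apply/matrixP => x y; rewrite projector_entry summxE; apply: eq_bigr => p _.
rewrite summxE; apply: eq_bigr => q _; rewrite mxE; congr (_ * _).
by rewrite !matching_sign_ord_diff [RHS]mxE.
Qed.

End Diagrams.

Section Limits.
Variables (R : realType) (n : nat).
Local Notation C := (Cplx R).
Local Open Scope sesquilinear_scope.

Lemma orthogonal_limit (N : nat) (d d' : measure_display)
    (Om : measurableType d) (P : probability Om R)
    (Om' : measurableType d') (P' : probability Om' R)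
    (B : R -> Om -> 'M[Cplx R]_N) (O0 : Om' -> 'M[Cplx R]_N) :
  (0 < N)%N ->
  brownian_motion (@special_orthogonal_group R N) P B \/
  brownian_motion (@orthogonal_group R N) P B ->
  random_mx O0 -> (forall w, orthogonal_group (O0 w)) ->
  expectationC P' (fun w => \det (O0 w)) = 0 ->
  expectation_mx P (fun w => tensor_power n (B T w)) *m
      expectation_mx P' (fun w => tensor_power n (O0 w)) @[T --> +oo] -->
    \sum_(p : matching 'I_n) \sum_(q : matching 'I_n)
      real_to_C (Wg (N%:R : R) p q) *: rho_plus R N (bracket p q).
Proof.
move=> N0 bB rO oO E0; rewrite -projector_orthogonal.
have KT : (1%:M : 'M[C]_N)^T = 1 *: 1%:M by rewrite trmx1 scale1r.
have KKT : (1%:M : 'M[C]_N) *m 1%:M^T = 1%:M by rewrite trmx1 mulmx1.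
have Kreal : map_mx Num.conj (1%:M : 'M[C]_N) = 1%:M by rewrite map_mx1.
have [Pi PiK lim] : exists2 Pi : tensor_End R N n, invariant_projection 1%:M Pi &
    expectation_mx P (fun w => tensor_power n (B t w)) @[t --> +oo] --> Pi.
  case: bB => bB; apply: (brownian_mean_limit n KT KKT Kreal (mulr1 1) _ _ bB).
  - by rewrite -orthogonal_group_form => g [].
  - exact: lie_algebra_special_orthogonal.
  - by rewrite -orthogonal_group_form.
  - by rewrite orthogonal_group_form; exact: (lie_algebra_form_group KT KKT (mulr1 1)).
have oI w : (O0 w)^T *m O0 w = 1%:M by case: (oO w).
apply: (weingarten_limit (eps := 1) KT KKT Kreal (mulr1 1) _ _ _ N0 _ PiK lim).
- by move=> a b; rewrite mulr1.
- by move=> a b _; exact: oner_neq0.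
- by move=> a b; rewrite rmorph1.
- by rewrite rC_nat mul1r.
- apply: (orthogonal_mean_fix P' rO oO) => w.
  by apply: (pairing_mx_fix _ (X' := (O0 w)^T)); rewrite ?mulmx1 ?oI.
move=> u ku pu; apply: (orthogonal_mean_kill rO oO E0) => w.
apply: (FFT_sym KT KKT ku pu) => //.
  rewrite mulmx1 -map_trmx (orthogonal_conj oO) trmxK; exact: mulmx1C.
rewrite -map_trmx (orthogonal_conj oO); apply/unitarymxP.
by rewrite trmxK (orthogonal_conj oO).
Qed.

Lemma symplectic_limit (N : nat) (d : measure_display)
    (Om : measurableType d) (P : probability Om R) (B : R -> Om -> 'M[Cplx R]_N) :
  (0 < N)%N -> ~~ odd N -> brownian_motion (@symplectic_group R N) P B ->
  expectation_mx P (fun w => tensor_power n (B T w)) @[T --> +oo] -->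
    \sum_(p : matching 'I_n) \sum_(q : matching 'I_n)
      real_to_C (Wg (- N%:R : R) p q) *: rho_minus_bracket R N p q.
Proof.
move=> N0 Ne bB; rewrite -projector_symplectic.
have KT := symplectic_J_tr R Ne; have KKT := symplectic_J_mul_tr R Ne.
have Kreal := symplectic_J_real R N.
have e2 : (-1 : C) * -1 = 1 by rewrite mulrNN mulr1.
have [//|Pi PiK lim] := brownian_mean_limit n KT KKT Kreal e2 _
  (lie_algebra_form_group KT KKT e2) bB.
have -> : (fun T => expectation_mx P (fun w => tensor_power n (B T w))) =
    (fun T => expectation_mx P (fun w => tensor_power n (B T w)) *m 1%:M).
  by apply/funext => T; rewrite mulmx1.
apply: (weingarten_limit (eps := -1) KT KKT Kreal e2 _ _ _ N0 _ PiK lim).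
- exact: ord_diffC.
- exact: ord_diff_neq0.
- exact: ord_diff_real.
- by rewrite rCN rC_nat mulN1r.
- by rewrite trmx1 map_mx1 mul1mx.
by move=> u ku pu; rewrite (FFT_antisym KT KKT e2 ku pu) ?mulmx0.
Qed.

End Limits.

Theorem theorem6p41 (R : realType) (n : nat) (n_ge2 : (2 <= n)%N)
    (n_even : ~~ odd n) :
  (forall (N : nat) (d d' : measure_display)
      (Om : measurableType d) (P : probability Om R)
      (Om' : measurableType d') (P' : probability Om' R)
      (B : R -> Om -> 'M[Cplx R]_N) (O0 : Om' -> 'M[Cplx R]_N),
    (1 <= N)%N ->
    brownian_motion (@special_orthogonal_group R N) P B \/
    brownian_motion (@orthogonal_group R N) P B ->
    random_mx O0 ->
    (forall w, orthogonal_group (O0 w)) ->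
    P' [set w | \det (O0 w) = 1] = P' [set w | \det (O0 w) = -1] \/
    expectationC P' (fun w => \det (O0 w)) = 0 ->
    expectation_mx P (fun w => tensor_power n (B T w)) *m
      expectation_mx P' (fun w => tensor_power n (O0 w)) @[T --> +oo] -->
    \sum_(p : matching 'I_n) \sum_(q : matching 'I_n)
      real_to_C (Wg (N%:R : R) p q) *: rho_plus R N (bracket p q)) /\
  (forall (N : nat) (d : measure_display)
      (Om : measurableType d) (P : probability Om R)
      (B : R -> Om -> 'M[Cplx R]_N),
    (2 <= N)%N -> ~~ odd N ->
    brownian_motion (@symplectic_group R N) P B ->
    expectation_mx P (fun w => tensor_power n (B T w)) @[T --> +oo] -->
    \sum_(p : matching 'I_n) \sum_(q : matching 'I_n)
      real_to_C (Wg (- N%:R : R) p q) *: rho_minus_bracket R N p q).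
Proof.
split=> [N d d' Om P Om' P' B O0 N0 bB rO oO EO|N d Om P B N2 Ne bB].
  apply: orthogonal_limit => //; case: EO => // EO.
  exact: expectation_det0.
by apply: symplectic_limit => //; exact: ltnW.
Qed.
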